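(* Let $n$ be fixed and assume $\Sigma,\mathcal{A},\mathcal{S}_0, m,\mathcal{CS},k,D_{max}$ and the functions next, critical, mustTick as described below. The problem of determining whether $\mathcal{A}$ satisfies $n$-time-bounded survivability with respect to the lazy time sampling, $\mathcal{CS}$ and $\mathcal{S}_0$ is in the class $\Delta_2^p$ of the polynomial hierarchy ($P^{NP}$) with input $\mathcal{S}_0$.
   Context: Timed multiset rewriting (MSR) setting. $\Sigma$ is a finite first-order typed alphabet. Configurations are multisets of ground timestamped facts $F@t$ ($t\in\mathbb{N}$) with exactly one fact $Time@t$ (global time). Rules are the Tick rule $Time@T \to Time@(T+1)$ and instantaneous rules $Time@T, \mathcal{W}, F_1@T_1', \ldots, F_n@T_n' \mid \mathcal{C} \to Time@T, \mathcal{W}, Q_1@(T+D_1), \ldots, Q_m@(T+D_m)$, with guards of constraints $T > T' \pm N$ or $T = T' \pm N$. $\mathcal{A}$ is a progressive timed MSR (PTS): balanced ($n=m$ in every instantaneous rule), each instantaneous rule creates at least one fact with $D_i\geq 1$ and only consumes facts with timestamp $\leq T$. $\mathcal{S}_0$ is an initial configuration with $m$ facts, $k$ bounds the size (number of symbols) of facts, $D_{max}$ bounds the natural numbers in $\mathcal{S}_0$, $\mathcal{A}$, $\mathcal{CS}$. A trace uses the lazy time sampling if Tick is applied to a configuration only when no instantaneous rule is applicable to it. A critical configuration specification $\mathcal{CS}$ is a set of pairs $\langle \mathcal{S}_j,\mathcal{C}_j\rangle$ of fact patterns and time constraints; a configuration is critical if some instance $\mathcal{S}_j\sigma$ is contained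 in it with $\mathcal{C}_j\sigma$ true; a trace is compliant if it has no critical configuration. $\mathcal{A}$ is $n$-time-bounded realizable if some trace from $\mathcal{S}_0$ using the lazy time sampling is compliant with global time advancing by exactly $n$ units; it satisfies $n$-time-bounded survivability if it is $n$-time-bounded realizable and all traces from $\mathcal{S}_0$ using the lazy time sampling with exactly $n$ instances of the Tick rule are compliant. The functions next, critical and mustTick check, respectively, whether a rule is applicable to a given configuration, whether a configuration is critical w.r.t. $\mathcal{CS}$, and whether Tick must (1) or must not (0) be applied under the lazy time sampling; they run in time polynomial in the size of $\mathcal{S}_0$. *)

(* Defs.v *)
From HB Require Import structures.
From mathcomp Require Import all_boot all_order all_algebra.
Set Implicit Arguments. Unset Strict Implicit. Unset Printing Implicit Defensive.
Import GRing.Theory.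

(** * Turing machines and complexity classes *)

(* Languages are boolean predicates: every language of the classes below is
   decidable, so nothing is lost. *)
Definition language (A : finType) := pred (seq A).

Variant hmove := MoveL | Stay | MoveR.

(* A two-way infinite tape; [None] is the blank, [tleft] is listed from the cell
   next to the head outwards, and cells beyond either list are blank. *)
Record tape (G : Type) := Tape {
  tleft : seq (option G); tcur : option G; tright : seq (option G) }.

Definition blank_tape (G : Type) : tape G := Tape [::] None [::].

Definition input_tape (G : Type) (s : seq G) : tape G :=
  if s is x :: s' then Tape [::] (Some x) (map Some s') else blank_tape G.

Definition tape_act (G : Type) (t : tape G) (a : option G * hmove) : tape G :=
  let: Tape l _ r := t in
  match a.2 with
  | Stay => Tape l a.1 r
  | MoveL => Tape (behead l) (head None l) (a.1 :: r)
  | MoveR => Tape (a.1 :: l) (head None r) (behead r)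
  end.

(* Deterministic multi-tape machines with input alphabet [A]; the input is
   written on tape [ord0]. *)
Record machine (A : finType) := Machine {
  work_tapes : nat;
  mstate : finType;
  tsym : finType;
  inject : A -> tsym;
  start : mstate;
  verdict : mstate -> option bool;
  trans : mstate -> {ffun 'I_work_tapes.+1 -> option tsym} ->
          mstate * {ffun 'I_work_tapes.+1 -> option tsym * hmove} }.

Section MachineSemantics.
Variables (A : finType) (M : machine A).

Definition mconfig : Type :=
  (mstate M * ('I_(work_tapes M).+1 -> tape (tsym M)))%type.

Definition minit (x : seq A) : mconfig :=
  (start M, fun i => if i == ord0 then input_tape (map (@inject A M) x)
                     else blank_tape (tsym M)).

Definition mread (c : mconfig) : {ffun 'I_(work_tapes M).+1 -> option (tsym M)} :=
  [ffun i => tcur (c.2 i)].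

(* Configurations with a verdict are halted. *)
Definition mstep (c : mconfig) : mconfig :=
  if verdict c.1 is Some _ then c
  else let: (q, act) := trans c.1 (mread c) in
       (q, fun i => tape_act (c.2 i) (act i)).

End MachineSemantics.

Definition in_P (A : finType) (L : language A) : Prop :=
  exists (M : machine A) (p : {poly nat}), forall x : seq A,
    verdict (iter p.[size x]%R (@mstep A M) (minit M x)).1 = Some (L x).

(* Certificates [w] may use their own alphabet [C]; the disjoint union [A + C]
   makes the concatenation of [x] and [w] uniquely decodable. *)
Definition in_NP (A : finType) (L : language A) : Prop :=
  exists (C : finType) (V : language (A + C)%type) (p : {poly nat}),
    in_P V /\
    forall x : seq A, L x <->
      exists w : seq C, size w <= p.[size x]%R /\ V (map inl x ++ map inr w).

(* A machine with a write-only query tape over [B]: an ordinary transition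
   appends [emit] (if any) to the query word.  In a state with
   [ask q = Some (qyes, qno)] the oracle is consulted in a single step and the
   query tape is erased. *)
Record oracle_machine (A B : finType) := OracleMachine {
  base : machine A;
  ask : mstate base -> option (mstate base * mstate base);
  emit : mstate base -> {ffun 'I_(work_tapes base).+1 -> option (tsym base)} ->
         option B }.

Section OracleSemantics.
Variables (A B : finType) (M : oracle_machine A B) (O : language B).

Definition oconfig : Type := (mconfig (base M) * seq B)%type.

Definition ostep (c : oconfig) : oconfig :=
  let: (c0, w) := c in
  if verdict c0.1 is Some _ then c
  else if ask c0.1 is Some (qyes, qno) then
    ((if O w then qyes else qno, c0.2), [::])
  else (mstep c0, if emit c0.1 (mread c0) is Some b then rcons w b else w).

End OracleSemantics.

Definition in_P_oracle (A B : finType) (O : language B) (L : language A) : Prop :=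
  exists (M : oracle_machine A B) (p : {poly nat}), forall x : seq A,
    verdict (iter p.[size x]%R (@ostep A B M O) (minit (base M) x, [::])).1.1
      = Some (L x).

Definition in_Delta2p (A : finType) (L : language A) : Prop :=
  exists (B : finType) (O : language B), in_NP O /\ in_P_oracle O L.

(** * Timed multiset rewriting *)

Record alphabet := Alphabet {
  srt : finType;
  fsym : finType;
  fargs : fsym -> seq srt;
  fres : fsym -> srt;
  psym : finType;
  pargs : psym -> seq srt }.

Definition var (Sg : alphabet) : Type := (srt Sg * nat)%type.

Inductive term (Sg : alphabet) : Type :=
  | Var of var Sg
  | App of fsym Sg & seq (term Sg).
Arguments Var {Sg}. Arguments App {Sg}.

Section TermEq.
Variable Sg : alphabet.

Fixpoint term_tree (t : term Sg) : GenTree.tree (srt Sg * nat + fsym Sg) :=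
  match t with
  | Var v => GenTree.Leaf (inl v)
  | App f ts => GenTree.Node 0 (GenTree.Leaf (inr f) :: map term_tree ts)
  end.

Fixpoint tree_term (t : GenTree.tree (srt Sg * nat + fsym Sg)) :
    option (term Sg) :=
  match t with
  | GenTree.Leaf (inl v) => Some (Var v)
  | GenTree.Node _ (GenTree.Leaf (inr f) :: ts) =>
      Some (App f (pmap tree_term ts))
  | _ => None
  end.

Lemma term_treeK : pcancel term_tree tree_term.
Proof.
rewrite /pcancel; fix IH 1; case=> [v|f ts] //=; congr (Some (App f _)).
by elim: ts => //= t ts ->; rewrite IH.
Qed.

End TermEq.

HB.instance Definition _ (Sg : alphabet) :=
  Equality.copy (term Sg) (pcan_type (@term_treeK Sg)).

Section Terms.
Variable Sg : alphabet.

Fixpoint ground (t : term Sg) : bool :=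
  match t with Var _ => false | App _ ts => all ground ts end.

Fixpoint has_sort (t : term Sg) (s : srt Sg) : bool :=
  match t with
  | Var v => v.1 == s
  | App f ts => (fres f == s) && all2 has_sort ts (fargs f)
  end.

Fixpoint subst (sg : var Sg -> term Sg) (t : term Sg) : term Sg :=
  match t with Var v => sg v | App f ts => App f (map (subst sg) ts) end.

Fixpoint term_size (t : term Sg) : nat :=
  match t with Var _ => 1 | App _ ts => (sumn (map term_size ts)).+1 end.

Definition sorted_subst (sg : var Sg -> term Sg) : Prop :=
  forall v, has_sort (sg v) v.1.

End Terms.

Definition atom (Sg : alphabet) : Type := (psym Sg * seq (term Sg))%type.

Inductive fact (Sg : alphabet) : Type := Time | Pred of atom Sg.
Arguments Time {Sg}. Arguments Pred {Sg}.

Definition fact_opt (Sg : alphabet) (f : fact Sg) :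
    option (psym Sg * seq (term Sg)) :=
  if f is Pred a then Some a else None.
Definition opt_fact (Sg : alphabet) (o : option (psym Sg * seq (term Sg))) :
    fact Sg := if o is Some a then Pred a else Time.
Lemma fact_optK (Sg : alphabet) : cancel (@fact_opt Sg) (@opt_fact Sg).
Proof. by case. Qed.
HB.instance Definition _ (Sg : alphabet) :=
  Equality.copy (fact Sg) (can_type (@fact_optK Sg)).

Section Facts.
Variable Sg : alphabet.

Definition sorted_atom (a : atom Sg) : bool := all2 (@has_sort Sg) a.2 (pargs a.1).
Definition sorted_fact (f : fact Sg) : bool :=
  if f is Pred a then sorted_atom a else true.
Definition ground_fact (f : fact Sg) : bool :=
  if f is Pred a then all (@ground Sg) a.2 else true.

(* The number of symbols of the fact; timestamps do not count. *)
Definition fact_size (f : fact Sg) : nat :=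
  if f is Pred a then (sumn (map (@term_size Sg) a.2)).+1 else 1.

Definition subst_atom (sg : var Sg -> term Sg) (a : atom Sg) : atom Sg :=
  (a.1, map (subst sg) a.2).
Definition subst_fact (sg : var Sg -> term Sg) (f : fact Sg) : fact Sg :=
  if f is Pred a then Pred (subst_atom sg a) else Time.

(* [(f, t)] is the timestamped fact f@t.  Multisets are lists, always compared
   and decomposed up to [perm_eq]. *)
Definition tfact : Type := (fact Sg * nat)%type.
Definition config : Type := seq tfact.

Definition is_config (S : config) : bool :=
  all (fun f : tfact => ground_fact f.1 && sorted_fact f.1) S
  && (count (fun f : tfact => f.1 == Time) S == 1).

Definition gtime (S : config) : nat :=
  head 0 [seq f.2 | f : tfact <- S & f.1 == Time].

End Facts.

(** ** Time constraints *)

(* In a rule, the time variable [tT] is the timestamp of Time. *)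
Definition tvar := nat.
Definition tT : tvar := 0.

(* [CGt x y N] is x > y + N and [CEq x y N] is x = y + N; the integer N covers
   both signs of "y +/- N". *)
Inductive constr := CGt of tvar & tvar & int | CEq of tvar & tvar & int.

Definition constr_tuple (c : constr) : bool * tvar * tvar * int :=
  match c with CGt x y N => (true, x, y, N) | CEq x y N => (false, x, y, N) end.
Definition tuple_constr (u : bool * tvar * tvar * int) : constr :=
  let: (b, x, y, N) := u in if b then CGt x y N else CEq x y N.
Lemma constr_tupleK : cancel constr_tuple tuple_constr.
Proof. by case. Qed.
HB.instance Definition _ := Equality.copy constr (can_type constr_tupleK).

Definition holds (tau : tvar -> nat) (c : constr) : bool :=
  match c with
  | CGt x y N => ((tau x)%:Z > (tau y)%:Z + N)%R
  | CEq x y N => ((tau x)%:Z == (tau y)%:Z + N)%R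
  end.

Definition constr_vars (c : constr) : seq tvar :=
  match c with CGt x y _ | CEq x y _ => [:: x; y] end.
Definition constr_num (c : constr) : nat :=
  match c with CGt _ _ N | CEq _ _ N => `|N|%N end.

(** ** Rules *)

(* Time@T, wpre, fpre | guard --> Time@T, wpre, post.  An entry [(a, x)] of
   [wpre] or [fpre] is the pattern a@x with x a time variable, an entry [(a, d)]
   of [post] is a@(T + d). *)
Record irule (Sg : alphabet) := IRule {
  wpre : seq (atom Sg * tvar);
  fpre : seq (atom Sg * tvar);
  guard : seq constr;
  post : seq (atom Sg * nat) }.

Definition irule_tuple (Sg : alphabet) (r : irule Sg) :
  seq (psym Sg * seq (term Sg) * nat) * seq (psym Sg * seq (term Sg) * nat)
    * seq constr * seq (psym Sg * seq (term Sg) * nat) :=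
  (wpre r, fpre r, guard r, post r).
Definition tuple_irule (Sg : alphabet) u : irule Sg :=
  let: (w, f, g, q) := u in IRule w f g q.
Lemma irule_tupleK (Sg : alphabet) : cancel (@irule_tuple Sg) (@tuple_irule Sg).
Proof. by case. Qed.
HB.instance Definition _ (Sg : alphabet) :=
  Equality.copy (irule Sg) (can_type (@irule_tupleK Sg)).

Inductive rule (Sg : alphabet) : Type := Tick | Inst of irule Sg.
Arguments Tick {Sg}. Arguments Inst {Sg}.

Definition rule_opt (Sg : alphabet) (r : rule Sg) : option (irule Sg) :=
  if r is Inst i then Some i else None.
Definition opt_rule (Sg : alphabet) (o : option (irule Sg)) : rule Sg :=
  if o is Some i then Inst i else Tick.
Lemma rule_optK (Sg : alphabet) : cancel (@rule_opt Sg) (@opt_rule Sg).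
Proof. by case. Qed.
HB.instance Definition _ (Sg : alphabet) :=
  Equality.copy (rule Sg) (can_type (@rule_optK Sg)).

Section Systems.
Variable Sg : alphabet.
Implicit Types (S : config Sg) (r : irule Sg).

(* A timed MSR is given by its instantaneous rules; Tick is always present. *)
Definition system : Type := seq (irule Sg).
Implicit Types A : system.

Definition rules A : seq (rule Sg) := Tick :: map Inst A.

Definition wf_irule r : bool :=
  [&& all (fun p : atom Sg * tvar => sorted_atom p.1) (wpre r ++ fpre r),
      all (fun p : atom Sg * nat => sorted_atom p.1) (post r)
    & all (fun x => x \in tT :: [seq p.2 | p <- wpre r ++ fpre r])
          (flatten (map constr_vars (guard r)))].

Definition pre_inst (sg : var Sg -> term Sg) (tau : tvar -> nat)
    (p : seq (atom Sg * tvar)) : config Sg :=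
  [seq (Pred (subst_atom sg u.1), tau u.2) | u <- p].
Definition post_inst (sg : var Sg -> term Sg) (t : nat)
    (p : seq (atom Sg * nat)) : config Sg :=
  [seq (Pred (subst_atom sg u.1), t + u.2) | u <- p].

(* [sg] may send variables to non-ground terms (a sort need not have ground
   terms); [is_config S'] makes the instance of the rule ground. *)
Definition fires (rl : rule Sg) S S' : Prop :=
  match rl with
  | Tick => exists t R,
      perm_eq S ((Time, t) :: R) /\ perm_eq S' ((Time, t.+1) :: R)
  | Inst r => exists sg tau R,
      [/\ sorted_subst sg, all (holds tau) (guard r), is_config S',
          perm_eq S ((Time, tau tT) ::
            pre_inst sg tau (wpre r) ++ pre_inst sg tau (fpre r) ++ R)
        & perm_eq S' ((Time, tau tT) ::
            pre_inst sg tau (wpre r) ++ post_inst sg (tau tT) (post r) ++ R)]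
  end.

Definition applicable (rl : rule Sg) S : Prop := exists S', fires rl S S'.

Definition balanced r : bool := size (fpre r) == size (post r).

Definition progressive A : Prop :=
  forall r, r \in A ->
    [/\ balanced r, has (fun q : atom Sg * nat => 1 <= q.2) (post r)
      & forall tau, all (holds tau) (guard r) ->
          all (fun f : atom Sg * tvar => tau f.2 <= tau tT) (fpre r)].

(** ** Traces *)

(* A finite trace from [S] lists the rules applied and the configurations
   reached. *)
Fixpoint is_trace A S (tr : seq (rule Sg * config Sg)) : Prop :=
  if tr is (rl, S') :: tr' then
    [/\ rl \in rules A, fires rl S S' & is_trace A S' tr']
  else True.

Definition must_tick A S : Prop := forall r, r \in A -> ~ applicable (Inst r) S.

Fixpoint lazy_sampling A S (tr : seq (rule Sg * config Sg)) : Prop :=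
  if tr is (rl, S') :: tr' then
    (rl = Tick -> must_tick A S) /\ lazy_sampling A S' tr'
  else True.

Definition ticks (tr : seq (rule Sg * config Sg)) : nat :=
  count (fun u => u.1 == Tick) tr.

Definition trace_configs S (tr : seq (rule Sg * config Sg)) : seq (config Sg) :=
  S :: [seq u.2 | u <- tr].

(** ** Critical configurations *)

Definition crit_spec : Type := seq (seq (fact Sg * tvar) * seq constr).
Implicit Types CS : crit_spec.

Definition wf_crit_spec CS : bool :=
  all (fun c : seq (fact Sg * tvar) * seq constr =>
         all (fun p : fact Sg * tvar => sorted_fact p.1) c.1
         && all (fun x => x \in [seq p.2 | p <- c.1])
                (flatten (map constr_vars c.2))) CS.

Definition is_critical CS S : Prop :=
  exists c sg tau R,
    [/\ c \in CS, sorted_subst sg, all (holds tau) c.2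
      & perm_eq S ([seq (subst_fact sg p.1, tau p.2) | p <- c.1] ++ R)].

Definition compliant CS S tr : Prop :=
  forall S', S' \in trace_configs S tr -> ~ is_critical CS S'.

Definition realizable A CS (n : nat) S : Prop :=
  exists tr, [/\ is_trace A S tr, lazy_sampling A S tr, compliant CS S tr
               & gtime (last S (trace_configs S tr)) = gtime S + n].

Definition survivable A CS (n : nat) S : Prop :=
  realizable A CS n S /\
  forall tr, is_trace A S tr -> lazy_sampling A S tr -> ticks tr = n ->
    compliant CS S tr.

(** ** Standing assumptions on an input *)

Definition fact_bound A S (k : nat) : Prop :=
  forall tr, is_trace A S tr ->
    all (all (fun f : tfact Sg => fact_size f.1 <= k)) (trace_configs S tr).

Definition num_bound A CS S (D : nat) : bool :=
  [&& all (fun f : tfact Sg => f.2 <= D) S,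
      all (fun r => all (fun c => constr_num c <= D) (guard r)
                    && all (fun q : atom Sg * nat => q.2 <= D) (post r)) A
    & all (fun c : seq (fact Sg * tvar) * seq constr =>
             all (fun d => constr_num d <= D) c.2) CS].

Definition admissible A CS S (m k Dmax : nat) : Prop :=
  [/\ is_config S, size S = m, fact_bound A S k & num_bound A CS S Dmax].

(** ** Encoding of configurations *)

(* [None] is the symbol Time. *)
Definition letter : finType := option (psym Sg + fsym Sg + bool)%type.

Fixpoint encode_term (t : term Sg) : seq letter :=
  match t with
  | Var _ => [::]
  | App f ts => Some (inl (inr f)) :: flatten (map encode_term ts)
  end.

Fixpoint bits_rec (fuel n : nat) : seq bool :=
  if fuel is fuel'.+1 then
    if n == 0 then [::] else odd n :: bits_rec fuel' n./2
  else [::].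
Definition bits (n : nat) : seq bool := bits_rec n n.

(* Timestamps are in binary.  No separators are needed: arities are fixed by
   the alphabet and every fact starts with a predicate symbol or Time. *)
Definition encode_tfact (f : tfact Sg) : seq letter :=
  (if f.1 is Pred a then
     Some (inl (inl a.1)) :: flatten (map encode_term a.2)
   else [:: None])
  ++ [seq Some (inr b) | b <- bits f.2].

Definition encode S : seq letter := flatten (map encode_tfact S).

(* Polynomial-time computability of a 0/1-valued function of configurations. *)
Definition ptime_config (f : config Sg -> bool) : Prop :=
  exists L : language letter, in_P L /\
    forall S, is_config S -> L (encode S) = f S.

End Systems.

(* Main.v *)
Require Import Defs.
From HB Require Import structures.
From mathcomp Require Import all_boot all_order all_algebra.
From mathcomp Require Import zify.
From Stdlib Require Import FunctionalExtensionality.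
Import GRing.Theory.
Set Implicit Arguments. Unset Strict Implicit. Unset Printing Implicit Defensive.

(** Survivability is the conjunction of "some lazy trace with [n] ticks meets no
    critical configuration" and the negation of "some lazy trace with [n] ticks
    meets one", so two queries to one NP oracle suffice.  Every instantaneous
    rule of a progressive system increases the number of facts whose timestamp
    exceeds the global time; hence a trace with [n] ticks has
    O(m (n + 1)) steps, its timestamps exceed those of the initial configuration
    by a constant, and it has a polynomial-size certificate.

    A certificate is a list of blocks, each of which rewrites one encoded
    configuration into the next: a tick, a rule applied to a configuration that
    lists the matched facts first and in order, or an exchange of two adjacent
    segments, which accounts for multisets being lists.  Since the encoding is
    uniquely decodable, checking a block reduces to equalities between
    concatenations of words supplied by the certificate, binary increments and
    comparisons, parsing of ground terms and calls of the given machines.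

    Polynomial time is established once and for all for a small language of
    programs with stacks, compiled to Turing machines; the functions it computes
    are closed under composition, concatenation, pushdown transduction and
    mapping over the blocks of a word. *)

(** * Stack programs *)

(** The verifier has to be an actual Turing machine, and the checker is shaped by what passes with a
    single stack can do. A certificate therefore spells out every word that would otherwise have to
    be searched for: both configurations of a block, the unmatched rest and the value of each
    variable; what remains is to compare concatenations. Soundness hinges on the cuts proposed by a
    certificate falling between facts, which [startok] guarantees.

    Timestamps are in binary, so those of the input may be exponential in its length. The checker
    never counts up to one of them; it increments by constants of the rules and compares. As [n] is
    fixed, [n + max_delay] only adds a constant to the number of bits.

    One checker serves both queries: the query alphabet is doubled, the copy in use tells which
    query is asked, and the checker requires that a critical configuration occurs exactly for the
    second kind.

    The size [k] of facts is not part of the input; the promise [k <= q.[size (encode S0)]] is what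
    makes the length of certificates a polynomial in the input alone. *)

Section Programs.
Variable G : finType.

(* Infinitely many stacks; the head of a list is the top. *)
Definition store := nat -> seq G.
Definition upd (s : store) i v : store := fun j => if j == i then v else s j.

(* [Auto q i nxt body] is a loop with finite control: in state [q], with [o] the
   top of stack [i], it runs [body q o] and goes on in the state [nxt q o]. *)
Inductive cmd : Type :=
| Nop
| Push of nat & G
| Pop of nat
| Seq of cmd & cmd
| Auto (Q : finType) of Q & nat & (Q -> option G -> option Q)
    & (Q -> option G -> cmd).

(** The time is an upper bound, with slack in every rule, so that estimates can be weakened at will.
    The strict inequalities in the rules for [Auto] pay for inspecting the top of the stack. *)
Inductive exec : cmd -> store -> nat -> store -> Prop :=
| ENop s T : 0 < T -> exec Nop s T s
| EPush i g s T : 0 < T -> exec (Push i g) s T (upd s i (g :: s i))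
| EPop i s T : 0 < T -> exec (Pop i) s T (upd s i (behead (s i)))
| ESeq c1 c2 s s1 s2 T1 T2 T : exec c1 s T1 s1 -> exec c2 s1 T2 s2 ->
    T1 + T2 <= T -> exec (Seq c1 c2) s T s2
| EAutoEnd (Q : finType) (q : Q) i nxt body s s1 T1 T :
    exec (body q (ohead (s i))) s T1 s1 -> nxt q (ohead (s i)) = None ->
    T1 < T -> exec (Auto q i nxt body) s T s1
| EAutoStep (Q : finType) (q q' : Q) i nxt body s s1 s2 T1 T2 T :
    exec (body q (ohead (s i))) s T1 s1 -> nxt q (ohead (s i)) = Some q' ->
    exec (Auto q' i nxt body) s1 T2 s2 -> T1 + T2 < T ->
    exec (Auto q i nxt body) s T s2.

Lemma exec_le c s T T' s' : T <= T' -> exec c s T s' -> exec c s T' s'.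
Proof.
move=> leT h; case: h leT.
- by move=> *; apply: ENop; lia.
- by move=> *; apply: EPush; lia.
- by move=> *; apply: EPop; lia.
- by move=> *; apply: ESeq; eauto; lia.
- by move=> *; apply: EAutoEnd; eauto; lia.
- by move=> *; apply: EAutoStep; eauto; lia.
Qed.

Fixpoint uses (c : cmd) (K : nat) : Prop :=
  match c with
  | Nop => True
  | Push i _ | Pop i => i < K
  | Seq c1 c2 => uses c1 K /\ uses c2 K
  | Auto Q _ i _ body => i < K /\ forall q o, uses (body q o) K
  end.

Lemma uses_le c K K' : K <= K' -> uses c K -> uses c K'.
Proof.
move=> le; elim: c => //=.
- by move=> i _ h; apply: leq_trans le.
- by move=> i h; apply: leq_trans le.
- by move=> c1 h1 c2 h2 [u1 u2]; split; auto.
- by move=> Q q i nxt body IH [h1 h2]; split; [apply: leq_trans le | auto].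
Qed.

(** A unit of time pushes at most one letter; this is what keeps intermediate results polynomial
    when programs are composed. *)
Lemma exec_size c s T s' i : exec c s T s' -> size (s' i) <= size (s i) + T.
Proof.
elim=> {c s T s'}.
- by lia.
- by move=> j g s T; rewrite /upd; case: eqP => [->|] /=; lia.
- by move=> j s T; rewrite /upd; case: eqP => [->|]; rewrite ?size_behead; lia.
- by move=> *; lia.
- by move=> *; lia.
- by move=> *; lia.
Qed.

Definition merge_store K (s s0 : store) : store := fun i => if i < K then s i else s0 i.

(** A frame rule: a caller may keep data on the stacks from [K] on while it runs a program confined
    to those below [K]. *)
Lemma exec_frame c s T s' : exec c s T s' -> forall K s0, uses c K ->
  exec c (merge_store K s s0) T (merge_store K s' s0).
Proof.
have mupd K r r0 i v : i < K ->
    merge_store K (upd r i v) r0 = upd (merge_store K r r0) i v.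
  move=> iK; apply: functional_extensionality => j; rewrite /merge_store /upd.
  by case: (eqVneq j i) => // ->; rewrite iK.
have mE K r r0 i : i < K -> merge_store K r r0 i = r i by rewrite /merge_store => ->.
elim=> {c s T s'} /=.
- by move=> s T T0 K s0 _; apply: ENop.
- by move=> i g s T T0 K s0 iK; rewrite mupd // -(mE K s s0 i iK); apply: EPush.
- by move=> i s T T0 K s0 iK; rewrite mupd // -(mE K s s0 i iK); apply: EPop.
- by move=> c1 c2 s s1 s2 T1 T2 T _ h1 _ h2 le K s0 [u1 u2]; apply: ESeq (le); auto.
- move=> Q q i nxt body s s1 T1 T _ h1 e le K s0 [iK u].
  by apply: EAutoEnd le; rewrite mE //; apply: h1.
- move=> Q q q' i nxt body s s1 s2 T1 T2 T _ h1 e _ h2 le K s0 [iK u].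
  by apply: EAutoStep (le); [rewrite mE //; apply: h1 | rewrite mE | apply: h2].
Qed.

(** ** Compilation to Turing machines *)

Section Compile.
Variable K : nat.
Notation reads := {ffun 'I_K.+1 -> option G}.
Notation acts := {ffun 'I_K.+1 -> option G * hmove}.

Definition act_on (v : reads) (i : 'I_K.+1) (a : option G * hmove) : acts :=
  [ffun j => if j == i then a else (v j, Stay)].

(** Inside a round of a loop the state is tagged with the control state and the letter read on
    entry: the body depends on both, and [nxt] is consulted only after the body may have changed the
    stack. *)
Fixpoint St (c : cmd) : finType :=
  match c with
  | Nop | Pop _ => unit
  | Push _ _ => bool
  | Seq c1 c2 => (St c1 + St c2)%type
  | Auto Q _ _ _ body => (Q + {p : Q * option G & St (body p.1 p.2)})%type
  end.

Fixpoint st0 (c : cmd) : St c :=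
  match c with
  | Nop | Pop _ => tt
  | Push _ _ => false
  | Seq c1 c2 => inl (st0 c1)
  | Auto Q q _ _ _ => inl q
  end.

(** The next state [None] marks the last step. A push takes two steps because a machine writes
    before it moves: go left first, then write. *)
Fixpoint stp (c : cmd) : St c -> reads -> option (St c) * acts :=
  match c with
  | Nop => fun _ v => (None, act_on v ord0 (v ord0, Stay))
  | Push i g => fun b v =>
      if b then (None, act_on v (inord i) (Some g, Stay))
      else (Some true, act_on v (inord i) (v (inord i), MoveL))
  | Pop i => fun _ v => (None, act_on v (inord i) (None, MoveR))
  | Seq c1 c2 => fun q v =>
      match q with
      | inl q1 => let: (o, a) := stp q1 v in
          (Some (if o is Some q' then inl q' else inr (st0 c2)), a)
      | inr q2 => let: (o, a) := stp q2 v in (omap inr o, a)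
      end
  | Auto Q _ i nxt body => fun q v =>
      match q with
      | inl q1 => (Some (inr (existT (fun p => St (body p.1 p.2))
                     (q1, v (inord i)) (st0 (body q1 (v (inord i)))))),
                   act_on v ord0 (v ord0, Stay))
      | inr (existT p q2) => let: (o, a) := stp q2 v in
          (if o is Some q' then
             Some (inr (existT (fun p => St (body p.1 p.2)) p q'))
           else omap inl (nxt p.1 p.2), a)
      end
  end.

Definition tapes := 'I_K.+1 -> tape G.
Definition rd (tp : tapes) : reads := [ffun i => tcur (tp i)].
Definition tacts (tp : tapes) (a : acts) : tapes := fun i => tape_act (tp i) (a i).

Inductive runs (S : Type) (step : S -> reads -> option S * acts) :
    S -> tapes -> nat -> tapes -> Prop :=
| REnd q tp a : step q (rd tp) = (None, a) -> runs step q tp 1 (tacts tp a)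
| RStep q q' tp a n tp' : step q (rd tp) = (Some q', a) ->
    runs step q' (tacts tp a) n tp' -> runs step q tp n.+1 tp'.

Lemma runs_seqr c1 c2 q tp n tp1 :
  runs (@stp c2) q tp n tp1 -> runs (@stp (Seq c1 c2)) (inr q) tp n tp1.
Proof.
elim=> {q tp n tp1} [q tp a e|q q' tp a n tp1 e _ IH].
  by apply: REnd; rewrite /= e.
by apply: RStep IH; rewrite /= e.
Qed.

Lemma runs_seq c1 c2 q tp n tp1 m tp2 :
  runs (@stp c1) q tp n tp1 -> runs (@stp c2) (st0 c2) tp1 m tp2 ->
  runs (@stp (Seq c1 c2)) (inl q) tp (n + m) tp2.
Proof.
elim=> {q tp n tp1} [q tp a e h|q q' tp a n tp1 e _ IH h].
  by rewrite add1n; apply: RStep (runs_seqr c1 h); rewrite /= e.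
by rewrite addSn; apply: RStep (IH h); rewrite /= e.
Qed.

Section RunsAuto.
Variables (Q : finType) (q0 : Q) (i : nat) (nxt : Q -> option G -> option Q).
Variable (body : Q -> option G -> cmd).
Let instate q o (st : St (body q o)) : St (Auto q0 i nxt body) :=
  inr (existT (fun p => St (body p.1 p.2)) (q, o) st).

Lemma runs_auto_end q o st tp n tp1 : nxt q o = None ->
  runs (@stp (body q o)) st tp n tp1 ->
  runs (@stp (Auto q0 i nxt body)) (instate st) tp n tp1.
Proof.
move=> eN; elim=> {st tp n tp1} [st tp a e|st st' tp a n tp1 e _ IH].
  by apply: REnd; rewrite /= e eN.
by apply: RStep IH; rewrite /= e.
Qed.

Lemma runs_auto_step q o q' st tp n tp1 m tp2 : nxt q o = Some q' ->
  runs (@stp (body q o)) st tp n tp1 ->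
  runs (@stp (Auto q0 i nxt body)) (inl q') tp1 m tp2 ->
  runs (@stp (Auto q0 i nxt body)) (instate st) tp (n + m) tp2.
Proof.
move=> eS; elim=> {st tp n tp1} [st tp a e h|st st' tp a n tp1 e _ IH h].
  by rewrite add1n; apply: RStep h; rewrite /= e eS.
by rewrite addSn; apply: RStep (IH h); rewrite /= e.
Qed.
End RunsAuto.

(* The stack lies to the right of the head, its top under the head, as the input
   does initially; only blanks are to the left. *)
Definition trep (t : tape G) (v : seq G) :=
  (forall n, nth None (tcur t :: tright t) n = nth None (map Some v) n) /\
  (forall n, nth None (tleft t) n = None).

Definition rep (tp : tapes) (s : store) := forall i, trep (tp i) (s i).

Lemma trep_cur t v : trep t v -> tcur t = ohead v.
Proof. by case=> /(_ 0) /= ->; case: v. Qed.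

Lemma rep_act_on tp s i a v : i < K.+1 -> rep tp s ->
  trep (tape_act (tp (inord i)) a) v ->
  rep (tacts tp (act_on (rd tp) (inord i) a)) (upd s i v).
Proof.
move=> iK h ht j; rewrite /tacts ffunE /upd; case: (eqVneq j (inord i)) => [->|ne].
  by rewrite inordK // eqxx.
rewrite ffunE; have -> : (j == i :> nat) = false.
  by apply/eqP=> e; case/eqP: ne; apply: val_inj; rewrite /= inordK.
by case: (tp j) (h j) => l c r.
Qed.

Lemma rep_stay tp s i : rep tp s -> rep (tacts tp (act_on (rd tp) i (rd tp i, Stay))) s.
Proof.
move=> h j; rewrite /tacts ffunE; case: eqP => [<-|_]; rewrite ffunE;
by case: (tp j) (h j) => l c r.
Qed.

Lemma trep_pop t v : trep t v -> trep (tape_act t (None, MoveR)) (behead v).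
Proof.
case: t => l c r [h1 h2]; split=> /=; last by case.
move=> n; have e := h1 n.+1.
have -> : nth None (head None r :: behead r) n = nth None r n.
  by clear; case: r => [|? ?]; case: n => //= n; rewrite nth_nil.
by rewrite (e : nth None r n = _); case: (v) => //=; rewrite nth_nil.
Qed.

Lemma trep_push t v g : trep t v ->
  trep (tape_act (tape_act t (tcur t, MoveL)) (Some g, Stay)) (g :: v).
Proof.
case: t => l c r [h1 h2]; split=> /= n; first by case: n => //= n; rewrite -h1.
by rewrite nth_behead.
Qed.

(** The factor 2 is the cost of a push; it also turns the unit of slack of each round of a loop into
    room for the step that enters the body. *)
Lemma exec_runs c s T s' : exec c s T s' -> uses c K.+1 -> forall tp, rep tp s ->
  exists t tp', [/\ runs (@stp c) (st0 c) tp t tp', rep tp' s' & t <= 2 * T].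
Proof.
elim=> {c s T s'} /=.
- move=> s T T0 _ tp h; exists 1; eexists; split; last by lia.
  + by apply: REnd; reflexivity.
  + exact: rep_stay.
- move=> i g s T T0 iK tp h; exists 2; eexists; split; last by lia.
  + by apply: RStep; [reflexivity | apply: REnd; reflexivity].
  + rewrite [rd tp _]ffunE.
    set tp1 := tacts tp _.
    have h1 : tp1 (inord i) = tape_act (tp (inord i)) (tcur (tp (inord i)), MoveL).
      by rewrite /tp1 /tacts ffunE eqxx.
    move=> j; rewrite /tacts ffunE /upd; case: (eqVneq j (inord i)) => [->|ne].
      by rewrite inordK // eqxx h1; apply: trep_push; rewrite -{2}(inordK iK).
    have -> : (j == i :> nat) = false.
      by apply/eqP=> e; case/eqP: ne; apply: val_inj; rewrite /= inordK.
    rewrite ffunE /tp1 /tacts ffunE (negPf ne) ffunE.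
    by case: (tp j) (h j).
- move=> i s T T0 iK tp h; exists 1; eexists; split; last by lia.
  + by apply: REnd; reflexivity.
  + by apply: rep_act_on => //; apply: trep_pop; have := h (inord i); rewrite inordK.
- move=> c1 c2 s s1 s2 T1 T2 T _ h1 _ h2 le [u1 u2] tp h.
  have [t1 [tp1 [r1 e1 l1]]] := h1 u1 _ h.
  have [t2 [tp2 [r2 e2 l2]]] := h2 u2 _ e1.
  exists (t1 + t2), tp2; split=> //; last by lia.
  exact: runs_seq r1 r2.
- move=> Q q i nxt body s s1 T1 T _ h1 e le [iK u] tp h.
  have [t1 [tp1 [r1 e1 l1]]] := h1 (u _ _) _ (rep_stay ord0 h).
  have rdi : rd tp (inord i) = ohead (s i).
    by rewrite ffunE (trep_cur (h _)) inordK.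
  exists t1.+1, tp1; split=> //; last by lia.
  apply: RStep; first by rewrite /= rdi; reflexivity.
  exact: runs_auto_end r1.
- move=> Q q q' i nxt body s s1 s2 T1 T2 T _ h1 e _ h2 le [iK u] tp h.
  have [t1 [tp1 [r1 e1 l1]]] := h1 (u _ _) _ (rep_stay ord0 h).
  have [t2 [tp2 [r2 e2 l2]]] := h2 (conj iK u) _ e1.
  have rdi : rd tp (inord i) = ohead (s i).
    by rewrite ffunE (trep_cur (h _)) inordK.
  exists (t1 + t2).+1, tp2; split=> //; last by lia.
  apply: RStep; first by rewrite /= rdi; reflexivity.
  exact: runs_auto_step e r1 r2.
Qed.

(** When the program ends, the state [inr None] looks at tape 0: its cell is blank exactly when
    stack 0 is empty, and this is the verdict. *)
Definition program_machine (A : finType) (e : A -> G) (c : cmd) : machine A :=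
  @Machine A K (St c + option bool)%type G e (inl (st0 c))
    (fun q => if q is inr o then o else None)
    (fun q v => match q with
       | inl q1 => let: (o, a) := stp q1 v in
           (if o is Some q' then inl q' else inr None, a)
       | inr _ => (inr (Some (isSome (v ord0))), act_on v ord0 (v ord0, Stay))
       end).

Lemma runs_machine (A : finType) (e : A -> G) c q tp t tp' :
  runs (@stp c) q tp t tp' ->
  iter t (@mstep A (program_machine e c)) (inl q, tp) = (inr None, tp').
Proof.
elim=> {q tp t tp'} [q tp a h|q q' tp a n tp' h _ IH]; last rewrite iterSr -IH;
  by rewrite /= /mstep /= /mread -/(rd tp) h.
Qed.

End Compile.

Lemma verdict_iter (A : finType) (M : machine A) (c : mconfig M) t N b :
  verdict (iter t (@mstep A M) c).1 = Some b -> t <= N ->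
  verdict (iter N (@mstep A M) c).1 = Some b.
Proof.
move=> h /subnK <-; elim: (N - t) => //= k.
by move: (iter _ _ _) => d e; rewrite /mstep e.
Qed.

Definition in1 (x : seq G) : store := fun i => if i is 0 then x else [::].

Lemma program_in_P (A : finType) (e : A -> G) c K (p : {poly nat}) (f : seq G -> seq G) :
  uses c K -> (forall x, exec c (in1 x) p.[size x]%R (in1 (f x))) ->
  in_P (fun z : seq A => f (map e z) != [::]).
Proof.
move=> u h; exists (@program_machine K A e c), (2%:P * p + 1)%R => x.
have u' := uses_le (leqnSn K) u.
have [|t [tp' [r re le]]] :=
  exec_runs (h (map e x)) u' (tp := (minit (program_machine K e c) x).2).
  move=> i; rewrite /minit /=; have [->|ne] := eqVneq i ord0.
    by rewrite /=; case: x => [|a x]; split=> n //=; rewrite ?nth_nil; case: n => //= n;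
      rewrite nth_nil.
  have -> : in1 (map e x) i = [::] by rewrite /in1; case: i ne => [[|i] hi] //= /eqP[];
    apply: val_inj.
  by split=> n; rewrite ?nth_nil //; case: n => //= n; rewrite nth_nil.
(* The extra step inspects stack 0, whence the [+ 1] in the polynomial; the machine then stays in
   its verdict up to the time bound. *)
apply: (@verdict_iter _ _ _ t.+1); last first.
  by rewrite !hornerE /= size_map in le *; lia.
have := runs_machine e r; rewrite iterS => ->; rewrite /mstep /= /mread ffunE.
rewrite (trep_cur (re ord0)) /=.
by case: (f _).
Qed.

End Programs.

(** * Polynomially bounded functions *)

(** The base is at least 2 even for [n = 0], so that a larger exponent absorbs constants and
    sums. *)
Definition pb (T : nat -> nat) := exists d, forall n, T n <= (n + 2) ^ d.

Lemma pb_le T T' : (forall n, T n <= T' n) -> pb T' -> pb T.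
Proof. by move=> le [d h]; exists d => n; apply: leq_trans (le n) (h n). Qed.

Lemma pb_const c : pb (fun _ => c).
Proof.
exists c => n; apply: leq_trans (ltnW (ltn_expl c (isT : 1 < 2))) _.
by case: c => // c; rewrite leq_exp2r //; lia.
Qed.

Lemma pb_id : pb id.
Proof. by exists 1 => n; rewrite expn1; lia. Qed.

Lemma pbM T U : pb T -> pb U -> pb (fun n => T n * U n).
Proof. by move=> [d h] [e k]; exists (d + e) => n; rewrite expnD leq_mul. Qed.

Lemma pbD T U : pb T -> pb U -> pb (fun n => T n + U n).
Proof.
move=> [d h] [e k]; exists (d + e).+1 => n; rewrite expnS.
have le1 : (n + 2) ^ d <= (n + 2) ^ (d + e) by rewrite leq_exp2l; lia.
have le2 : (n + 2) ^ e <= (n + 2) ^ (d + e) by rewrite leq_exp2l; lia.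
have := h n; have := k n; move: ((n + 2) ^ (d + e)) le1 le2 => X; nia.
Qed.

Lemma pb_expn T d : pb T -> pb (fun n => T n ^ d).
Proof.
move=> [e h]; exists (e * d) => n; rewrite expnM.
by case: d => // d; rewrite leq_exp2r.
Qed.

Lemma pb_sum (I : Type) (r : seq I) (F : I -> nat -> nat) :
  (forall i, pb (F i)) -> pb (fun n => \sum_(i <- r) F i n).
Proof.
move=> h; elim: r => [|i r IH].
  by apply: pb_le (pb_const 0) => n; rewrite big_nil.
by apply: pb_le (pbD (h i) IH) => n; rewrite big_cons.
Qed.

Lemma pb_poly (p : {poly nat}) : pb (fun n => p.[n]%R).
Proof.
have le n : p.[n]%R <= \sum_(i < size p) (p`_i)%R * n ^ i.
  rewrite horner_coef; by apply: eq_leq; apply: eq_bigr => i _; congr (_ * _).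
apply: pb_le le _.
by apply: pb_sum => i; apply: pbM (pb_const _) (pb_expn _ pb_id).
Qed.

Lemma pb_polyP T : pb T -> exists p : {poly nat}, forall n, T n <= p.[n]%R.
Proof.
move=> [d h]; exists (('X + 2%:P) ^+ d)%R => n; apply: leq_trans (h n) _.
by rewrite horner_exp hornerD hornerX hornerC.
Qed.

Ltac pb_tac := repeat first [ assumption | exact: pb_id | exact: pb_const
  | apply: pb_expn | apply: pbD | apply: pbM ].

(** * Polynomial-time string functions *)

Section FP.
Variable G : finType.
Implicit Types (s : store G) (c : cmd G).

Lemma exec_seq c1 c2 s s1 s2 T1 T2 : exec c1 s T1 s1 -> exec c2 s1 T2 s2 ->
  exec (Seq c1 c2) s (T1 + T2) s2.
Proof. by move=> h1 h2; apply: ESeq h1 h2 _. Qed.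

(** All stacks except 0 are empty before and after a run, so programs can be chained and called
    repeatedly inside a loop. *)
Definition FP (f : seq G -> seq G) := exists c K d,
  uses c K /\ forall x, exec c (in1 x) ((size x + 2) ^ d) (in1 (f x)).

Lemma FP_intro f c K T : uses c K -> pb T ->
  (forall x, exec c (in1 x) (T (size x)) (in1 (f x))) -> FP f.
Proof.
move=> u [d hd] h; exists c, K, d; split=> // x.
by apply: exec_le (h x); apply: hd.
Qed.

Lemma FP_ext f g : FP f -> (forall x, f x = g x) -> FP g.
Proof. by move=> [c [K [d [u h]]]] e; exists c, K, d; split=> // x; rewrite -e. Qed.

Lemma FP_size f c d : (forall x, exec c (in1 x) ((size x + 2) ^ d) (in1 (f x))) ->
  forall x, size (f x) <= size x + (size x + 2) ^ d.
Proof. by move=> h x; have := exec_size 0 (h x). Qed.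

Lemma FP_comp f g : FP f -> FP g -> FP (fun x => f (g x)).
Proof.
move=> [c1 [K1 [d1 [u1 h1]]]] [c2 [K2 [d2 [u2 h2]]]].
have u1' := uses_le (leq_maxl K1 K2) u1.
have u2' := uses_le (leq_maxr K1 K2) u2.
apply: (@FP_intro _ (Seq c2 c1) _
  (fun n => (n + 2) ^ d2 + (n + (n + 2) ^ d2 + 2) ^ d1) (conj u2' u1')); first by pb_tac.
move=> x; apply: exec_seq (h2 x) _; apply: exec_le (h1 (g x)).
case: d1 {h1} => // d1; rewrite leq_exp2r // leq_add2r.
exact: (FP_size h2).
Qed.

Fixpoint pushes i (l : seq G) : cmd G :=
  if l is g :: l' then Seq (Push i g) (pushes i l') else Nop G.

Definition case_top i (h : option G -> cmd G) : cmd G :=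
  Auto tt i (fun _ _ => None) (fun _ o => h o).

Definition move i j : cmd G :=
  Auto tt i (fun _ o => if o is Some _ then Some tt else None)
    (fun _ o => if o is Some g then Seq (Pop G i) (Push j g) else Nop G).

Definition move2 i j k : cmd G :=
  Auto tt i (fun _ o => if o is Some _ then Some tt else None)
    (fun _ o => if o is Some g then Seq (Pop G i) (Seq (Push j g) (Push k g)) else Nop G).

Definition clear i : cmd G :=
  Auto tt i (fun _ o => if o is Some _ then Some tt else None)
    (fun _ o => if o is Some g then Pop G i else Nop G).

Lemma uses_move i j K : i < K -> j < K -> uses (move i j) K.
Proof. by move=> iK jK; split=> // _ []. Qed.

Lemma uses_move2 i j k K : i < K -> j < K -> k < K -> uses (move2 i j k) K.
Proof. by move=> iK jK kK; split=> // _ []. Qed.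

Lemma uses_clear i K : i < K -> uses (clear i) K.
Proof. by move=> iK; split=> // _ []. Qed.

Lemma uses_pushes i l K : i < K -> uses (pushes i l) K.
Proof. by move=> iK; elim: l. Qed.

Lemma uses_case i h K : i < K -> (forall o, uses (h o) K) -> uses (case_top i h) K.
Proof. by []. Qed.

Lemma uses_seq c1 c2 K : uses c1 K -> uses c2 K -> uses (Seq c1 c2) K.
Proof. by []. Qed.

Lemma updE s i v j : upd s i v j = if j == i then v else s j. Proof. by []. Qed.

Lemma upd_id s i : upd s i (s i) = s.
Proof. by apply: functional_extensionality => j; rewrite updE; case: eqP => // ->. Qed.

Lemma exec_pushes i l s : exec (pushes i l) s (size l).+1 (upd s i (rev l ++ s i)).
Proof.
elim: l s => [|g l IH] s; first by rewrite upd_id; apply: ENop.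
apply: (@ESeq _ _ _ _ _ _ 1 (size l).+1 _ (EPush i g s (ltn0Sn 0))) => //.
suff -> : upd s i (rev (g :: l) ++ s i) =
    upd (upd s i (g :: s i)) i (rev l ++ upd s i (g :: s i) i) by apply: IH.
apply: functional_extensionality => j; rewrite !updE eqxx.
by case: eqP => // _; rewrite rev_cons cat_rcons.
Qed.

Lemma exec_case i h s T s' : exec (h (ohead (s i))) s T s' ->
  exec (case_top i h) s T.+1 s'.
Proof. by move=> e; apply: EAutoEnd e _ _. Qed.

Lemma exec_move (i j : nat) s : i != j ->
  exec (move i j) s (3 * size (s i) + 2) (upd (upd s i [::]) j (rev (s i) ++ s j)).
Proof.
move=> ne; have [v e] : exists v, s i = v by eexists.
elim: v s e => [|g v IH] s e.
  apply: (@EAutoEnd _ _ _ _ _ _ _ _ 1); rewrite /= ?e //.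
  suff -> : upd (upd s i [::]) j (rev [::] ++ s j) = s by apply: ENop.
  apply: functional_extensionality => k; rewrite !updE.
  by case: eqP => [->|_] //; case: eqP => [->|_].
apply: (@EAutoStep _ _ _ tt _ _ _ _ _ _ 2 (3 * size v + 2)); rewrite /= ?e //.
- by apply: ESeq; [apply: (EPop _ _ (ltn0Sn 0)) | apply: (EPush _ _ _ (ltn0Sn 0)) |].
- set s1 := upd _ j (g :: _); have s1i : s1 i = v by rewrite /s1 !updE (negPf ne) eqxx e.
  have := IH s1 s1i; rewrite s1i; congr exec.
  apply: functional_extensionality => k;
    rewrite /s1 !updE eqxx [j == i]eq_sym (negPf ne) rev_cons cat_rcons.
  by case: (k == j); case: (k == i).
- by rewrite /=; lia.
Qed.

Lemma exec_move2 (i j k : nat) s : i != j -> i != k -> j != k ->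
  exec (move2 i j k) s (4 * size (s i) + 2)
    (upd (upd (upd s i [::]) j (rev (s i) ++ s j)) k (rev (s i) ++ s k)).
Proof.
move=> ij ik jk; have [v e] : exists v, s i = v by eexists.
elim: v s e => [|g v IH] s e.
  apply: (@EAutoEnd _ _ _ _ _ _ _ _ 1); rewrite /= ?e //.
  suff -> : upd (upd (upd s i [::]) j (rev [::] ++ s j)) k (rev [::] ++ s k) = s
    by apply: ENop.
  apply: functional_extensionality => m; rewrite !updE.
  by do 2!case: eqP => [->|_] //; case: eqP => [->|_].
apply: (@EAutoStep _ _ _ tt _ _ _ _ _ _ 3 (4 * size v + 2)); rewrite /= ?e //.
- apply: ESeq; [apply: (EPop _ _ (ltn0Sn 0)) | | apply: leqnn].
  by apply: ESeq; [apply: (EPush _ _ _ (ltn0Sn 0)) | apply: (EPush _ _ _ (ltn0Sn 0)) |].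
- set s1 := upd _ k (g :: _).
  have s1i : s1 i = v by rewrite /s1 !updE (negPf ik) (negPf ij) eqxx e.
  have := IH s1 s1i; rewrite s1i; congr exec.
  have [ji ki kj] : [/\ j == i = false, k == i = false & k == j = false].
    by rewrite ![_ == i]eq_sym [k == j]eq_sym (negPf ij) (negPf ik) (negPf jk).
  apply: functional_extensionality => m.
  rewrite /s1 !updE !eqxx ji ki kj (negPf jk) rev_cons !cat_rcons.
  by case: (m == k); case: (m == j); case: (m == i).
- by rewrite /=; lia.
Qed.

Lemma exec_clear i s : exec (clear i) s (2 * size (s i) + 2) (upd s i [::]).
Proof.
have [v e] : exists v, s i = v by eexists.
elim: v s e => [|g v IH] s e.
  apply: (@EAutoEnd _ _ _ _ _ _ _ _ 1); rewrite /= ?e //.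
  by rewrite -[X in upd _ _ X]e upd_id; apply: ENop.
apply: (@EAutoStep _ _ _ tt _ _ _ _ _ _ 1 (2 * size v + 2)); rewrite /= ?e //.
- exact: EPop.
- set s1 := upd s _ (behead _); have s1i : s1 i = v by rewrite /s1 !updE eqxx e.
  have := IH s1 s1i; rewrite s1i; congr exec.
  by apply: functional_extensionality => m; rewrite /s1 !updE; case: eqP.
- by rewrite /=; lia.
Qed.

(** Stack 0 passes arguments to a subroutine confined to the stacks below [K]; the three stacks
    above are scratch space which it cannot touch. *)
Definition R4 K (y a b e : seq G) : store G := fun i =>
  if i == 0 then y else if i == K then a else if i == K.+1 then b
  else if i == K.+2 then e else [::].

Section R4.
Variable (K : nat).
Hypothesis K0 : 0 < K.
Implicit Types y a b e v : seq G.

Lemma R4_in1 y : in1 y = R4 K y [::] [::] [::].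
Proof. by apply: functional_extensionality => -[|i]; rewrite /R4 //= !if_same. Qed.
Lemma R4_0 y a b e : R4 K y a b e 0 = y. Proof. by []. Qed.
Lemma R4_K y a b e : R4 K y a b e K = a.
Proof. by rewrite /R4; case: eqP K0 => [->|] //; rewrite eqxx. Qed.
Lemma R4_K1 y a b e : R4 K y a b e K.+1 = b.
Proof. by rewrite /R4 /=; case: eqP => [|_]; [lia | rewrite eqxx]. Qed.
Lemma R4_K2 y a b e : R4 K y a b e K.+2 = e.
Proof. by rewrite /R4 /=; do 2!(case: eqP => [|_]; first lia); rewrite eqxx. Qed.
Lemma R4_upd0 y a b e v : upd (R4 K y a b e) 0 v = R4 K v a b e.
Proof. by apply: functional_extensionality => i; rewrite updE /R4; case: eqP. Qed.
Lemma R4_updK y a b e v : upd (R4 K y a b e) K v = R4 K y v b e.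
Proof.
apply: functional_extensionality => i; rewrite updE /R4.
by case: (eqVneq i K) => // ->; case: eqP K0 => // ->.
Qed.
Lemma R4_updK1 y a b e v : upd (R4 K y a b e) K.+1 v = R4 K y a v e.
Proof.
apply: functional_extensionality => i; rewrite updE /R4.
by case: (eqVneq i K.+1) => // -> /=; case: eqP => //; lia.
Qed.
Lemma R4_updK2 y a b e v : upd (R4 K y a b e) K.+2 v = R4 K y a b v.
Proof.
apply: functional_extensionality => i; rewrite updE /R4.
by case: (eqVneq i K.+2) => // -> /=; do 2!(case: eqP => [|_]; first lia).
Qed.
Definition R4E := (R4_0, R4_K, R4_K1, R4_K2, R4_upd0, R4_updK, R4_updK1, R4_updK2).

Lemma R4_neqs : [/\ 0 != K, K != 0, K.+1 != 0, K.+2 != 0 &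
  [/\ K != K.+1, K != K.+2, K.+1 != K, K.+2 != K & [/\ K.+1 != K.+2, K.+2 != K.+1,
    0 != K.+1 & 0 != K.+2]]].
Proof. by do ![split]; lia. Qed.

Lemma R4_frame c y y' T a b e : uses c K -> exec c (in1 y) T (in1 y') ->
  exec c (R4 K y a b e) T (R4 K y' a b e).
Proof.
move=> u h; have := exec_frame h (R4 K [::] a b e) u.
suff m z : merge_store K (in1 z) (R4 K [::] a b e) = R4 K z a b e by rewrite !m.
apply: functional_extensionality => i; rewrite /merge_store /R4 /in1.
case: i => [|i] /=; first by rewrite K0.
by case: ifP => // lt; do 3!(case: eqP => [|_]; first lia).
Qed.
End R4.

End FP.
Arguments R4E {G K}. Arguments move {G}. Arguments move2 {G}. Arguments clear {G}.

Ltac uses_tac := repeat first [ assumption | apply: uses_seq | apply: uses_move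
  | apply: uses_move2 | apply: uses_clear | apply: uses_pushes | apply: I | apply:
    uses_case ].

Ltac mv K0 := apply: exec_move;
  first (by case: (R4_neqs K0) => ? ? ? ? [? ? ? ? [? ? ? ?]]).

Lemma FP_cat (G : finType) (f g : seq G -> seq G) : FP f -> FP g ->
  FP (fun x => f x ++ g x).
Proof.
move=> [cf [K1 [df [uf hf]]]] [cg [K2 [dg [ug hg]]]].
pose K := (maxn K1 K2).+1; have K0 : 0 < K by [].
have uf' : uses cf K by apply: uses_le uf; rewrite /K; lia.
have ug' : uses cg K by apply: uses_le ug; rewrite /K; lia.
(* A move reverses a word, so data travel an even number of times. A copy of [x] is parked on
   [K.+1], [g x] is computed and parked reversed on [K], then [f x] is computed from the copy, which
   passes through [K.+2] to regain its order. Finally [g x] returns to stack 0 and [f x] is put on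
   top of it. *)
pose prog := foldr (@Seq G) (Nop G) [:: move 0 K; move2 K 0 K.+1; cg; move 0 K;
  move K.+1 K.+2; move K.+2 0; cf; move 0 K.+1; move K 0; move K.+1 0].
pose sf n := n + (n + 2) ^ df; pose sg n := n + (n + 2) ^ dg.
apply: (@FP_intro _ _ prog K.+3 (fun n => (3 * n + 2) + ((4 * n + 2) + ((n + 2) ^ dg +
  ((3 * sg n + 2) + ((3 * n + 2) + ((3 * n + 2) + ((n + 2) ^ df + ((3 * sf n + 2) +
  ((3 * sg n + 2) + ((3 * sf n + 2) + 1))))))))))).
- have u1 : uses cf K.+3 by apply: uses_le uf'; lia.
  have u2 : uses cg K.+3 by apply: uses_le ug'; lia.
  have b0 : 0 < K.+3 by []. have b1 : K < K.+3 by lia.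
  have b2 : K.+1 < K.+3 by lia. have b3 : K.+2 < K.+3 by [].
  rewrite /prog; uses_tac.
- by rewrite /sf /sg; pb_tac.
move=> x; rewrite !(R4_in1 K).
have sfx := FP_size hf x; have sgx := FP_size hg x.
apply: exec_seq; first by mv K0.
rewrite !(R4E K0) cats0.
apply: exec_seq.
  apply: exec_le; last first.
    by apply: exec_move2; case: (R4_neqs K0) => ? ? ? ? [? ? ? ? [? ? ? ?]].
  by rewrite !(R4E K0) size_rev.
rewrite !(R4E K0) revK !cats0.
apply: exec_seq; first by apply: (R4_frame K0).
apply: exec_seq; first by apply: exec_le; last (by mv K0); rewrite !(R4E K0) /sg; lia.
rewrite !(R4E K0) !cats0.
apply: exec_seq; first by apply: exec_le; last (by mv K0); rewrite !(R4E K0).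
rewrite !(R4E K0) !cats0.
apply: exec_seq; first by apply: exec_le; last (by mv K0); rewrite !(R4E K0) size_rev.
rewrite !(R4E K0) !cats0 revK.
apply: exec_seq; first by apply: (R4_frame K0).
apply: exec_seq; first by apply: exec_le; last (by mv K0); rewrite !(R4E K0) /sf; lia.
rewrite !(R4E K0) !cats0.
apply: exec_seq; first by apply: exec_le; last (by mv K0);
  rewrite !(R4E K0) size_rev /sg; lia.
rewrite !(R4E K0) !cats0 revK.
apply: exec_seq; first by apply: exec_le; last (by mv K0);
  rewrite !(R4E K0) size_rev /sf; lia.
rewrite !(R4E K0) revK.
exact: ENop.
Qed.

(** ** Pushdown transducers *)

Section PushdownTransducer.
Variables (G Q : finType) (nxt : Q -> G -> Q).
Variables (act : Q -> G -> option G -> seq G * seq G) (fin : Q -> option G -> seq G).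

(** An action replaces the top of the stack by [a.1] and emits [a.2]. An empty stack shows [None]
    and may still be pushed upon. *)
Fixpoint pdt (q : Q) (stk x : seq G) : seq G :=
  if x is g :: x' then
    let a := act q g (ohead stk) in a.2 ++ pdt (nxt q g) (a.1 ++ behead stk) x'
  else fin q (ohead stk).

Let body (q : Q) (o : option G) : cmd G :=
  if o is Some g then
    Seq (Pop G 0) (case_top 1 (fun t => Seq (Pop G 1)
      (Seq (pushes 1 (rev (act q g t).1)) (pushes 2 (act q g t).2))))
  else case_top 1 (fun t => pushes 2 (fin q t)).
Let loop q := Auto q 0 (fun q o => omap (nxt q) o) body.
(** Bounds what a single round pushes or emits; it is finite because [Q] and [G] are. *)
Let C := \max_(q : Q) \max_(o : option G)
  (size (fin q o) + \max_(g : G) (size (act q g o).1 + size (act q g o).2)).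

Let C_fin q o : size (fin q o) <= C.
Proof.
rewrite /C; apply: leq_trans (leq_bigmax q).
by apply: leq_trans (leq_bigmax o); lia.
Qed.
Let C_act q g o : size (act q g o).1 + size (act q g o).2 <= C.
Proof.
rewrite /C; apply: leq_trans (leq_bigmax q).
apply: leq_trans (leq_bigmax o).
apply: leq_trans (leq_addl _ _).
exact: (leq_bigmax (F := fun g => size (act q g o).1 + size (act q g o).2) g).
Qed.

Let exec_loop x q stk out : exists stk', exec (loop q) (R4 1 x stk out [::])
  ((C + 10) * (size x).+1) (R4 1 [::] stk' (rev (pdt q stk x) ++ out) [::]).
Proof.
have K0 : 0 < 1 by [].
elim: x q stk out => [|g x IH] q stk out.
  exists stk; apply: (@EAutoEnd _ _ _ _ _ _ _ _ (size (fin q (ohead stk))).+2) => //.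
    rewrite /= [X in exec _ _ _ X](_ : _ = upd (R4 1 [::] stk out [::]) 2
      (rev (fin q (ohead stk)) ++ (R4 1 [::] stk out [::]) 2)).
      by apply: exec_case; apply: exec_pushes.
    by rewrite !(R4E K0).
  by have := C_fin q (ohead stk); rewrite /=; nia.
pose a := act q g (ohead stk).
have [stk' h] := IH (nxt q g) (a.1 ++ behead stk) (rev a.2 ++ out).
exists stk'; apply: (@EAutoStep _ _ _ (nxt q g) _ _ _ _
  (R4 1 x (a.1 ++ behead stk) (rev a.2 ++ out) [::]) _
  (1 + (1 + ((size a.1).+1 + (size a.2).+1)).+1) ((C + 10) * (size x).+1)) => //.
- rewrite /=; apply: exec_seq; first exact: EPop.
  rewrite !(R4E K0); apply: exec_case; rewrite !(R4E K0) -/a.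
  apply: exec_seq; first exact: EPop.
  rewrite !(R4E K0); apply: exec_seq.
    by rewrite -[size a.1]size_rev; apply: exec_pushes.
  by rewrite !(R4E K0) revK; have :=
    exec_pushes 2 a.2 (R4 1 x (a.1 ++ behead stk) out [::]); rewrite !(R4E K0).
- by move: h; rewrite /= -/a rev_cat catA.
- by have := C_act q g (ohead stk); rewrite -/a /=; nia.
Qed.

Lemma FP_pdt q stk : FP (pdt q stk).
Proof.
have K0 : 0 < 1 by [].
(* The loop collects the output reversed on stack 2 and the last move restores its order. Whatever
   the transducer leaves on its own stack is cleared. *)
pose prog := Seq (pushes 1 (rev stk)) (Seq (loop q) (Seq (clear 1) (move 2 0))).
pose B n := (C + 10) * n.+1.
apply: (@FP_intro _ _ prog 4 (fun n => (size stk).+1 + (B n + ((2 * (size stk + B n) + 2) +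
  (3 * B n + 2))))).
- have ub p o : uses (body p o) 4.
    by case: o => [g|]; [apply: uses_seq => // | ]; apply: uses_case => // o; uses_tac.
  by apply: uses_seq; [uses_tac | apply: uses_seq; [split | uses_tac]].
- by apply: (@pb_le _ (fun n => (size stk).+1 + (C + 10) * (n + 1) + ((2 * (size stk + (C
  + 10) * (n + 1)) + 2) + (3 * ((C + 10) * (n + 1)) + 2)))) => [n|]; [rewrite /B;
  lia | pb_tac].
move=> x; rewrite !(R4_in1 1).
apply: exec_seq.
  by rewrite -[size stk]size_rev; apply: exec_pushes.
rewrite !(R4E K0) revK cats0.
have [stk' h] := exec_loop x q stk [::].
have s1 := exec_size 1 h; have s2 := exec_size 2 h; rewrite !(R4E K0) in s1 s2.
apply: exec_seq; first exact: h.
rewrite cats0 in s2 *.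
apply: exec_seq.
  by apply: exec_le; last (apply: exec_clear); rewrite !(R4E K0) /B; lia.
rewrite !(R4E K0).
have := exec_move (R4 1 [::] [::] (rev (pdt q stk x)) [::]) (isT : 2 != 0).
rewrite !(R4E K0) revK cats0; apply: exec_le.
by rewrite /= in s2; rewrite /B; lia.
Qed.

End PushdownTransducer.

(** ** Mapping over blocks *)

Section Blocks.
Variables (G : finType) (blk : G).

(** [blk] terminates a block. An unterminated rest counts as a block too, so that no part of a
    malformed word escapes the checks. *)
Fixpoint blocks (x : seq G) : seq (seq G) :=
  if x is g :: x' then
    if g == blk then [::] :: blocks x'
    else if blocks x' is b :: r then (g :: b) :: r else [:: [:: g]]
  else [::].

Fixpoint bcut (x : seq G) : seq G * seq G :=
  if x is g :: x' then
    if g == blk then ([::], x') else ((g :: (bcut x').1), (bcut x').2)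
  else ([::], [::]).

(** Turns the letterwise recursion of [blocks] into the order in which the loop works, one whole
    block per round. *)
Lemma blocks_cut (x : seq G) : x != [::] -> blocks x = (bcut x).1 :: blocks (bcut x).2.
Proof.
elim: x => // g x IH _ /=; case: eqP => // _.
by case: x IH => [|h x] // ->.
Qed.

Lemma size_bcut (x : seq G) : x != [::] ->
  size (bcut x).1 <= size x /\ size (bcut x).2 < size x.
Proof.
elim: x => // g x IH _ /=; case: eqP => //= _.
by case: x IH => [|h x] // /(_ isT) /= []; lia.
Qed.

Lemma blocks_cat b x : blk \notin b -> blocks (b ++ blk :: x) = b :: blocks x.
Proof.
elim: b => [|g b IH] /=; first by rewrite eqxx.
by rewrite inE eq_sym negb_or => /andP[/negPf -> /IH ->].
Qed.

Lemma blocks_flatten bs : all (fun b => blk \notin b) bs ->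
  blocks (flatten [seq rcons b blk | b <- bs]) = bs.
Proof.
elim: bs => //= b bs IH /andP[hb /IH e].
by rewrite cat_rcons blocks_cat // e.
Qed.

Let cut_loop K : cmd G :=
  Auto tt K.+1 (fun _ o => if o is Some g then if g == blk then None else Some tt else None)
    (fun _ o => if o is Some g then
       if g == blk then Pop G K.+1 else Seq (Pop G K.+1) (Push K g) else Nop G).

Let exec_cut K x a e : 0 < K -> exec (cut_loop K) (R4 K [::] a x e)
  (3 * size x + 2) (R4 K [::] (rev (bcut x).1 ++ a) (bcut x).2 e).
Proof.
move=> K0; elim: x a => [|g x IH] a.
  by apply: (@EAutoEnd _ _ _ _ _ _ _ _ 1); rewrite ?(R4E K0) //=; apply: ENop.
have [eg|ne] := eqVneq g blk.
  apply: (@EAutoEnd _ _ _ _ _ _ _ _ 1); rewrite ?(R4E K0) /= ?eg ?eqxx //=; last by lia.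
  have := EPop K.+1 (R4 K [::] a (blk :: x) e) (ltn0Sn 0).
  by rewrite !(R4E K0).
apply: (@EAutoStep _ _ _ tt _ _ _ _ (R4 K [::] (g :: a) x e) _ 2 (3 * size x + 2));
  rewrite ?(R4E K0) /= ?(negPf ne) //=; last by lia.
- have := exec_seq (EPop K.+1 (R4 K [::] a (g :: x) e) (ltn0Sn 0)) (EPush K g _ (ltn0Sn 0)).
  by rewrite !(R4E K0).
- by have := IH (g :: a); rewrite rev_cons cat_rcons.
Qed.

Lemma FP_bmap f : FP f -> FP (fun x => flatten (map f (blocks x))).
Proof.
move=> [c [K1 [d [u h]]]].
pose K := K1.+1; have K0 : 0 < K by [].
have u' : uses c K by apply: uses_le u; rewrite /K; lia.
pose bd : cmd G := Seq (cut_loop K) (Seq (move K 0) (Seq c (move 0 K.+2))).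
pose loop : cmd G := Auto tt K.+1 (fun _ o => if o is Some g then Some tt else None)
  (fun _ o => if o is Some g then bd else Nop G).
pose W n := (3 * n + 2) + ((3 * n + 2) + ((n + 2) ^ d + (3 * (n + (n + 2) ^ d) + 2))).
have W_le m n : m <= n -> W m <= W n.
  move=> le; have : (m + 2) ^ d <= (n + 2) ^ d by case: (d) => // d';
    rewrite leq_exp2r //; lia.
  by rewrite /W; lia.
(* [N] stays fixed while [x] shrinks, so every round is charged the same cost [W N]. *)
have exec_loop N x e : size x <= N ->
    exec loop (R4 K [::] [::] x e) ((W N).+1 * (size x).+1 + 1)
      (R4 K [::] [::] [::] (rev (flatten (map f (blocks x))) ++ e)).
  have loop0 e' T : 1 < T -> exec loop (R4 K [::] [::] [::] e') T (R4 K [::] [::] [::] e').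
    by move=> ?; apply: (@EAutoEnd _ _ _ _ _ _ _ _ 1); rewrite ?(R4E K0) //=; apply: ENop.
  elim: {x}(size x) {-2}x e (leqnn (size x)) => [|m IH] x e lex leN.
    have -> : x = [::] by case: x lex {leN}.
    by apply: loop0; lia.
  have [->|xn] := eqVneq x [::]; first by apply: loop0; lia.
  have [le1 lt2] := size_bcut xn.
  rewrite (blocks_cut xn) /=.
  apply: (@EAutoStep _ _ _ tt _ _ _ _ (R4 K [::] [::] (bcut x).2 (rev (f (bcut x).1) ++
    e)) _
     (W N) ((W N).+1 * (size (bcut x).2).+1 + 1)).
  - rewrite ?(R4E K0).
    have -> : ohead x = Some (head blk x) by case: (x) xn.
    apply: exec_le (W_le _ _ leN) _.
    apply: exec_seq; first exact: exec_cut.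
    rewrite cats0; apply: exec_seq.
      apply: exec_le; last (by mv K0).
      by rewrite !(R4E K0) size_rev leq_add2r leq_mul2l le1.
    rewrite !(R4E K0) cats0 revK; apply: exec_seq.
      apply: exec_le; last by apply: (R4_frame K0 _ _ _ u'); apply: h.
      by case: (d) => // d'; rewrite leq_exp2r //; lia.
    have := exec_move (R4 K (f (bcut x).1) [::] (bcut x).2 e) (isT : 0 != K.+2).
    rewrite !(R4E K0); apply: exec_le.
    have := FP_size h (bcut x).1.
    have : (size (bcut x).1 + 2) ^ d <= (size x + 2) ^ d by case: (d) => // d';
      rewrite leq_exp2r //; lia.
    by lia.
  - by rewrite !(R4E K0); case: x xn {lex leN le1 lt2}.
  - by rewrite rev_cat -catA; apply: IH; lia.
  - by rewrite /=; nia.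
pose prog := Seq (move 0 K) (Seq (move K K.+1) (Seq loop (move K.+2 0))).
pose B n := (W n).+1 * n.+1 + 1.
apply: (@FP_intro _ _ prog K.+3 (fun n => (3 * n + 2) + ((3 * n + 2) + (B n + (3 * B n +
  2))))).
- have u1 : uses c K.+3 by apply: uses_le u'; lia.
  have b1 : K < K.+3 by lia. have b2 : K.+1 < K.+3 by lia.
  have uc : uses (cut_loop K) K.+3 by split=> // _ [g'|] //=; case: ifP.
  have ubd : uses bd K.+3 by apply: uses_seq => //; uses_tac.
  have ul : uses loop K.+3 by split=> // _ [].
  by rewrite /prog; uses_tac.
- have pB : pb B.
    apply: (@pb_le _ (fun n => (W n + 1) * (n + 1) + 1)) => [n|]; first by rewrite /B; lia.
    by rewrite /W; pb_tac.
  by pb_tac.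
move=> x; rewrite !(R4_in1 K).
apply: exec_seq; first by mv K0.
rewrite !(R4E K0) cats0; apply: exec_seq.
  by apply: exec_le; last (by mv K0); rewrite !(R4E K0) size_rev.
rewrite !(R4E K0) cats0 revK.
have hl := exec_loop _ x [::] (leqnn _).
apply: exec_seq; first exact: hl.
have := exec_size K.+2 hl; rewrite !(R4E K0) cats0 => le.
move: (flatten _) le => y le.
have := exec_move (R4 K [::] [::] [::] (rev y)) (isT : K.+2 != 0).
rewrite !(R4E K0) revK cats0; apply: exec_le.
by rewrite add0n in le; rewrite leq_add2r leq_mul2l le.
Qed.

End Blocks.

Lemma FP_hom (G : finType) (h : G -> seq G) : FP (fun x => flatten (map h x)).
Proof.
apply: FP_ext (@FP_pdt G unit (fun _ _ => tt) (fun _ g _ => ([::], h g))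
  (fun _ _ => [::]) tt [::]) _.
by elim=> //= g x ->.
Qed.

(** ** Calling a Turing machine *)

Section Call.
Variables (G A : finType) (M : machine A).
Variables (eT : option (tsym M) -> G) (dT : G -> option (tsym M)).
Variables (eQ : mstate M -> G) (dQ : G -> option (mstate M)) (yes : G).
Hypotheses (eTK : cancel eT dT) (eQK : pcancel eQ dQ).

Let k := (work_tapes M).+1.
(* Stack 1 holds the state, stacks [lr j] and [rr j] the two halves of tape [j]. *)
Let lr (j : 'I_k) : nat := 2 + 2 * j.
Let rr (j : 'I_k) : nat := 3 + 2 * j.
Let N := 4 + 2 * k.

(** The second alternative is needed for blank tapes at the start and for a head that has moved past
    the last listed cell: both leave the right stack empty. *)
Definition tape_rel (t : tape (tsym M)) (l r : seq G) :=
  l = map eT (tleft t) /\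
  (r = map eT (tcur t :: tright t) \/ [/\ r = [::], tcur t = None & tright t = [::]]).

Let act1 (j : 'I_k) (a : option (tsym M) * hmove) : cmd G :=
  Seq (Pop G (rr j))
    match a.2 with
    | Stay => Push (rr j) (eT a.1)
    | MoveR => Push (lr j) (eT a.1)
    | MoveL => Seq (Push (rr j) (eT a.1)) (case_top (lr j) (fun o =>
        if o is Some g then Seq (Pop G (lr j)) (Push (rr j) g)
        else Push (rr j) (eT None)))
    end.

Lemma lr_rr i j : (lr i == rr j) = false. Proof. by apply/eqP; rewrite /lr /rr; lia. Qed.
Lemma rr_lr i j : (rr i == lr j) = false. Proof. by rewrite eq_sym lr_rr. Qed.
Lemma lr_inj i j : (lr i == lr j) = (i == j).
Proof. by apply/eqP/eqP => [|-> //]; rewrite /lr => e; apply: val_inj => /=; lia. Qed.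
Lemma rr_inj i j : (rr i == rr j) = (i == j).
Proof. by apply/eqP/eqP => [|-> //]; rewrite /rr => e; apply: val_inj => /=; lia. Qed.
Let regE := (lr_rr, rr_lr, lr_inj, rr_inj, eqxx).

Let exec_act1 (j : 'I_k) a s t : tape_rel t (s (lr j)) (s (rr j)) ->
  exists l r, tape_rel (tape_act t a) l r /\
    exec (act1 j a) s 10 (upd (upd s (lr j) l) (rr j) r).
Proof.
case: t => tl tc tr [/= el er].
have er' : behead (s (rr j)) = map eT tr by case: er => [->|[-> _ ->]].
have done2 (s1 s2 : store G) c T : (forall i, s1 i = s2 i) -> exec c s T s1 ->
  exec c s T s2.
  by move=> e; rewrite (functional_extensionality _ _ e).
case: a => w [] /=.
- exists (map eT (behead tl)), (map eT (head None tl :: w :: tr)).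
  split; first by split=> //; left.
  apply: (@ESeq _ _ _ _ _ _ 1 6) => //; first exact: EPop.
  apply: (@ESeq _ _ _ _ _ _ 1 5) => //; first exact: EPush.
  apply: (@exec_le _ _ _ 3) => //; apply: exec_case.
  rewrite !updE !regE el er'.
  case: tl el => [|b tl] el /=.
    set s2 := upd _ _ _.
    have := EPush (rr j) (eT None) s2 (ltn0Sn 1).
    rewrite [upd s2 _ _](_ : _ = upd (upd s (lr j) [::]) (rr j) [:: eT None,
      eT w & map eT tr]) //.
    apply: functional_extensionality => i; rewrite /s2 !updE !regE ?er'.
    by case: eqP => // _; case: eqP => // ->.
  set s2 := upd _ _ (eT w :: _).
  have := exec_seq (EPop (lr j) s2 (ltn0Sn 0)) (EPush (rr j) (eT b) _ (ltn0Sn 0)).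
  rewrite [upd (upd s2 _ _) _ _](_ : _ = upd (upd s (lr j) (map eT tl)) (rr j) [:: eT b,
    eT w & map eT tr]) //.
  apply: functional_extensionality => i; rewrite /s2 !updE !regE ?er' ?el.
  by case: eqP.
- exists (map eT tl), (map eT (w :: tr)); split; first by split=> //; left.
  apply: (@ESeq _ _ _ _ _ _ 1 1) => //; first exact: EPop.
  set s1 := upd s _ _; have := EPush (rr j) (eT w) s1 (ltn0Sn 0).
  rewrite [upd s1 _ _](_ : _ = upd (upd s (lr j) (map eT tl)) (rr j) (map eT (w :: tr))) //.
  apply: functional_extensionality => i; rewrite /s1 !updE !regE er' -el.
  by case: eqP => // _; case: eqP => // ->.
- exists (map eT (w :: tl)), (map eT tr); split.
    split=> //; case: tr {er er'} => [|b tr] /=; [right | left] => //.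
  apply: (@ESeq _ _ _ _ _ _ 1 1) => //; first exact: EPop.
  set s1 := upd s _ _; have := EPush (lr j) (eT w) s1 (ltn0Sn 0).
  rewrite [upd s1 _ _](_ : _ = upd (upd s (lr j) (map eT (w :: tl))) (rr j) (map eT tr)) //.
  apply: functional_extensionality => i; rewrite /s1 !updE !regE er' el.
  by case: (eqVneq i (lr j)) => // ->; rewrite regE.
Qed.

Let tapes_rel (s : store G) (tp : 'I_k -> tape (tsym M)) :=
  forall j, tape_rel (tp j) (s (lr j)) (s (rr j)).
Let same_out (s s' : store G) := forall i, i < 2 \/ N <= i -> s' i = s i.

Let do_acts (js : seq 'I_k) (a : {ffun 'I_k -> option (tsym M) * hmove}) : cmd G :=
  foldr (fun j c => Seq (act1 j (a j)) c) (Nop G) js.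

Let exec_do_acts (js : seq 'I_k) a s tp : uniq js -> tapes_rel s tp ->
  exists s', [/\ exec (do_acts js a) s (10 * size js + 1) s',
    tapes_rel s' (fun j => if j \in js then tape_act (tp j) (a j) else tp j)
    & same_out s s'].
Proof.
elim: js s tp => [|j js IH] s tp /=.
  by move=> _ h; exists s; split=> //; apply: ENop.
case/andP=> jn uj h.
have [l [r [tr e]]] := exec_act1 (a j) (h j).
set s1 := upd _ _ _ in e.
have h1 : tapes_rel s1 (fun i => if i == j then tape_act (tp i) (a i) else tp i).
  move=> i; rewrite /s1 !updE !regE; case: eqP => [->//|_]; exact: h.
have [s' [e' h' o']] := IH _ _ uj h1.
exists s'; split.
- by apply: ESeq e e' _; rewrite mulnS addnA.
- move=> i; have := h' i; rewrite inE; case: eqP => [->|_] //=.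
  by rewrite (negPf jn).
- move=> i hi; rewrite (o' i hi) /s1 !updE.
  have := ltn_ord j; rewrite /N /lr /rr in hi *.
  by case: eqP => [|_]; [lia | case: eqP => [|_] //; lia].
Qed.

(** The letters under the heads are gathered in the control of the program by nested case
    distinctions, and the continuation [h] receives the complete vector. *)
Fixpoint read_all (js : seq 'I_k) (v : {ffun 'I_k -> option (tsym M)})
    (h : {ffun 'I_k -> option (tsym M)} -> cmd G) : cmd G :=
  if js is j :: js' then
    case_top (rr j) (fun o => read_all js' [ffun i => if i == j then obind dT o else v i] h)
  else h v.

Let exec_read_all (js : seq 'I_k) (v : {ffun 'I_k ->
  option (tsym M)}) h s tp T s' : tapes_rel s tp ->
  exec (h [ffun i => if i \in js then tcur (tp i) else v i]) s T s' ->
  exec (read_all js v h) s (T + size js) s'.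
Proof.
move=> tr; elim: js v => [|j js IH] v /= e.
  rewrite addn0; move: e; set v' := finfun _.
  by have -> : v' = v by apply/ffunP => i; rewrite ffunE.
rewrite addnS; apply: exec_case; apply: IH.
move: e; congr (exec (h _) _ _ _); apply/ffunP => i; rewrite !ffunE inE.
have [->|_] //= := eqVneq i j; case: ifP => // _.
by have [_ [->|[-> -> _]]] := tr j => //=; rewrite eTK.
Qed.

Let step (q : mstate M) : cmd G :=
  read_all (enum 'I_k) [ffun => None] (fun v =>
    Seq (Pop G 1) (Seq (Push 1 (eQ (trans q v).1)) (do_acts (enum 'I_k) (trans q v).2))).

Let crep (s : store G) (c : mconfig M) :=
  [/\ s 0 = [::], s 1 = [:: eQ c.1], tapes_rel s c.2 & forall i, N <= i -> s i = [::]].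

Let exec_step s c : crep s c -> verdict c.1 = None ->
  exists s', exec (step c.1) s (11 * k + 3) s' /\ crep s' (mstep c).
Proof.
move=> [s0 s1 tr so] vN.
have ev : [ffun i => if i \in enum 'I_k then tcur (c.2 i) else [ffun => None] i] = mread c.
  by apply/ffunP => i; rewrite !ffunE mem_enum.
pose q' := (trans c.1 (mread c)).1; pose a := (trans c.1 (mread c)).2.
pose s1' := upd (upd s 1 [::]) 1 [:: eQ q'].
have tr1 : tapes_rel s1' c.2 by move=> j; rewrite /s1' !updE /=; apply: tr.
have [s' [e' tr' o']] := exec_do_acts a (enum_uniq 'I_k) tr1.
exists s'; split.
  have -> : 11 * k + 3 = (1 + (1 + (10 * k + 1))) + size (enum 'I_k).
    by rewrite size_enum_ord; lia.
  apply: (exec_read_all tr); rewrite ev -/q' -/a.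
  apply: exec_seq; first exact: EPop.
  apply: exec_seq; first exact: EPush.
  by move: e'; rewrite size_enum_ord /s1' updE eqxx s1.
rewrite /mstep vN; case et : (trans _ _) => [q2 a2].
have [-> ->] : q2 = q' /\ a2 = a by rewrite /q' /a et.
split=> //=.
- by rewrite o'; [rewrite /s1' !updE | left].
- by rewrite o'; [rewrite /s1' !updE | left].
- by move=> j; have := tr' j; rewrite mem_enum.
- move=> i hi; rewrite o'; last by right.
  by rewrite /s1' !updE; case: eqP hi => [->|_ hi]; [rewrite /N; lia | apply: so].
Qed.

Let running (o : option G) :=
  if obind dQ o is Some q then if verdict q is None then Some q else None else None.
Let loop : cmd G := Auto tt 1 (fun _ o => omap (fun _ => tt) (running o))
  (fun _ o => if running o is Some q then step q else Nop G).

Let exec_loop n s c b : crep s c -> verdict (iter n (@mstep A M) c).1 = Some b ->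
  exists s' c', [/\ exec loop s ((11 * k + 4) * n + 2) s',
    crep s' c' & verdict c'.1 = Some b].
Proof.
elim: n s c => [|n IH] s c h v.
  exists s, c; split=> //; case: (h) => _ s1 _ _.
  apply: (@EAutoEnd _ _ _ _ _ _ _ _ 1); rewrite /running ?s1 /= ?eQK //=; last by lia.
    by rewrite v; apply: ENop.
  by rewrite (v : verdict c.1 = _).
case: (h) => _ s1 _ _.
case vc : (verdict c.1) => [b'|].
  have vb : b' = b.
    by have := verdict_iter (t := 0) vc (leq0n n.+1); rewrite v => -[].
  exists s, c; split=> //; last by rewrite vc vb.
  apply: (@EAutoEnd _ _ _ _ _ _ _ _ 1); rewrite /running ?s1 /= ?eQK /= ?vc //; last by lia.
  exact: ENop.
have [s2 [e2 h2]] := exec_step h vc.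
rewrite iterSr in v; have [s' [c' [e' h' v']]] := IH _ _ h2 v.
exists s', c'; split=> //.
apply: (@EAutoStep _ _ _ tt _ _ _ _ s2 _ (11 * k + 3) ((11 * k + 4) * n + 2)) => //;
  rewrite /running ?s1 /= ?eQK /= ?vc //.
by rewrite mulnS; lia.
Qed.

Let clears (l : seq nat) : cmd G := foldr (fun i c => Seq (clear i) c) (Nop G) l.

Let exec_clears l s B : (forall i, size (s i) <= B) ->
  exec (clears l) s ((2 * B + 2) * size l + 1) (fun i => if i \in l then [::] else s i).
Proof.
elim: l s => [|j l IH] s h; first by apply: ENop; lia.
have h1 i : size (upd s j [::] i) <= B by rewrite updE; case: eqP.
have e : exec (clear j) s (2 * B + 2) (upd s j [::]).
  by apply: exec_le (exec_clear j s); have := h j; lia.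
apply: (@ESeq _ _ _ _ _ _ _ ((2 * B + 2) * size l + 1) _ e); last by rewrite /= mulnS addnA.
have := IH _ h1; congr exec; apply: functional_extensionality => i.
by rewrite inE updE; case: eqP => //=; case: ifP.
Qed.

(** The machine leaves data on its tapes; they are erased because [FP] asks for empty stacks at the
    end. *)
Let finish : cmd G := Seq (case_top 1 (fun o => if obind dQ o is Some q then
  if verdict q == Some true then Push 0 yes else Nop G else Nop G)) (clears (iota 1 N)).

(** Stack 3 is [rr ord0], the half of the input tape under and to the right of the head; the detour
    through stack 1 keeps the input in order. *)
Let compute : cmd G :=
  Seq (move 0 1) (Seq (move 1 3) (Seq (Push 1 (eQ (start M))) loop)).
Let call : cmd G := Seq compute finish.

Lemma uses_call : uses call N.+1.
Proof.
have lrN j : lr j < N.+1 by have := ltn_ord j; rewrite /lr /N; lia.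
have rrN j : rr j < N.+1 by have := ltn_ord j; rewrite /rr /N; lia.
have uact j a : uses (act1 j a) N.+1.
  apply: uses_seq => //; case: a => w [] //=; split=> //; split=> // _ [g|] //=.
have udo js a : uses (do_acts js a) N.+1 by elim: js => // j js IH; apply: uses_seq.
have uread js v h : (forall v, uses (h v) N.+1) -> uses (read_all js v h) N.+1.
  by move=> hh; elim: js v => // j js IH v; apply: uses_case => // o; apply: IH.
have ustep q : uses (step q) N.+1 by apply: uread => v; do !split=> //; apply: udo.
have uloop : uses loop N.+1.
  by split=> // _ o /=; case: (running o).
have uclears l : (forall i, i \in l -> i < N.+1) -> uses (clears l) N.+1.
  elim: l => // i l IH h; apply: uses_seq; last by apply: IH => j hj; apply: h;
    rewrite inE hj orbT.
  by apply: uses_clear; apply: h; rewrite inE eqxx.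
apply: uses_seq.
  apply: uses_seq; first exact: uses_move.
  by apply: uses_seq; first exact: uses_move.
apply: uses_seq.
  by apply: uses_case => // -[g|] //=; case: (dQ g) => // q; case: ifP.
by apply: uclears => i; rewrite mem_iota; lia.
Qed.

Variables (p : {poly nat}) (L : language A).
Hypothesis ML : forall x, verdict (iter p.[size x]%R (@mstep A M) (minit M x)).1 = Some
  (L x).

Let exec_call (a : seq A) :
  let n := size a in let y := map (fun u => eT (Some (inject M u))) a in
  let T1 := (3 * n + 2) + ((3 * n + 2) + (1 + ((11 * k + 4) * p.[n]%R + 2))) in
  exec call (in1 y) (T1 + (2 + ((2 * (n + T1 + 2) + 2) * N + 1)))
    (in1 (if L a then [:: yes] else [::])).
Proof.
move=> n y T1; have sy : size y = n by rewrite size_map.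
pose s1 : store G := fun i => if i == 3 then y else if i == 1 then [:: eQ (start M)] else
  [::].
have h1 : crep s1 (minit M a).
  split=> //; last by move=> i; rewrite /N /s1; case: eqP => [->|_];
    [lia | case: eqP => [->|_] //; lia].
  move=> j; have l0 : s1 (lr j) = [::] by rewrite /s1 /lr; do 2!(case: eqP => [|_];
    first lia).
  rewrite l0 /=; case: eqP => [->|jn].
    split; rewrite /s1 /rr /=; rewrite /y; case: (a) => [|u a'] //=; [by right | left].
    by rewrite -!map_comp.
  have -> : s1 (rr j) = [::].
    rewrite /s1 /rr; case: eqP => [e|_]; last by case: eqP => [|_] //; lia.
    by case: jn; apply: ord_inj; move: (nat_of_ord j) e => m; rewrite /=; lia.
  by split=> //; right.
have [s2 [c2 [e2 h2 v2]]] := exec_loop h1 (ML a).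
have e3 : exec compute (in1 y) T1 s2.
  have m1 := exec_move (in1 y) (isT : 0 != 1).
  set s' := upd _ 1 _ in m1.
  have m2 := exec_move s' (isT : 1 != 3).
  have t2 : size (s' 1) = n by rewrite /s' updE /= cats0 size_rev.
  apply: exec_seq; first by rewrite -sy; exact: m1.
  apply: exec_seq; first by rewrite -{1}t2; exact: m2.
  apply: exec_seq; first exact: EPush.
  move: e2; congr exec; apply: functional_extensionality => -[|[|[|[|i]]]] //=.
  by rewrite /s' !updE /= !cats0 revK.
have B2 i : size (s2 i) <= n + T1.
  have := exec_size i e3; rewrite /in1; case: i => [|i] /=; lia.
have [s20 s21 _ s2o] := h2.
pose fl : seq G := if L a then [:: yes] else [::].
have e4 : exec (case_top 1 (fun o => if obind dQ o is Some q then
    if verdict q == Some true then Push 0 yes else Nop G else Nop G)) s2 2 (upd s2 0 fl).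
  apply: exec_case; rewrite s21 /= eQK v2 /fl; case: (L a) => /=.
    by rewrite -[X in yes :: X]s20; apply: EPush.
  by rewrite -[X in upd _ _ X]s20 upd_id; apply: ENop.
have B4 i : size (upd s2 0 fl i) <= n + T1 + 2.
  by rewrite updE; case: eqP => _; [rewrite /fl; case: ifP => /=; lia | have := B2 i; lia].
have e5 := exec_clears (iota 1 N) B4; rewrite size_iota in e5.
have -> : in1 fl = (fun i => if i \in iota 1 N then [::] else upd s2 0 fl i).
  apply: functional_extensionality => -[|i]; rewrite mem_iota //.
  by case: ifP => // h; rewrite updE /= s2o //; lia.
exact: exec_seq e3 (exec_seq e4 e5).
Qed.

(** A homomorphism first translates the letters into tape symbols and drops those which [dA]
    rejects; the simulated machine then sees a genuine input. *)
Lemma FP_machine (dA : G -> option A) :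
  FP (fun x => if L (pmap dA x) then [:: yes] else [::]).
Proof.
have [c [K [d [u h]]]] := FP_hom (fun g => if dA g is Some a then [:: eT (Some (inject M
  a))] else [::]).
have [e pe] := pb_poly p.
pose T n := (n + 2) ^ d; pose P n := (n + 2) ^ e.
pose T1 n := (3 * n + 2) + ((3 * n + 2) + (1 + ((11 * k + 4) * P n + 2))).
apply: (@FP_intro _ _ (Seq c call) (maxn K N.+1)
  (fun n => T n + (T1 n + (2 + ((2 * (n + T1 n + 2) + 2) * N + 1))))).
- by apply: uses_seq; [apply: uses_le u | apply: uses_le uses_call]; lia.
- by rewrite /T /T1 /P; pb_tac.
move=> x; apply: exec_seq; first exact: h.
have -> : flatten [seq if dA g is Some a then [:: eT (Some (inject M a))] else [::] | g
  <- x]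
    = [seq eT (Some (inject M u)) | u <- pmap dA x].
  by elim: (x) => //= g y ->; case: (dA g).
apply: exec_le (exec_call _) => /=.
have le1 : size (pmap dA x) <= size x by rewrite size_pmap count_size.
have le2 : p.[size (pmap dA x)]%R <= P (size x).
  apply: leq_trans (pe _) _; rewrite /P; case: (e) => // e'; rewrite leq_exp2r //; lia.
have le3 : (11 * k + 4) * p.[size (pmap dA x)]%R <= (11 * k + 4) * P (size x)
  by rewrite leq_mul2l le2 orbT.
set U := 3 * size (pmap dA x) + 2 + _; have leU : U <= T1 (size x) by rewrite /U /T1; lia.
apply: leq_add => //; rewrite leq_add2l leq_add2r leq_mul2r; apply/orP; right; lia.
Qed.
End Call.

(** ** Boolean tests *)

Section Tests.
Variables (G : finType) (yes : G).

Definition flag (b : bool) : seq G := if b then [:: yes] else [::].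
Definition FPB (b : seq G -> bool) := FP (fun x => flag (b x)).

Lemma FPB_ext b b' : FPB b -> b =1 b' -> FPB b'.
Proof. by move=> h e; apply: FP_ext h _ => x; rewrite e. Qed.

Lemma FP_const (y : seq G) : FP (fun _ => y).
Proof.
apply: FP_ext (@FP_pdt G unit (fun _ _ => tt) (fun _ _ _ => ([::], [::]))
  (fun _ _ => y) tt [::]) _.
by elim.
Qed.

Lemma FPB_empty f : FP f -> FPB (fun x => f x == [::]).
Proof.
move=> hf; pose t := @pdt G bool (fun _ _ => false) (fun _ _ _ => ([::], [::]))
  (fun q _ => flag q).
have tF y : t false [::] y = [::] by elim: y.
by apply: FP_ext (FP_comp (FP_pdt _ _ _ true [::] : FP (t true [::])) hf) _ => x;
  case: (f x).
Qed.

Lemma FPB_neg b : FPB b -> FPB (fun x => ~~ b x).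
Proof. by move/FPB_empty=> h; apply: FP_ext h _ => x; case: (b x). Qed.

Lemma FPB_nonempty f : FP f -> FPB (fun x => f x != [::]).
Proof. by move/FPB_empty/FPB_neg. Qed.

Lemma FPB_or b b' : FPB b -> FPB b' -> FPB (fun x => b x || b' x).
Proof.
move=> h h'; apply: FP_ext (FPB_nonempty (FP_cat h h')) _ => x.
by case: (b x); case: (b' x).
Qed.

Lemma FPB_and b b' : FPB b -> FPB b' -> FPB (fun x => b x && b' x).
Proof.
move=> h h'; apply: FPB_ext (FPB_neg (FPB_or (FPB_neg h) (FPB_neg h'))) _ => x.
by rewrite negb_or !negbK.
Qed.

Lemma FPB_const c : FPB (fun _ => c). Proof. exact: FP_const. Qed.

Lemma FPB_all (I : eqType) (l : seq I) (b : I -> seq G -> bool) :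
  (forall i, i \in l -> FPB (b i)) -> FPB (fun x => all (b^~ x) l).
Proof.
elim: l => [|i l IH] h; first exact: FPB_const.
apply: FPB_and; first by apply: h; rewrite inE eqxx.
by apply: IH => j jl; apply: h; rewrite inE jl orbT.
Qed.

Lemma FPB_has (I : eqType) (l : seq I) (b : I -> seq G -> bool) :
  (forall i, i \in l -> FPB (b i)) -> FPB (fun x => has (b^~ x) l).
Proof.
move=> h; have h' : FPB (fun x => ~~ all (fun i => ~~ b i x) l).
  by apply: FPB_neg; apply: FPB_all => i /h /FPB_neg.
by apply: FPB_ext h' _ => x; rewrite -has_predC; apply: eq_has => i /=; rewrite negbK.
Qed.

(** ** String functions with values in a sub-alphabet *)

Variable hash : G.

(* Functions into [seq X] are computed through the encoding [e] of letters; the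
   separator [hash] lies outside the image of [e]. *)
Definition FPT (X : Type) (e : X -> G) (f : seq G -> seq X) := FP (fun x => map e (f x)).

Lemma FPT_ext (X : Type) (e : X -> G) f f' : FPT e f -> f =1 f' -> FPT e f'.
Proof. by move=> h E; apply: FP_ext h _ => x; rewrite E. Qed.

Lemma FPT_cat (X : Type) (e : X -> G) f g : FPT e f -> FPT e g ->
  FPT e (fun x => f x ++ g x).
Proof. by move=> hf hg; apply: FP_ext (FP_cat hf hg) _ => x; rewrite map_cat. Qed.

Lemma FPT_const (X : Type) (e : X -> G) y : FPT e (fun _ => y).
Proof. exact: FP_const. Qed.

Lemma FPT_cons (X : Type) (e : X -> G) a f : FPT e f -> FPT e (fun x => a :: f x).
Proof. exact: (@FPT_cat X e (fun _ => [:: a]) f (FPT_const e _)). Qed.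

Lemma FPT_trans (X Y : Type) (e : X -> G) (e' : Y -> G) f F phi : FPT e f -> FP F ->
  (forall u, F (map e u) = map e' (phi u)) -> FPT e' (fun x => phi (f x)).
Proof. by move=> hf hF E; apply: FP_ext (FP_comp hF hf) _ => x; rewrite E. Qed.

Lemma FPT_pmap (X Y : Type) (e : X -> G) (e' : Y -> G) (d : X -> option Y) (dX : G ->
  option X) f :
  pcancel e dX -> FPT e f -> FPT e' (fun x => pmap d (f x)).
Proof.
move=> eK hf; apply: (FPT_trans hf (FP_hom (fun g => if obind d (dX g) is Some y then [::
  e' y] else [::]))).
by elim=> //= a u ->; rewrite eK /=; case: (d a).
Qed.

Lemma FPT_map (X Y : Type) (e : X -> G) (e' : Y -> G) (h : X -> Y) (dX : G -> option X) f :
  pcancel e dX -> FPT e f -> FPT e' (fun x => map h (f x)).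
Proof.
move=> eK hf; apply: FPT_ext (FPT_pmap e' (fun a => Some (h a)) eK hf) _ => x.
by elim: (f x) => //= a u ->.
Qed.

Definition otop (o : option G) : seq G := if o is Some t then [:: t] else [::].

Lemma otopK (stk : seq G) : otop (ohead stk) ++ behead stk = stk.
Proof. by case: stk. Qed.

Section Sub.
Variables (X : Type) (e : X -> G).
Hypothesis e_hash : forall a, (e a == hash) = false.

(** A transducer works only while it reads, so it is fed the word twice: the first copy fills the
    stack, the second one provides the steps in which the stack is emptied. *)
Lemma FPT_rev f : FPT e f -> FPT e (fun x => rev (f x)).
Proof.
move=> hf.
have h2 : FP (fun x => map e (f x) ++ [:: hash] ++ map e (f x)).
  by apply: FP_cat hf (FP_cat (FP_const _) hf).
pose t := @pdt G bool (fun q g => q || (g == hash))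
  (fun q g o => if q then ([::], otop o)
                else if g == hash then (otop o, [::]) else (g :: otop o, [::]))
  (fun _ _ => [::]).
apply: FP_ext (FP_comp (FP_pdt _ _ _ false [::] : FP (t false [::])) h2) _ => x.
have pop (u : seq X) stk : size stk <= size u -> t true stk (map e u) = stk.
  elim: u stk => [|a u IH] [|s stk] //= le; first exact: (IH [::]).
  by congr cons; apply: IH.
have push u v stk : t false stk (map e u ++ hash :: map e v) =
    t true (map e (rev u) ++ stk) (map e v).
  elim: u stk => [|a u IH] stk /=; first by rewrite eqxx otopK.
  by rewrite e_hash /= otopK IH rev_cons map_rcons cat_rcons.
by rewrite push cats0 pop // size_map size_rev.
Qed.

Variable h : option G -> option G -> seq G.

(** A letterwise combination of two words, the shorter one padded with [None]; equality and
    comparison of numbers are both instances. *)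
Fixpoint zmap (u v : seq G) : seq G :=
  if u is a :: u' then h (Some a) (ohead v) ++ zmap u' (behead v)
  else flatten [seq h None (Some b) | b <- v].

Lemma FP_zmap f g : FPT e f -> FPT e g -> FP (fun x => zmap (map e (f x)) (map e (g x))).
Proof.
move=> hf hg.
have h2 : FP (fun x => map e (rev (f x)) ++ [:: hash] ++ map e (g x) ++ [:: hash] ++ map
  e (f x)).
  apply: FP_cat (FPT_rev hf) (FP_cat (FP_const _) (FP_cat hg (FP_cat (FP_const _) hf))).
(* The first copy of [f x] loads the stack; the second one only paces the
   removal of what [g x] leaves on it. *)
pose t := @pdt G (option bool)
  (fun q g => if g == hash then if q is None then Some false else Some true else q)
  (fun q g o => if g == hash then (otop o, [::]) else
     match q with
     | None => (g :: otop o, [::])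
     | Some false => ([::], h o (Some g))
     | Some true => ([::], if o is Some a then h (Some a) None else [::])
     end)
  (fun _ _ => [::]).
apply: FP_ext (FP_comp (FP_pdt _ _ _ None [::] : FP (t None [::])) h2) _ => x.
have t2 (u : seq X) stk : size stk <= size u ->
    t (Some true) stk (map e u) = flatten [seq h (Some a) None | a <- stk].
  elim: u stk => [|a u IH] [|s stk] //= le; rewrite e_hash //=; first exact: (IH [::]).
  by congr (_ ++ _); apply: IH.
have z0 u : zmap u [::] = flatten [seq h (Some a) None | a <- u].
  by elim: u => //= a u ->.
have t1 (w v : seq X) stk : size stk <= size w ->
    t (Some false) stk (map e v ++ hash :: map e w) = zmap stk (map e v).
  elim: v stk => [|b v IH] stk le /=; first by rewrite eqxx /= otopK t2.
  rewrite e_hash /= IH; last by rewrite size_behead; lia.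
  by case: stk {le}.
have t0 u v stk : t None stk (map e u ++ hash :: v) = t (Some false) (map e (rev u) ++
  stk) v.
  elim: u stk => [|a u IH] stk /=; first by rewrite eqxx otopK.
  by rewrite e_hash /= otopK IH rev_cons map_rcons cat_rcons.
by rewrite t0 revK cats0 t1 // size_map.
Qed.
End Sub.

(** Every mismatch, including a letter against the padding, leaves a mark; the words agree when no
    mark is left. *)
Lemma FPB_eq (X : eqType) (e : X -> G) f g : injective e ->
  (forall a, (e a == hash) = false) -> FPT e f -> FPT e g -> FPB (fun x => f x == g x).
Proof.
move=> e_inj eh hf hg.
apply: FPB_ext (FPB_empty (FP_zmap eh (fun a b => flag (a != b)) hf hg)) _ => x;
  move: (f x) (g x).
elim=> [|a u IH] [|b v] //=; rewrite (inj_eq Some_inj) (inj_eq e_inj) eqseq_cons.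
by case: (a == b); rewrite //=; apply: IH.
Qed.

(** ** Binary numbers, least significant bit first *)

Fixpoint incb (u : seq bool) : seq bool :=
  match u with
  | [::] => [:: true]
  | true :: u' => false :: incb u'
  | false :: u' => true :: u'
  end.

(** With the least significant bit first, the last position at which the words differ decides; [r]
    is the verdict on the positions already read. *)
Definition cmpb (r a b : bool) := if a == b then r else a.
Fixpoint gtb (r : bool) (u v : seq bool) : bool :=
  if u is a :: u' then gtb (cmpb r a (head false v)) u' (behead v)
  else foldl (cmpb^~ false) r v.

Variable e : bool -> G.
Hypotheses (e_inj : injective e) (e_hash : forall b, (e b == hash) = false).

Lemma FPT_incb f : FPT e f -> FPT e (fun x => incb (f x)).
Proof.
pose t := @pdt G bool (fun q g => q && (g == e true))
  (fun q g _ => ([::], if q then [:: e (g != e true)] else [:: g]))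
  (fun q _ => if q then [:: e true] else [::]).
move=> hf; apply: (FPT_trans hf (FP_pdt _ _ _ true [::] : FP (t true [::]))).
have tF u : t false [::] u = u by elim: u => //= a u ->.
elim=> // -[] u IH /=; first by rewrite eqxx /= IH.
by rewrite (inj_eq e_inj) /= tF.
Qed.

Lemma FPT_iter_incb n f : FPT e f -> FPT e (fun x => iter n incb (f x)).
Proof. by move=> hf; elim: n => //= n IH; apply: FPT_incb. Qed.

(** [h] keeps the bit of the first word wherever the two differ, with the padding read as 0; the
    last bit kept is the verdict, remembered in the state of [t]. *)
Lemma FPB_gtb f g : FPT e f -> FPT e g -> FPB (fun x => gtb false (f x) (g x)).
Proof.
pose d (o : option G) := o == Some (e true).
pose h a b := if d a == d b then [::] else [:: e (d a)].
move=> hf hg; have hz := FP_zmap e_hash h hf hg.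
pose t := @pdt G bool (fun _ g => g == e true) (fun _ _ _ => ([::],
  [::])) (fun q _ => flag q).
apply: FP_ext (FP_comp (FP_pdt _ _ _ false [::] : FP (t false [::])) hz) _ => x.
have de b : d (Some (e b)) = b.
  by rewrite /d (inj_eq Some_inj) (inj_eq e_inj); case: b.
have et b : (e b == e true) = b by rewrite (inj_eq e_inj); case: b.
have th r (a b : option bool) y : t r [::] (h (omap e a) (omap e b) ++ y) =
    t (cmpb r (odflt false a) (odflt false b)) [::] y.
  have dE c : d (omap e c) = odflt false c by case: c => [c|] //=; apply: de.
  rewrite /h !dE /cmpb; case: eqP => //= _; congr (t _ _ _).
  by rewrite et.
have step r u v : t r [::] (zmap h (map e u) (map e v)) = flag (gtb r u v).
  elim: u r v => [|a u IH] r v /=.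
    elim: v r => //= b v IH r; have := th r None (Some b) => /= ->; exact: IH.
  have -> : ohead (map e v) = omap e (ohead v) by case: v.
  have := th r (Some a) (ohead v) => /= ->.
  by rewrite behead_map IH; case: v.
exact: step.
Qed.

End Tests.

Fixpoint bval (u : seq bool) : nat := if u is b :: u' then b + 2 * bval u' else 0.

Lemma gtbE r u v : gtb r u v = (bval v < bval u) || ((bval u == bval v) && r).
Proof.
elim: u r v => [|a u IH] r v /=.
  elim: v r => [|b v IH] r //=; rewrite IH /cmpb.
  by case: b; case: r => /=; apply/idP/idP; lia.
rewrite IH /cmpb; have -> : bval v = head false v + 2 * bval (behead v) by case: v.
by case: a; case: (head false v); case: r => /=; apply/idP/idP; lia.
Qed.

Lemma bits_recE k n : n <= k -> bits_rec k n = bits n.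
Proof.
rewrite /bits; elim/ltn_ind: n k => -[|n] IH k; first by case: k.
case: k => // k le /=; congr cons.
have lt : uphalf n < n.+1 by rewrite ltnS; lia.
by rewrite (IH _ lt k) ?(IH _ lt n) //; lia.
Qed.

Lemma bits_step n : 0 < n -> bits n = odd n :: bits n./2.
Proof. by case: n => // n _; rewrite /bits /= [bits_rec n _]bits_recE //; lia. Qed.

Lemma bvalK n : bval (bits n) = n.
Proof.
elim/ltn_ind: n => -[|n] // IH; rewrite bits_step //= IH; first by lia.
by rewrite ltnS; lia.
Qed.

Lemma incb_bits n : incb (bits n) = bits n.+1.
Proof.
elim/ltn_ind: n => -[|n] // IH; rewrite bits_step // [RHS]bits_step //=.
case on : (odd n) => /=; last by rewrite IH; [congr (_ :: bits _); lia | lia].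
by congr (_ :: bits _); lia.
Qed.

Lemma size_bits n d : n < 2 ^ d -> size (bits n) <= d.
Proof.
elim: d n => [|d IH] n; first by case: n.
case: n => // n lt; rewrite bits_step //= ltnS; apply: IH.
by rewrite expnS in lt; lia.
Qed.

Lemma bits_size n : n < 2 ^ size (bits n).
Proof.
elim/ltn_ind: n => -[|n] // IH; rewrite bits_step //= expnS.
have := IH (uphalf n); rewrite ltnS => /(_ ltac:(lia)); lia.
Qed.

(** * Unique decoding of configurations *)

Section Decoding.
Variable Sg : alphabet.
Implicit Types (S : config Sg) (ss : seq (srt Sg)) (u : seq (letter Sg)).

Definition bitl (b : bool) : letter Sg := Some (inr b).
Definition flet (f : Defs.fsym Sg) : letter Sg := Some (inl (inr f)).
Definition plet (p : psym Sg) : letter Sg := Some (inl (inl p)).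

Definition forest_code (ts : seq (term Sg)) := flatten (map (@encode_term Sg) ts).

Lemma forest_code_cat ts ts' : forest_code (ts ++ ts') = forest_code ts ++ forest_code ts'.
Proof. by rewrite /forest_code map_cat flatten_cat. Qed.

Lemma all2_cat (T U : Type) (r : T -> U -> bool) s1 s2 t1 t2 :
  all2 r s1 t1 -> all2 r s2 t2 -> all2 r (s1 ++ s2) (t1 ++ t2).
Proof. by elim: s1 t1 => [|a s1 IH] [|b t1] //= /andP[-> /IH h] /h ->. Qed.

Lemma all2_split (T U : Type) (r : T -> U -> bool) s t1 t2 : all2 r s (t1 ++ t2) ->
  exists s1 s2, [/\ s = s1 ++ s2, all2 r s1 t1 & all2 r s2 t2].
Proof.
elim: t1 s => [|b t1 IH] s /=; first by exists [::], s.
case: s => // a s /= /andP[rab /IH[s1 [s2 [-> h1 h2]]]].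
by exists (a :: s1), s2; rewrite /= rab.
Qed.

Lemma all2_size_eq (T U : Type) (r : T -> U -> bool) s t : all2 r s t -> size s = size t.
Proof. by elim: s t => [|a s IH] [|b t] //= /andP[_ /IH ->]. Qed.

(** Terms are coded in Polish notation; [ss] is the pushdown of sorts still expected, and a function
    symbol replaces its sort by those of its arguments. *)
Fixpoint tparse ss u : bool :=
  if u is l :: u' then
    match l, ss with
    | Some (inl (inr f)), s :: ss' => (fres f == s) && tparse (fargs f ++ ss') u'
    | _, _ => false
    end
  else ss == [::].

Lemma tparse_sound ss u : tparse ss u -> exists ts,
  [/\ all2 (@has_sort Sg) ts ss, all (@ground Sg) ts & u = forest_code ts].
Proof.
elim: u ss => [|l u IH] ss /=; first by move/eqP=> ->; exists [::].
case: l => [[[//|f]|//]|//]; case: ss => // s ss /andP[/eqP fs /IH[ts [h1 h2 ->]]].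
have [us [vs [ets hu hv]]] := all2_split h1.
exists (App f us :: vs); move: h2; rewrite ets all_cat => /andP[gu gv].
split; rewrite /= ?fs ?eqxx ?hu ?gu //.
by rewrite forest_code_cat /forest_code /=.
Qed.

Lemma tparse_complete ss ts : all2 (@has_sort Sg) ts ss -> all (@ground Sg) ts ->
  tparse ss (forest_code ts).
Proof.
move en : (size (forest_code ts)) => n.
elim: n ss ts en => [|n IH] ss [|[v|f us] ts] //=; try by case: ss.
move=> [en]; case: ss => // s ss /= /andP[/andP[fs hu] hv] /andP[gu gv].
rewrite fs /= -[flatten _]/(forest_code us) -/(forest_code ts) -forest_code_cat.
apply: IH; last by rewrite all_cat gu.
  by rewrite forest_code_cat.
exact: all2_cat.
Qed.

(** The sorts fix the arities, hence the code is prefix-free. The induction is on the length of the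
    code, because removing a head symbol merges its arguments with the rest of the forest. *)
Lemma forest_code_inj ss ts ts' u u' :
  all2 (@has_sort Sg) ts ss -> all (@ground Sg) ts ->
  all2 (@has_sort Sg) ts' ss -> all (@ground Sg) ts' ->
  forest_code ts ++ u = forest_code ts' ++ u' -> ts = ts' /\ u = u'.
Proof.
move en : (size (forest_code ts)) => n.
elim: n ss ts ts' en => [|n IH] ss ts ts' en h1 g1 h2 g2.
  case: ts en h1 g1 => [|[v|f us] ts] //= _ h1 _ e.
  by case: ss h1 h2 => // _; case: ts' g2 e.
case: ts en h1 g1 h2 => [|[v|f us] ts] //= en.
case: ss => // s ss /= /andP[/andP[fs hu] hv] /andP[gu gv].
case: ts' g2 => [|[v|f' us'] ts'] //= /andP[gu' gv'] /andP[/andP[fs' hu'] hv'] [ef].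
move: hu' => {fs'}; rewrite -ef => hu'.
rewrite -[flatten (map _ us)]/(forest_code us) -[flatten (map _ us')]/(forest_code us').
rewrite -[flatten (map _ ts)]/(forest_code ts) -[flatten (map _ ts')]/(forest_code ts').
rewrite -!forest_code_cat => ecode.
have [|||||ecat ->] := IH (fargs f ++ ss) (us ++ ts) (us' ++ ts') _ _ _ _ _ ecode.
- by case: en => <-; rewrite forest_code_cat.
- exact: all2_cat.
- by rewrite all_cat gu.
- exact: all2_cat.
- by rewrite all_cat gu'.
have eqs : size us = size us' by rewrite (all2_size_eq hu) (all2_size_eq hu').
by move/eqP: ecat; rewrite eqseq_cat // => /andP[/eqP -> /eqP ->]; rewrite ef.
Qed.

Definition is_start (l : letter Sg) : bool :=
  match l with None | Some (inl (inl _)) => true | _ => false end.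
(** [Time] and the predicate symbols occur only at the beginning of an encoded fact, so a word that
    passes this test can be cut off only at a boundary between facts. *)
Definition startok u : bool := if u is l :: _ then is_start l else true.

Definition wf_tfact (f : tfact Sg) := ground_fact f.1 && sorted_fact f.1.

Lemma startok_encode S : startok (encode S).
Proof. by case: S => [|[[|a] t] S]. Qed.

Lemma encode_cat S S' : encode (S ++ S') = encode S ++ encode S'.
Proof. by rewrite /encode map_cat flatten_cat. Qed.

(** The hypotheses on [u] and [u'] exclude that the last bits of a timestamp are counted as part of
    the rest. *)
Lemma bits_code_inj (b b' : seq bool) u u' : startok u -> startok u' ->
  map bitl b ++ u = map bitl b' ++ u' -> b = b' /\ u = u'.
Proof.
move=> hu hu'; elim: b b' => [|x b IH] [|x' b'] //=.
- by move=> e; rewrite e /= in hu.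
- by move=> e; rewrite -e /= in hu'.
- by case=> -> /IH[-> ->].
Qed.

Definition atom_code (a : atom Sg) := plet a.1 :: forest_code a.2.

Lemma decode_pred a b u S : sorted_atom a -> all (@ground Sg) a.2 -> startok u ->
  all wf_tfact S -> encode S = atom_code a ++ map bitl b ++ u ->
  exists t S', [/\ S = (Pred a, t) :: S', b = bits t & u = encode S'].
Proof.
move=> sa ga hu; case: S => [|[[|a'] t] S] //= /andP[/andP[/= ga' sa'] _].
case: a a' sa ga sa' ga' => [p ts] [p' ts'] sa ga sa' ga' [ep e].
rewrite /sorted_atom /= -ep in sa sa' ga ga'; rewrite -catA in e.
have [et eb] := forest_code_inj sa' ga' sa ga e.
have [eb' eu] := bits_code_inj (startok_encode S) hu eb.
by exists t, S; split; rewrite ?ep ?et ?eb' ?eu.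
Qed.

Lemma decode_time b u S : startok u -> encode S = None :: map bitl b ++ u ->
  exists t S', [/\ S = (Time, t) :: S', b = bits t & u = encode S'].
Proof.
move=> hu; case: S => [|[[|a'] t] S] //= [e].
have [eb' eu] := bits_code_inj (startok_encode S) hu e.
by exists t, S; split; rewrite ?eb' ?eu.
Qed.

Lemma encode_term_nonstart t : all (predC is_start) (@encode_term Sg t).
Proof.
move: t; fix IH 1; case=> [v|f ts] //=.
by elim: ts => //= t ts h; rewrite all_cat IH h.
Qed.

Lemma encode_tfact_nonstart (f : tfact Sg) : exists l u,
  encode_tfact f = l :: u /\ all (predC is_start) u.
Proof.
have hb t : all (predC is_start) [seq Some (inr b) : letter Sg | b <- bits t].
  by elim: (bits t).
case: f => [[|a] t]; rewrite /encode_tfact /=; do 2!eexists; split=> //.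
by rewrite all_cat hb andbT; elim: a.2 => //= x ts h; rewrite all_cat encode_term_nonstart.
Qed.

(** If the first fact fits into [u], remove it and recurse; otherwise [u] must be empty, since a
    later cut inside the fact would make [v] start with a letter that cannot start a fact. *)
Lemma decode_cat u v S : startok v -> encode S = u ++ v ->
  exists S1 S2, [/\ S = S1 ++ S2, u = encode S1 & v = encode S2].
Proof.
move=> hv; elim: S u => [|f S IH] u.
  by case: u => //= <-; exists [::], [::].
have [l [w [ef hw]]] := encode_tfact_nonstart f.
have ec R : encode (f :: R) = l :: w ++ encode R by rewrite /encode /= ef.
rewrite ec; case: u => [/= <-|l' u /= [<- e]].
  by exists [::], (f :: S); rewrite ec.
have [le|lt] := leqP (size w) (size u).
  have eu : u = w ++ drop (size w) u.
    have := congr1 (take (size w)) e; rewrite take_size_cat // takel_cat // => {1}->.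
    by rewrite cat_take_drop.
  move: e; rewrite eu -catA => /eqP; rewrite eqseq_cat // eqxx /= => /eqP /IH.
  move=> [S1 [S2 [-> -> ->]]]; exists (f :: S1), S2; split=> //.
have ew : w = u ++ drop (size u) w.
  have := congr1 (take (size u)) e;
    rewrite takel_cat ?(ltnW lt) // take_size_cat // => {1}<-.
  by rewrite cat_take_drop.
(* The part of the fact beyond the cut is nonempty and opens [v], against [startok v]. *)
have dn : size (drop (size u) w) != 0 by rewrite size_drop; lia.
move: e hw; rewrite ew -catA => /eqP;
  rewrite eqseq_cat // eqxx /= all_cat => /eqP e /andP[_].
by move: e hv dn; case: (drop _ _) => [|x y] //= <- /= ->.
Qed.

End Decoding.

(** * Steps of traces on encoded configurations *)

Section Steps.
Variable Sg : alphabet.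
Implicit Types (S R : config Sg) (u X Y : seq (letter Sg)).
Implicit Types (V : var Sg -> seq (letter Sg)) (T : tvar -> seq bool).
Notation bitl := (bitl Sg).

Definition tick_ok X Y (tau : seq bool) u :=
  [&& X == None :: map bitl tau ++ u, Y == None :: map bitl (incb tau) ++ u & startok u].

Definition swap_ok X Y u1 u2 u3 u4 :=
  [&& X == u1 ++ u2 ++ u3 ++ u4, Y == u1 ++ u3 ++ u2 ++ u4,
      startok u2, startok u3 & startok u4].

Fixpoint term_vars (t : term Sg) : seq (var Sg) :=
  match t with Var v => [:: v] | App _ ts => flatten (map term_vars ts) end.
Definition atom_vars (a : atom Sg) := flatten (map term_vars a.2).

Fixpoint tstr V (t : term Sg) : seq (letter Sg) :=
  match t with Var v => V v | App f ts => flet f :: flatten (map (tstr V) ts) end.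
Definition astr V (a : atom Sg) := plet a.1 :: flatten (map (tstr V) a.2).
Definition pre_str V T (p : seq (atom Sg * tvar)) :=
  flatten [seq astr V w.1 ++ map bitl (T w.2) | w <- p].
Definition post_str V (t : seq bool) (p : seq (atom Sg * nat)) :=
  flatten [seq astr V w.1 ++ map bitl (iter w.2 incb t) | w <- p].

(** Words can only be incremented, so a negative offset moves to the other side; [Negz n] stands for
    [-(n + 1)], hence the [n.+1]. *)
Definition holdsb T (c : constr) : bool :=
  match c with
  | CGt x y (Posz n) => gtb false (T x) (iter n incb (T y))
  | CGt x y (Negz n) => gtb false (iter n.+1 incb (T x)) (T y)
  | CEq x y (Posz n) => T x == iter n incb (T y)
  | CEq x y (Negz n) => iter n.+1 incb (T x) == T y
  end.

Definition rule_tvars (r : irule Sg) := tT :: [seq p.2 | p <- wpre r ++ fpre r].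
Definition rule_vars (r : irule Sg) :=
  flatten [seq atom_vars p.1 | p <- wpre r ++ fpre r ++ post r].

(** The words for the variables come from the certificate and may be arbitrary. Parsing them, also
    for variables that occur only in [post], ensures that the facts created are ground and well
    sorted. *)
Definition rule_ok (r : irule Sg) X Y u V T :=
  [&& X == None :: map bitl (T tT) ++ pre_str V T (wpre r) ++ pre_str V T (fpre r) ++ u,
      Y == None :: map bitl (T tT) ++ pre_str V T (wpre r) ++ post_str V (T tT) (post r)
        ++ u,
      startok u,
      all (fun v : var Sg => tparse [:: v.1] (V v)) (rule_vars r)
    & all (holdsb T) (guard r)].

Lemma encode_cons f S : encode (f :: S) = encode_tfact f ++ encode S. Proof. by []. Qed.
Lemma pre_str_cons V T w p :
  pre_str V T (w :: p) = (astr V w.1 ++ map bitl (T w.2)) ++ pre_str V T p.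
Proof. by []. Qed.
Lemma post_str_cons V t w p :
  post_str V t (w :: p) = (astr V w.1 ++ map bitl (iter w.2 incb t)) ++ post_str V t p.
Proof. by []. Qed.

Lemma is_configE S : is_config S = all (@wf_tfact Sg) S && (count (fun f : tfact Sg =>
  f.1 == Time) S == 1).
Proof. by []. Qed.

Lemma perm_config S S' : perm_eq S S' -> is_config S = is_config S'.
Proof.
by move=> h; rewrite !is_configE (perm_all _ h) (permP h).
Qed.

Lemma tick_sound S X Y tau u : is_config S -> X = encode S -> tick_ok X Y tau u ->
  exists S', [/\ Y = encode S', is_config S' & fires Tick S S'].
Proof.
move=> cS -> /and3P[/eqP eX /eqP -> hu].
have [t [R [eS -> ->]]] := decode_time hu eX.
exists ((Time, t.+1) :: R); split.
- by rewrite incb_bits.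
- by rewrite eS in cS.
- by exists t, R; rewrite eS.
Qed.

Lemma startok_cat u u' : startok u -> startok u' -> startok (u ++ u').
Proof. by case: u. Qed.

Lemma swap_sound S X Y u1 u2 u3 u4 : X = encode S -> swap_ok X Y u1 u2 u3 u4 ->
  exists S', Y = encode S' /\ perm_eq S S'.
Proof.
move=> -> /and5P[/eqP eX /eqP -> h2 h3 h4].
have [S1 [R1 [-> -> e1]]] := decode_cat (startok_cat h2 (startok_cat h3 h4)) eX.
have [S2 [R2 [-> -> e2]]] := decode_cat (startok_cat h3 h4) (esym e1).
have [S3 [S4 [-> -> ->]]] := decode_cat h4 (esym e2).
exists (S1 ++ S3 ++ S2 ++ S4); rewrite !encode_cat; split=> //.
by rewrite perm_cat2l !catA perm_cat2r perm_catC.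
Qed.

(** * Instances of patterns and their encodings *)

Section Instances.
Variables (sg : var Sg -> term Sg).
Hypothesis sgs : sorted_subst sg.

Lemma subst_sort t s : has_sort t s -> has_sort (subst sg t) s.
Proof.
move: t s; fix IH 1; case=> [v|f ts] s /=; first by move/eqP <-; apply: sgs.
case/andP=> -> /=; elim: ts (fargs f) => [|t ts h] [|s' ss] //= /andP[ht hts].
by rewrite IH //; apply: h.
Qed.

Lemma subst_sorted a : sorted_atom a -> sorted_atom (subst_atom sg a).
Proof.
rewrite /sorted_atom /=; elim: a.2 (pargs a.1) => [|t ts h] [|s ss] //= /andP[ht hts].
by rewrite subst_sort //; apply: h.
Qed.

Lemma subst_ground t : all (fun v => ground (sg v)) (term_vars t) = ground (subst sg t).
Proof.
move: t; fix IH 1; case=> [v|f ts] /=; first by rewrite andbT.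
by elim: ts => //= t ts h; rewrite all_cat IH h.
Qed.

Lemma subst_ground_atom a :
  all (fun v => ground (sg v)) (atom_vars a) = all (@ground Sg) (subst_atom sg a).2.
Proof.
by rewrite /atom_vars /=; elim: a.2 => //= t ts h; rewrite all_cat subst_ground h.
Qed.

Variable V : var Sg -> seq (letter Sg).

Lemma tstrE t : {in term_vars t, forall v, V v = encode_term (sg v)} ->
  tstr V t = encode_term (subst sg t).
Proof.
move: t; fix IH 1; case=> [v|f ts] /= h; first by apply: h; rewrite inE.
congr cons; elim: ts h => //= t ts h1 h; rewrite h1; last first.
  by move=> v hv; apply: h; rewrite mem_cat hv orbT.
by rewrite IH // => v hv; apply: h; rewrite mem_cat hv.
Qed.

Lemma astrE a : {in atom_vars a, forall v, V v = encode_term (sg v)} ->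
  astr V a = atom_code (subst_atom sg a).
Proof.
move=> h; congr cons; move: h; rewrite /forest_code /atom_vars /=.
elim: a.2 => //= t ts h1 h; rewrite h1; last first.
  by move=> v hv; apply: h; rewrite mem_cat hv orbT.
by rewrite tstrE // => v hv; apply: h; rewrite mem_cat hv.
Qed.

Lemma pre_strE T tau p :
  (forall w, w \in p -> {in atom_vars w.1, forall v, V v = encode_term (sg v)}) ->
  (forall w, w \in p -> T w.2 = bits (tau w.2)) ->
  pre_str V T p = encode (pre_inst sg tau p).
Proof.
elim: p => // w p IH hv ht; rewrite pre_str_cons [pre_inst _ _ _]/= encode_cons.
rewrite astrE; last by apply: hv; rewrite inE eqxx.
rewrite ht ?inE ?eqxx //; congr (_ ++ _).
by apply: IH => w' hw; [apply: hv | apply: ht]; rewrite inE hw orbT.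
Qed.

Lemma iter_incb n t : iter n incb (bits t) = bits (t + n).
Proof. by elim: n => [|n IH]; rewrite ?addn0 //= IH incb_bits addnS. Qed.

Lemma post_strE t p :
  (forall w, w \in p -> {in atom_vars w.1, forall v, V v = encode_term (sg v)}) ->
  post_str V (bits t) p = encode (post_inst sg t p).
Proof.
elim: p => // w p IH hv; rewrite post_str_cons [post_inst _ _ _]/= encode_cons.
rewrite astrE; last by apply: hv; rewrite inE eqxx.
rewrite iter_incb; congr (_ ++ _).
by apply: IH => w' hw; apply: hv; rewrite inE hw orbT.
Qed.

Lemma decode_pre T p u S :
  (forall w, w \in p -> [/\ sorted_atom w.1, {in atom_vars w.1, forall v,
    V v = encode_term (sg v)}
     & {in atom_vars w.1, forall v, ground (sg v)}]) ->
  startok u -> all (@wf_tfact Sg) S -> encode S = pre_str V T p ++ u ->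
  exists S', [/\ S = pre_inst sg (fun x => bval (T x)) p ++ S',
    (forall w, w \in p -> T w.2 = bits (bval (T w.2))) & u = encode S'].
Proof.
elim: p S => [|w p IH] S hp hu wS; first by move=> /= <-; exists S.
have [sa va ga] := hp w (mem_head _ _).
rewrite pre_str_cons -!catA astrE // => e.
have hsp : startok (pre_str V T p ++ u) by apply: startok_cat => //; case: (p).
have [||t [S1 [eS eT eS1]]] := decode_pred _ _ hsp wS e.
- exact: subst_sorted.
- by rewrite -subst_ground_atom; apply/allP.
have wS1 : all (@wf_tfact Sg) S1 by move: wS; rewrite eS /= => /andP[].
have [|S' [eS' eT' eu]] := IH S1 _ hu wS1 (esym eS1).
  by move=> w' hw; apply: hp; rewrite inE hw orbT.
exists S'; split=> //; first by rewrite eS eS' /= eT bvalK.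
by move=> w'; rewrite inE => /orP[/eqP ->|/eT' //]; rewrite eT bvalK.
Qed.

End Instances.

Lemma holdsbE T tau c : {in constr_vars c, forall x, T x = bits (tau x)} ->
  holdsb T c = holds tau c.
Proof.
case: c => x y N h;
  (have hx : T x = bits (tau x) by apply: h; rewrite inE eqxx);
  (have hy : T y = bits (tau y) by apply: h; rewrite !inE eqxx orbT);
  clear h; rewrite /holdsb /holds; case: N => n; rewrite hx hy !iter_incb.
- by rewrite gtbE !bvalK andbF orbF; apply/idP/idP; lia.
- by rewrite gtbE !bvalK andbF orbF NegzE; apply/idP/idP; lia.
- by rewrite (can_eq bvalK); apply/idP/idP; lia.
- by rewrite (can_eq bvalK) NegzE; apply/idP/idP; lia.
Qed.

(** A variable outside [l] is sent to itself, which keeps the substitution well sorted even at sorts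
    without ground terms. *)
Lemma choose_terms (P : var Sg -> term Sg -> Prop) (l : seq (var Sg)) :
  (forall v, v \in l -> exists t, P v t) ->
  exists sg : var Sg -> term Sg,
    (forall v, v \in l -> P v (sg v)) /\ (forall v, v \notin l -> sg v = Var v).
Proof.
elim: l => [|v l IH] h; first by exists Var.
have [|sg [h1 h2]] := IH; first by move=> v' hv; apply: h; rewrite inE hv orbT.
have [t Pt] := h v (mem_head _ _).
exists (fun v' => if v' == v then t else sg v'); split=> v'; rewrite inE.
  by case: eqP => [->|_] //= hv; apply: h1.
by case: eqP => //= _; apply: h2.
Qed.

Lemma count_pre sg tau p : count (fun f : tfact Sg => f.1 == Time) (pre_inst sg tau p) = 0.
Proof. by elim: p => //= w p ->. Qed.

Lemma count_post sg t p : count (fun f : tfact Sg => f.1 == Time) (post_inst sg t p) = 0.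
Proof. by elim: p => //= w p ->. Qed.

Lemma rule_sound r S X Y u V T : wf_irule r -> is_config S -> X = encode S ->
  rule_ok r X Y u V T ->
  exists S', [/\ Y = encode S', is_config S' & fires (Inst r) S S'].
Proof.
move=> /and3P[wpr wpo wg] cS -> /and5P[/eqP eX /eqP -> hu hV hg].
have [v hv|sg [hsg hsg']] := @choose_terms (fun v t => [/\ has_sort t v.1,
  ground t & V v = encode_term t])
    (rule_vars r).
  have /tparse_sound[ts [h1 h2 ->]] := allP hV _ hv.
  case: ts h1 h2 => [|t [|? ?]] //=; rewrite ?andbF // !andbT => ht gt.
  by exists t; rewrite /forest_code /= cats0.
have sgs : sorted_subst sg.
  move=> v; case hv : (v \in rule_vars r); first by have [] := hsg v hv.
  by rewrite hsg' ?hv //= eqxx.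
have hvars w : w \in wpre r ++ fpre r ++ post r -> {in atom_vars w.1, forall v,
    V v = encode_term (sg v)} /\ {in atom_vars w.1, forall v, ground (sg v)}.
  move=> hw; have hv v : v \in atom_vars w.1 -> v \in rule_vars r.
    by move=> hv; apply/flattenP; exists (atom_vars w.1) => //; apply/mapP; exists w.
  by split=> v /hv /hsg[].
have hpre w : w \in wpre r ++ fpre r ->
    [/\ sorted_atom w.1, {in atom_vars w.1, forall v, V v = encode_term (sg v)}
      & {in atom_vars w.1, forall v, ground (sg v)}].
  move=> hw; have [|h1 h2] := hvars w; first by rewrite catA mem_cat hw.
  by split=> //; apply: (allP wpr).
have hpost w : w \in post r ->
    [/\ sorted_atom w.1, {in atom_vars w.1, forall v, V v = encode_term (sg v)}
      & {in atom_vars w.1, forall v, ground (sg v)}].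
  move=> hw; have [|h1 h2] := hvars w; first by rewrite !mem_cat hw !orbT.
  by split=> //; apply: (allP wpo).
pose tau x := bval (T x).
have sp p v : startok v -> startok (pre_str V T p ++ v) by move=> hv;
  apply: startok_cat => //; case: p.
have [t [S1 [eS eT e1]]] := decode_time (sp _ _ (sp _ _ hu)) eX.
move: (cS); rewrite is_configE eS /= => /andP[wS1 cS1].
rewrite /pre_str catA -flatten_cat -map_cat -/(pre_str V T (wpre r ++ fpre r)) in e1.
have [R [eS1 eT1 eu]] := decode_pre sgs hpre hu wS1 (esym e1).
have tauT : tau tT = t by rewrite /tau eT bvalK.
have epre : pre_inst sg tau (wpre r ++ fpre r) = pre_inst sg tau (wpre r) ++ pre_inst sg
  tau (fpre r).
  exact: map_cat.
exists ((Time, t) :: pre_inst sg tau (wpre r) ++ post_inst sg t (post r) ++ R).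
have cS' : is_config ((Time, t) :: pre_inst sg tau (wpre r) ++ post_inst sg t (post r) ++
  R).
  rewrite eS1 epre !all_cat in wS1; case/andP: wS1 => /andP[w1 w2] w3.
  rewrite eS1 epre !count_cat !count_pre /= in cS1.
  rewrite is_configE /= !all_cat w1 w3 !count_cat count_pre count_post /= cS1 !andbT.
  apply/allP => f /mapP[w hw ->]; rewrite /wf_tfact /=.
  have [h1 _ h3] := hpost w hw.
  by rewrite -subst_ground_atom subst_sorted // andbT; apply/allP.
split=> //.
  rewrite eT (@pre_strE sg V T tau); last 2 first.
  - by move=> w hw; have [|] := hpre w; rewrite ?mem_cat ?hw.
  - by move=> w hw; apply: eT1; rewrite mem_cat hw.
  rewrite (@post_strE sg); last by move=> w /hpost[].
  by rewrite encode_cons !encode_cat eu.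
exists sg, tau, R; rewrite tauT; split=> //.
(* By [wf_irule] a guard speaks only of [tT] and of time variables of the precondition, whose words
   are canonical by [eT] and [eT1]. *)
- apply/allP => c hc; rewrite -(@holdsbE T); first exact: (allP hg).
  move=> x hx; have /(allP wg) : x \in flatten (map constr_vars (guard r)).
    by apply/flattenP; exists (constr_vars c) => //; apply: map_f.
  rewrite inE => /orP[/eqP ->|/mapP[w hw ->]]; last exact: eT1.
  by rewrite tauT.
- by rewrite eS1 epre -catA.
Qed.

Lemma tick_complete t R : tick_ok (encode ((Time, t) :: R)) (encode ((Time,
  t.+1) :: R)) (bits t) (encode R).
Proof. by rewrite /tick_ok incb_bits startok_encode /encode /= /encode_tfact /= !eqxx. Qed.

Lemma swap_complete S1 S2 S3 S4 :
  swap_ok (encode (S1 ++ S2 ++ S3 ++ S4)) (encode (S1 ++ S3 ++ S2 ++ S4))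
    (encode S1) (encode S2) (encode S3) (encode S4).
Proof. by rewrite /swap_ok !encode_cat !eqxx !startok_encode. Qed.

Lemma rule_complete r sg tau R V T :
  sorted_subst sg -> all (holds tau) (guard r) -> wf_irule r ->
  is_config ((Time, tau tT) :: pre_inst sg tau (wpre r) ++ pre_inst sg tau (fpre r) ++ R) ->
  is_config ((Time, tau tT) :: pre_inst sg tau (wpre r) ++ post_inst sg (tau tT) (post r)
    ++ R) ->
  {in rule_vars r, forall v, V v = encode_term (sg v)} ->
  {in rule_tvars r, forall x, T x = bits (tau x)} ->
  rule_ok r (encode ((Time, tau tT) :: pre_inst sg tau (wpre r) ++ pre_inst sg tau (fpre
    r) ++ R))
    (encode ((Time, tau tT) :: pre_inst sg tau (wpre r) ++ post_inst sg (tau tT) (post r)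
      ++ R))
    (encode R) V T.
Proof.
move=> sgs hg /and3P[_ _ wg] cS cS' hV hT.
have eT : T tT = bits (tau tT) by apply: hT; rewrite inE eqxx.
have ev w : w \in wpre r ++ fpre r ++ post r -> {subset atom_vars w.1 <= rule_vars r}.
  by move=> hw v hv; apply/flattenP; exists (atom_vars w.1) => //; apply/mapP; exists w.
have epre p : {subset p <= wpre r ++ fpre r} -> pre_str V T p = encode (pre_inst sg tau p).
  move=> hp; apply: pre_strE => [w /hp hw v hv|w /hp hw].
    by apply: hV; apply: (ev w) => //; rewrite catA mem_cat hw.
  by apply: hT; rewrite inE map_f ?orbT.
have epost : post_str V (bits (tau tT)) (post r) = encode (post_inst sg (tau tT) (post r)).
  by apply: post_strE => w hw v hv; apply: hV; apply: (ev w); rewrite // !mem_cat hw !orbT.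
apply/and5P; split.
- by rewrite eT !epre ?encode_cons ?encode_cat // => w; rewrite mem_cat => ->;
  rewrite ?orbT.
- by rewrite eT epost !epre ?encode_cons ?encode_cat // => w; rewrite mem_cat => ->;
  rewrite ?orbT.
- exact: startok_encode.
(* The value of [v] is ground because an instance of an atom containing [v] lies in one of the two
   configurations. *)
- apply/allP => v hv; rewrite hV // -[encode_term _]cats0.
  apply: (@tparse_complete _ [:: v.1] [:: sg v]); rewrite /= ?andbT ?sgs //.
  case/flattenP: hv => s /mapP[w hw ->] hv.
  move: cS cS'; rewrite !is_configE /= !all_cat.
  move=> /andP[/and3P[w1 w2 _] _] /andP[/and3P[_ w3 _] _].
  have ga : all (@ground Sg) (subst_atom sg w.1).2.
    move: hw; rewrite !mem_cat => /or3P[] hw.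
    + by have /andP[] := allP w1 _ (map_f (fun p : atom Sg * nat => (Pred (subst_atom sg
      p.1), tau p.2)) hw).
    + by have /andP[] := allP w2 _ (map_f (fun p : atom Sg * nat => (Pred (subst_atom sg
      p.1), tau p.2)) hw).
    + by have /andP[] := allP w3 _ (map_f (fun p : atom Sg * nat => (Pred (subst_atom sg
      p.1), tau tT + p.2)) hw).
  by rewrite -subst_ground_atom in ga; apply: (allP ga).
- apply/allP => c hc; rewrite (@holdsbE T tau); first exact: (allP hg).
  move=> x hx; apply: hT; apply: (allP wg).
  by apply/flattenP; exists (constr_vars c) => //; apply: map_f.
Qed.

End Steps.

(** * The certificate checker *)

(** [Sep] ends a piece and [Blk] a block, [Fin] precedes the last configuration, [KTick] and [KSwap]
    head blocks. [Hash] is internal to the checker: the separator of intermediate words and the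
    letter for a positive answer. *)
Inductive mark := Sep | Blk | Fin | Hash | KTick | KSwap.
Definition mark_ord (k : mark) : 'I_6 :=
  inord (match k with Sep => 0 | Blk => 1 | Fin => 2 | Hash => 3 | KTick => 4 | KSwap =>
    5 end).
Definition ord_mark (i : 'I_6) : mark := nth Sep [:: Sep; Blk; Fin; Hash; KTick; KSwap] i.
Lemma mark_ordK : cancel mark_ord ord_mark.
Proof. by case; rewrite /ord_mark /mark_ord inordK. Qed.
HB.instance Definition _ := Equality.copy mark (can_type mark_ordK).
HB.instance Definition _ := Choice.copy mark (can_type mark_ordK).
HB.instance Definition _ := Countable.copy mark (can_type mark_ordK).
HB.instance Definition _ := Finite.copy mark (can_type mark_ordK).

Section Checker.
Variables (Sg : alphabet) (A : system Sg) (n : nat).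
Variables (Mc Mm : machine (letter Sg)) (Lc Lm : language (letter Sg)).

Definition cert : finType := (letter Sg + (mark + 'I_(size A)))%type.
(* The two copies of [letter Sg] distinguish the two kinds of queries. *)
Definition query : finType := (letter Sg + letter Sg)%type.
(** Besides the input of the verifier, the working alphabet holds the sorts on the stack of the
    parser and the tape symbols and states of the two machines that are called. *)
Definition sym : finType := (cert + (query + (srt Sg +
  ((option (tsym Mc) + mstate Mc) + (option (tsym Mm) + mstate Mm)))))%type.

Definition Ltr (l : letter Sg) : sym := inl (inl l).
Definition Mk (k : mark) : sym := inl (inr (inl k)).
Definition Rl (i : 'I_(size A)) : sym := inl (inr (inr i)).
Definition Srt (s : srt Sg) : sym := inr (inr (inl s)).
Definition dL (g : sym) : option (letter Sg) := if g is inl (inl l) then Some l else None.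
Definition eO (o : option (letter Sg)) : sym := if o is Some l then Ltr l else Mk Sep.
Definition eB (b : bool) : sym := Ltr (bitl Sg b).
Definition getbit (l : letter Sg) : option bool :=
  if l is Some (inr b) then Some b else None.

Notation FPB := (FPB (Mk Hash)).
Notation FPL := (FPT Ltr).

Lemma LtrK : pcancel Ltr dL. Proof. by []. Qed.
Lemma Ltr_hash l : (Ltr l == Mk Hash) = false. Proof. by apply/eqP. Qed.
Lemma eO_hash l : (eO l == Mk Hash) = false. Proof. by apply/eqP; case: l. Qed.
Lemma eB_hash l : (eB l == Mk Hash) = false. Proof. by apply/eqP. Qed.
Lemma Ltr_inj : injective Ltr. Proof. by move=> l l' []. Qed.
Lemma eO_inj : injective eO. Proof. by move=> [l|] [l'|] //= [->]. Qed.
Lemma eB_inj : injective eB. Proof. by move=> l l' []. Qed.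

(** Symbols other than letters are skipped, so the head of a block does not disturb its first piece.
    A missing piece reads as the empty word. *)
Fixpoint pcs (j : nat) (b : seq sym) : seq (letter Sg) :=
  if b is g :: b' then
    if g == Mk Sep then if j is j'.+1 then pcs j' b' else [::]
    else if (j, dL g) is (0, Some l) then l :: pcs j b' else pcs j b'
  else [::].

Definition tb j b := pmap getbit (pcs j b).
Definition inn (b : seq sym) := pcs 0 b.
Definition outt (b : seq sym) := pcs 1 b.

(** In a rule block, pieces 0 and 1 are the configurations before and after, piece 2 is the
    unmatched rest, and then come the time variables and the term variables. [index] picks the first
    of repeated occurrences, so one variable has one value. *)
Definition tpc (r : irule Sg) (b : seq sym) (x : tvar) := tb (3 + index x (rule_tvars r)) b.
Definition vpc (r : irule Sg) (b : seq sym) (v : var Sg) :=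
  pcs (3 + size (rule_tvars r) + index v (rule_vars r)) b.

Definition is_tick (b : seq sym) := ohead b == Some (Mk KTick).
Definition tick_blk b :=
  [&& is_tick b, tick_ok (inn b) (outt b) (tb 2 b) (pcs 3 b) & Lm (inn b)].
Definition swap_blk b := (ohead b == Some (Mk KSwap)) &&
  swap_ok (inn b) (outt b) (pcs 2 b) (pcs 3 b) (pcs 4 b) (pcs 5 b).
Definition rule_blk b (i : 'I_(size A)) := (ohead b == Some (Rl i)) &&
  rule_ok (tnth (in_tuple A) i) (inn b) (outt b) (pcs 2 b)
    (vpc (tnth (in_tuple A) i) b) (tpc (tnth (in_tuple A) i) b).
Definition blk_ok b := [|| tick_blk b, swap_blk b | has (rule_blk b) (enum 'I_(size A))].

(** The input of the verifier is a query followed by a certificate; the letters of the query lie in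
    the other summand and are dropped here. *)
Fixpoint bpart (z : seq sym) : seq sym :=
  if z is g :: z' then
    if g == Mk Fin then [::] else if g is inl _ then g :: bpart z' else bpart z'
  else [::].
Fixpoint fpart (z : seq sym) : seq (letter Sg) :=
  if z is g :: z' then if g == Mk Fin then pmap dL z' else fpart z' else [::].
Definition dql (g : sym) := if g is inr (inl (inl l)) then Some l else None.
Definition dqr (g : sym) := if g is inr (inl (inr l)) then Some l else None.
(** A query of the first kind consists of [dql] letters, one of the second kind of [dqr] letters in
    reverse order; as one of the two parts is empty, the concatenation recovers the configuration in
    both cases. *)
Definition xpart z := pmap dql z ++ rev (pmap dqr z).

(** A terminator after each word reduces equality of two lists of words to a single equality of
    words. *)
Definition flat (ss : seq (seq (letter Sg))) : seq (option (letter Sg)) :=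
  flatten [seq rcons (map Some s) None | s <- ss].

Definition zblocks z := blocks (Mk Blk) (bpart z).
Definition crits z := has (fun b => Lc (inn b)) (zblocks z) || Lc (fpart z).
(** The first test compares two shifted lists: the output of each block, with the queried
    configuration in front, is the input of the next one, with the final configuration at the end.
    In the last test the right-hand side is the kind of the query. *)
Definition check (z : seq sym) : bool :=
  [&& flat (xpart z :: map outt (zblocks z)) == flat (rcons (map inn (zblocks z)) (fpart
    z)),
      all blk_ok (zblocks z), count is_tick (zblocks z) == n
    & crits z == (pmap dqr z != [::])].

Lemma flat_inj : injective flat.
Proof.
have cut s s' (u u' : seq (option (letter Sg))) :
    rcons (map Some s) None ++ u = rcons (map Some s') None ++ u' -> s = s' /\ u = u'.
  rewrite !cat_rcons; elim: s s' => [|a s IH] [|a' s'] //= []; first by [].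
  by move=> -> /IH[-> ->].
elim=> [|s ss IH] [|s' ss'] //.
- by rewrite /flat /= cat_rcons; case: s'.
- by rewrite /flat /= cat_rcons; case: s.
by rewrite /flat /= => /cut[-> /IH ->].
Qed.

Lemma flat_cons s ss : flat (s :: ss) = rcons (map Some s) None ++ flat ss.
Proof. by []. Qed.
Lemma flat_rcons ss s : flat (rcons ss s) = flat ss ++ rcons (map Some s) None.
Proof. by rewrite /flat map_rcons -cats1 flatten_cat /= cats0. Qed.

(** ** The checker runs in polynomial time *)

(** The finite control counts the separators still to be passed; [None] is the state behind the
    wanted piece. *)
Lemma FPL_pcs j : FPL (pcs j).
Proof.
pose t := @pdt sym (option 'I_j.+1)
  (fun q g => if q is Some i then if g == Mk Sep then
     if (i : nat) is i'.+1 then Some (inord i') else None else Some i else None)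
  (fun q g _ => ([::], if q is Some i then if (g != Mk Sep) && (i == 0 :> nat)
     then map Ltr (oapp (fun l => [:: l]) [::] (dL g)) else [::] else [::]))
  (fun _ _ => [::]).
apply: FP_ext (FP_pdt _ _ _ (Some ord_max) [::] : FP (t _ _)) _ => b.
have tN y : t None [::] y = [::] by elim: y.
suff h i : i < j.+1 -> t (Some (inord i)) [::] b = map Ltr (pcs i b).
  by have := h j (ltnSn j); have -> : inord j = ord_max :> 'I_j.+1 by apply: ord_inj;
    rewrite inordK.
elim: b i => //= g b IH i ij; rewrite inordK //; case: eqP => //= _.
  by case: i ij => [|i] ij /=; [exact: tN | apply: IH; lia].
case: i ij => [|i] ij /=; last exact: IH.
by case: (dL g) => [l|] /=; rewrite -/(t _ _ _) IH.
Qed.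

Lemma FPT_tb j : FPT eB (tb j).
Proof. exact: FPT_pmap LtrK (FPL_pcs j). Qed.

Lemma FPL_bits f : FPT eB f -> FPL (fun x => map (bitl Sg) (f x)).
Proof.
apply: (@FPT_map _ _ _ eB Ltr (bitl Sg) (fun g => obind getbit (dL g))).
by [].
Qed.

Lemma FPL_flatten (I : Type) (l : seq I) (F : I -> seq sym -> seq (letter Sg)) :
  (forall i, FPL (F i)) -> FPL (fun x => flatten [seq F i x | i <- l]).
Proof.
move=> h; elim: l => [|i l IH]; first exact: FPT_const.
by apply: FPT_cat.
Qed.

Lemma FPB_eqL f g : FPL f -> FPL g -> FPB (fun x => f x == g x).
Proof. exact: (FPB_eq _ Ltr_inj Ltr_hash). Qed.

Lemma FPB_startok f : FPL f -> FPB (fun x => startok (f x)).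
Proof.
move=> hf; pose t := @pdt sym bool (fun _ _ => true)
  (fun q g _ => ([::], if q || oapp (@is_start Sg) true (dL g) then [::] else [:: g]))
  (fun _ _ => [::]).
have tT y : t true [::] y = [::] by elim: y.
have := FPB_empty (Mk Hash) (FP_comp (FP_pdt _ _ _ false [::] : FP (t _ _)) hf).
move=> h; apply: FPB_ext h _ => x; case: (f x) => [|l u] //=.
by rewrite -/(t _ _ _) tT; case: (is_start l).
Qed.

Lemma FPB_head g : FPB (fun b => ohead b == Some g).
Proof.
pose t := @pdt sym bool (fun _ _ => true)
  (fun q g' _ => ([::], if ~~ q && (g' == g) then [:: g] else [::]))
  (fun _ _ => [::]).
have tT y : t true [::] y = [::] by elim: y.
have h := FPB_nonempty (Mk Hash) (FP_pdt _ _ _ false [::] : FP (t false [::])).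
apply: FPB_ext h _ => -[|g' u] //=; rewrite -/(t _ _ _) tT (inj_eq Some_inj).
by case: (g' == g).
Qed.

(** The transducer stack is the list of expected sorts. Every failure, including sorts left over at
    the end, emits [Hash], so success is the empty output. *)
Lemma FPB_tparse s f : FPL f -> FPB (fun x => tparse [:: s] (f x)).
Proof.
pose dS (g : sym) := if g is inr (inr (inl s)) then Some s else None.
pose act (g : sym) (o : option sym) : seq sym * seq sym :=
  if (dL g, obind dS o) is (Some (Some (inl (inr f))), Some s) then
    if fres f == s then (map Srt (fargs f), [::]) else ([::], [:: Mk Hash])
  else ([::], [:: Mk Hash]).
pose t := @pdt sym unit (fun _ _ => tt) (fun _ => act)
  (fun _ o => if o is Some _ then [:: Mk Hash] else [::]).
move=> hf; have := FPB_empty (Mk Hash) (FP_comp (FP_pdt _ _ _ tt [:: Srt s] : FP (t _ _))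
  hf).
move=> h; apply: FPB_ext h _ => x.
suff E u ss : (t tt (map Srt ss) (map Ltr u) == [::]) = tparse ss u
  by apply: (E (f x) [:: s]).
elim: u ss => [|l u IH] ss /=; first by case: ss.
rewrite -/(t _ _ _) /act /=; case: l => [[[p|f']|b]|] //; case: ss => [|s' ss] //=.
by case: (_ == s') => //=; rewrite -map_cat -/(t _ _ _) IH.
Qed.

Lemma FPB_holdsb (T : seq sym -> tvar -> seq bool) c : (forall x, FPT eB (T^~ x)) ->
  FPB (fun b => holdsb (T b) c).
Proof.
move=> hT; have hTn m x : FPT eB (fun b => iter m incb (T b x)).
  exact: (FPT_iter_incb eB_inj).
case: c => x y [] m /=.
- exact: (FPB_gtb (Mk Hash) eB_inj eB_hash).
- exact: (FPB_gtb (Mk Hash) eB_inj eB_hash (hTn m.+1 x)).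
- exact: (FPB_eq (Mk Hash) eB_inj eB_hash).
- exact: (FPB_eq (Mk Hash) eB_inj eB_hash (hTn m.+1 x)).
Qed.

Lemma FPL_astr (V : seq sym -> var Sg -> seq (letter Sg)) a : (forall v, FPL (V^~ v)) ->
  FPL (fun b => astr (V b) a).
Proof.
move=> hV; have ht t : FPL (fun b => tstr (V b) t).
  move: t; fix IH 1; case=> [v|f ts] /=; first exact: hV.
  apply: FPT_cons; elim: ts => [|t ts h] /=; first exact: FPT_const.
  by apply: FPT_cat.
by apply: FPT_cons; apply: FPL_flatten.
Qed.

Lemma FPB_tick_ok X Y tau u : FPL X -> FPL Y -> FPT eB tau -> FPL u ->
  FPB (fun b => tick_ok (X b) (Y b) (tau b) (u b)).
Proof.
move=> hX hY ht hu; apply: FPB_and; last apply: FPB_and.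
- by apply: FPB_eqL hX _; apply: FPT_cons; apply: FPT_cat hu; apply: FPL_bits.
- apply: FPB_eqL hY _; apply: FPT_cons; apply: FPT_cat hu; apply: FPL_bits.
  exact: (FPT_incb eB_inj).
- exact: FPB_startok.
Qed.

Lemma FPB_swap_ok X Y u1 u2 u3 u4 : FPL X -> FPL Y -> FPL u1 -> FPL u2 -> FPL u3 ->
  FPL u4 ->
  FPB (fun b => swap_ok (X b) (Y b) (u1 b) (u2 b) (u3 b) (u4 b)).
Proof.
move=> hX hY h1 h2 h3 h4; apply: FPB_and; last apply: FPB_and; last apply: FPB_and;
  last apply: FPB_and; try exact: FPB_startok.
- by apply: FPB_eqL hX _; do 3!apply: FPT_cat => //.
- by apply: FPB_eqL hY _; do 3!apply: FPT_cat => //.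
Qed.

Lemma FPB_rule_ok r X Y u (V : seq sym -> var Sg -> seq (letter Sg)) (T : seq sym ->
  tvar -> seq bool) :
  FPL X -> FPL Y -> FPL u -> (forall v, FPL (V^~ v)) -> (forall x, FPT eB (T^~ x)) ->
  FPB (fun b => rule_ok r (X b) (Y b) (u b) (V b) (T b)).
Proof.
move=> hX hY hu hV hT.
have hp p : FPL (fun b => pre_str (V b) (T b) p).
  apply: (@FPL_flatten _ p (fun w b => astr (V b) w.1 ++ map (bitl Sg) (T b w.2))) => w.
  by apply: FPT_cat; [apply: FPL_astr | apply: FPL_bits].
have hq p : FPL (fun b => post_str (V b) (T b tT) p).
  apply: (@FPL_flatten _ p (fun w b => astr (V b) w.1 ++ map (bitl Sg) (iter w.2 incb (T
    b tT)))) => w.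
  by apply: FPT_cat; [apply: FPL_astr | apply: FPL_bits; apply: (FPT_iter_incb eB_inj)].
have hTT : FPL (fun b => map (bitl Sg) (T b tT)) by apply: FPL_bits.
apply: FPB_and; last apply: FPB_and; last apply: FPB_and; last apply: FPB_and.
- by apply: FPB_eqL hX _; apply: FPT_cons; do 3!apply: FPT_cat => //.
- by apply: FPB_eqL hY _; apply: FPT_cons; do 3!apply: FPT_cat => //.
- exact: FPB_startok.
- by apply: (@FPB_all _ _ _ (rule_vars r) (fun (v : var Sg) b => tparse [:: v.1] (V b
  v))) => v _; apply: FPB_tparse.
- by apply: (@FPB_all _ _ _ (guard r) (fun c b => holdsb (T b) c)) => c _;
  apply: FPB_holdsb.
Qed.

Variables (pc pm : {poly nat}).
Hypothesis McP : forall x, verdict (iter pc.[size x]%R (@mstep _ Mc) (minit Mc x)).1 =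
  Some (Lc x).
Hypothesis MmP : forall x, verdict (iter pm.[size x]%R (@mstep _ Mm) (minit Mm x)).1 =
  Some (Lm x).

Lemma FPB_Lc f : FPL f -> FPB (fun x => Lc (f x)).
Proof.
pose eT (o : option (tsym Mc)) : sym := inr (inr (inr (inl (inl o)))).
pose dT (g : sym) := if g is inr (inr (inr (inl (inl o)))) then o else None.
pose eQ (q : mstate Mc) : sym := inr (inr (inr (inl (inr q)))).
pose dQ (g : sym) := if g is inr (inr (inr (inl (inr q)))) then Some q else None.
have h := @FP_machine _ _ Mc eT dT eQ dQ (Mk Hash) (fun _ => erefl) (fun _ => erefl) _ _
  McP dL.
move=> hf; apply: FP_ext (FP_comp h hf) _ => x.
by rewrite (map_pK LtrK).
Qed.

Lemma FPB_Lm f : FPL f -> FPB (fun x => Lm (f x)).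
Proof.
pose eT (o : option (tsym Mm)) : sym := inr (inr (inr (inr (inl o)))).
pose dT (g : sym) := if g is inr (inr (inr (inr (inl o)))) then o else None.
pose eQ (q : mstate Mm) : sym := inr (inr (inr (inr (inr q)))).
pose dQ (g : sym) := if g is inr (inr (inr (inr (inr q)))) then Some q else None.
have h := @FP_machine _ _ Mm eT dT eQ dQ (Mk Hash) (fun _ => erefl) (fun _ => erefl) _ _
  MmP dL.
move=> hf; apply: FP_ext (FP_comp h hf) _ => x.
by rewrite (map_pK LtrK).
Qed.

Lemma FPB_blk_ok : FPB blk_ok.
Proof.
apply: FPB_or; last apply: FPB_or.
- apply: FPB_and; first exact: FPB_head.
  apply: FPB_and; last by apply: FPB_Lm; apply: FPL_pcs.
  by apply: FPB_tick_ok; first [exact: FPL_pcs | exact: FPT_tb].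
- apply: FPB_and; first exact: FPB_head.
  by apply: FPB_swap_ok; exact: FPL_pcs.
- apply: (@FPB_has _ _ _ (enum 'I_(size A)) (fun i b => rule_blk b i)) => i _.
  apply: FPB_and; first exact: FPB_head.
  by apply: FPB_rule_ok => *; first [exact: FPL_pcs | exact: FPT_tb].
Qed.

Lemma FP_bpart : FP bpart.
Proof.
pose t := @pdt sym bool (fun q g => q || (g == Mk Fin))
  (fun q g _ => ([::], if q || (g == Mk Fin) then [::] else if g is inl _ then [:: g]
    else [::]))
  (fun _ _ => [::]).
have tT y : t true [::] y = [::] by elim: y.
apply: FP_ext (FP_pdt _ _ _ false [::] : FP (t false [::])) _.
elim=> //= g z IH; rewrite -/(t _ _ _); case: eqP => //= _.
by case: g => [c|c]; rewrite IH.
Qed.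

Lemma FPL_fpart : FPL fpart.
Proof.
pose t := @pdt sym bool (fun q g => q || (g == Mk Fin))
  (fun q g _ => ([::], if q then map Ltr (oapp (fun l => [:: l]) [::] (dL g)) else [::]))
  (fun _ _ => [::]).
have tT y : t true [::] y = map Ltr (pmap dL y).
  by elim: y => //= g y IH; rewrite -/(t _ _ _) IH; case: (dL g).
apply: FP_ext (FP_pdt _ _ _ false [::] : FP (t false [::])) _.
by elim=> //= g z IH; rewrite -/(t _ _ _); case: eqP.
Qed.

Lemma FPL_pmap (d : sym -> option (letter Sg)) : FPL (pmap d).
Proof.
apply: FP_ext (FP_hom (fun g => map Ltr (oapp (fun l => [:: l]) [::] (d g)))) _.
by elim=> //= g x ->; case: (d g).
Qed.

Lemma FP_zblocks f : FP f -> FP (fun z => flatten (map f (zblocks z))).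
Proof. by move=> hf; apply: FP_comp (FP_bmap (Mk Blk) hf) FP_bpart. Qed.

Lemma FPT_rconsO f : FPL f -> FPT eO (fun b => rcons (map Some (f b)) None).
Proof.
move=> hf; apply: FPT_ext (FPT_cat (FPT_map eO Some LtrK hf) (FPT_const eO [:: None])) _
  => b.
by rewrite cats1.
Qed.

Lemma FPT_flat f : FPL f -> FPT eO (fun z => flat (map f (zblocks z))).
Proof.
move=> hf; apply: FP_ext (FP_zblocks (FPT_rconsO hf)) _ => z;
  rewrite /flat map_flatten -!map_comp.
by congr flatten; apply: eq_map => b.
Qed.

Lemma FPB_crits : FPB crits.
Proof.
apply: FPB_or; last by apply: FPB_Lc; apply: FPL_fpart.
have h := FPB_nonempty (Mk Hash) (FP_zblocks (FPB_Lc (FPL_pcs 0))).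
apply: FPB_ext h _ => z.
by elim: (zblocks z) => //= b bl <-; rewrite /inn; case: (Lc _).
Qed.

Lemma FPB_check : FPB check.
Proof.
apply: FPB_and; last apply: FPB_and; last apply: FPB_and.
- apply: (FPB_eq _ eO_inj eO_hash).
    apply: FPT_ext (FPT_cat (FPT_rconsO _) (FPT_flat (FPL_pcs 1))) _; last by move=> z;
      rewrite flat_cons.
    apply: FPT_cat; first exact: FPL_pmap.
    by apply: (FPT_rev Ltr_hash); apply: FPL_pmap.
  apply: FPT_ext (FPT_cat (FPT_flat (FPL_pcs 0)) (FPT_rconsO FPL_fpart)) _.
  by move=> z; rewrite flat_rcons.
- have h := FPB_empty (Mk Hash) (FP_zblocks (FPB_neg FPB_blk_ok)).
  apply: FPB_ext h _ => z.
  by elim: (zblocks z) => //= b bl <-; case: (blk_ok b).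
(* The ticks are written in unary and compared with a fixed word of length [n]. *)
- have h : FPT (fun _ : unit => Mk Sep) (fun z => nseq (count is_tick (zblocks z)) tt).
    have h1 : FP (fun b => if is_tick b then [:: Mk Sep] else [::]).
      apply: FP_ext (FP_comp (FP_hom (fun=> [:: Mk Sep])) (FPB_head (Mk KTick))) _ => b.
      by rewrite /is_tick; case: eqP.
    apply: FP_ext (FP_zblocks h1) _ => z.
    by elim: (zblocks z) => //= b bl ->; case: (is_tick b).
  have sh : (Mk Sep == Mk Hash) = false by apply/eqP.
  have inj : injective (fun _ : unit => Mk Sep) by case; case.
  have := FPB_eq (Mk Hash) inj (fun _ => sh) h (FPT_const _ (nseq n tt)).
  move=> h'; apply: FPB_ext h' _ => z.
  apply/eqP/eqP => [/(congr1 size)|->] //; by rewrite !size_nseq.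
- have h1 : FPB (fun z => pmap dqr z != [::]).
    have h := FPB_nonempty (Mk Hash) (FPL_pmap dqr).
    by apply: FPB_ext h _ => z; case: (pmap dqr z).
  have h2 := FPB_or (FPB_and FPB_crits h1) (FPB_and (FPB_neg FPB_crits) (FPB_neg h1)).
  by apply: FPB_ext h2 _ => z; case: (crits z); case: (_ != _).
Qed.

End Checker.

(** * Certificates and traces *)

Section Invariance.
Variables (Sg : alphabet) (A : system Sg) (CS : crit_spec Sg).
Implicit Types (S : config Sg) (tr : seq (rule Sg * config Sg)).

Lemma fires_perml (rl : rule Sg) S S1 S' : perm_eq S S1 -> fires rl S1 S' -> fires rl S S'.
Proof.
move=> h; case: rl => [|r] /=.
  by case=> t [R [h1 h2]]; exists t, R; split=> //; apply: perm_trans h h1.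
case=> sg [tau [R [h1 h2 h3 h4 h5]]]; exists sg, tau, R; split=> //.
exact: perm_trans h h4.
Qed.

Lemma must_tick_perm S S1 : perm_eq S S1 -> must_tick A S -> must_tick A S1.
Proof.
by move=> h mt r rA [S' f]; apply: (mt r rA); exists S'; apply: fires_perml f.
Qed.

Lemma is_critical_perm S S1 : perm_eq S S1 -> is_critical CS S -> is_critical CS S1.
Proof.
rewrite perm_sym => h [c [sg [tau [R [h1 h2 h3 h4]]]]]; exists c, sg, tau, R; split=> //.
exact: perm_trans h h4.
Qed.

Lemma is_trace_perm S S1 tr : perm_eq S S1 -> is_trace A S1 tr -> is_trace A S tr.
Proof.
by move=> h; case: tr => [|[rl S'] tr] //= [h1 h2 h3]; split=> //; apply: fires_perml h2.
Qed.

Lemma lazy_perm S S1 tr : perm_eq S S1 -> lazy_sampling A S1 tr -> lazy_sampling A S tr.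
Proof.
move=> h; case: tr => [|[rl S'] tr] //= [h1 h2]; split=> // e.
by apply: must_tick_perm (h1 e); rewrite perm_sym.
Qed.

Definition meets_critical S tr := exists2 S1, S1 \in trace_configs S tr & is_critical CS S1.

Lemma meets_critical_nil S : meets_critical S [::] <-> is_critical CS S.
Proof.
split=> [[S1]|h]; first by rewrite inE => /eqP ->.
by exists S; rewrite ?inE.
Qed.

Lemma meets_critical_cons S rl S' tr :
  meets_critical S ((rl, S') :: tr) <-> is_critical CS S \/ meets_critical S' tr.
Proof.
split=> [[S1]|[h|[S1 h1 h2]]].
- by rewrite inE => /orP[/eqP -> h|h h']; [left | right; exists S1].
- by exists S; rewrite ?inE ?eqxx.
- by exists S1; rewrite // inE h1 orbT.
Qed.

Lemma meets_criticalE S tr :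
  meets_critical S tr <-> is_critical CS S \/ exists2 u, u \in tr & is_critical CS u.2.
Proof.
split=> [[S1]|[h|[u h1 h2]]].
- rewrite inE => /orP[/eqP -> h|/mapP[u hu ->] h]; [by left | by right; exists u].
- by exists S; rewrite ?inE ?eqxx.
- by exists u.2; rewrite // inE; apply/orP; right; apply: map_f.
Qed.

Lemma is_trace_config S tr : is_config S -> is_trace A S tr ->
  forall S', S' \in trace_configs S tr -> is_config S'.
Proof.
elim: tr S => [|[rl S1] tr IH] S cS /=; first by move=> _ S'; rewrite inE => /eqP ->.
move=> [_ f t] S'; rewrite inE => /orP[/eqP -> //|h].
apply: (IH S1) => //; case: rl f {h} => [|r] /=; last by case=> sg [tau [R []]].
case=> t0 [R [h1 h2]]; rewrite (perm_config h2); move: cS; rewrite (perm_config h1).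
by [].
Qed.

End Invariance.

(** * Soundness and completeness of lists of blocks *)

Section Certificates.
Variables (Sg : alphabet) (A : system Sg) (CS : crit_spec Sg).
Variables (Mc Mm : machine (letter Sg)) (Lc Lm : language (letter Sg)).
Hypothesis wfA : all (@wf_irule Sg) A.
Hypothesis LcP : forall S, is_config S -> (Lc (encode S) <-> is_critical CS S).
Hypothesis LmP : forall S, is_config S -> (Lm (encode S) <-> must_tick A S).
Notation sym := (sym A Mc Mm).
Notation blk_ok := (@blk_ok Sg A Mc Mm Lm).
Implicit Types (S : config Sg) (tr : seq (rule Sg * config Sg)).

Lemma blk_sound (b : seq sym) S : blk_ok b -> is_config S -> inn b = encode S ->
  exists S', [/\ outt b = encode S', is_config S' &
    if is_tick b then fires Tick S S' /\ must_tick A S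
    else perm_eq S S' \/ exists2 r, r \in A & fires (Inst r) S S'].
Proof.
move=> hb cS eb; case/or3P: hb.
- move=> /and3P[ht hok hm]; have [S' [h1 h2 h3]] := tick_sound cS eb hok.
  by exists S'; rewrite ht; split=> //; split=> //; apply/LmP; rewrite -?eb.
- move=> /andP[hk hok]; have [S' [h1 h2]] := swap_sound eb hok.
  exists S'; rewrite -(perm_config h2) /is_tick (eqP hk) (inj_eq Some_inj).
  by case: eqP => // _; split=> //; left.
- case/hasP=> i _ /andP[hk hok].
  have iA := mem_tnth i (in_tuple A).
  have [S' [h1 h2 h3]] := rule_sound (allP wfA _ iA) cS eb hok.
  exists S'; rewrite /is_tick (eqP hk) (inj_eq Some_inj).
  by case: eqP => // _; split=> //; right; exists (tnth (in_tuple A) i).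
Qed.

Lemma blocks_sound (bl : seq (seq sym)) S fin : is_config S -> all blk_ok bl ->
  encode S :: map (@outt _ _ _ _) bl = rcons (map (@inn _ _ _ _) bl) fin ->
  exists tr, [/\ is_trace A S tr, lazy_sampling A S tr,
    ticks tr = count (@is_tick _ _ _ _) bl
    & meets_critical CS S tr <-> has (fun b => Lc (inn b)) bl || Lc fin].
Proof.
elim: bl S => [|b bl IH] S cS /=.
  by move=> _ [<-]; exists [::]; split=> //; rewrite meets_critical_nil LcP.
case/andP=> hb hbl [eb echain].
have [S' [eS' cS' hstep]] := blk_sound hb cS (esym eb).
rewrite eS' in echain; have [tr [h1 h2 h3 h4]] := IH S' cS' hbl echain.
rewrite -eb; case: ifP hstep => ht.
  move=> [hf hm]; exists ((Tick, S') :: tr); split=> //=.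
  - by rewrite /ticks /= -/(ticks tr) h3 ?ht ?eqxx.
  - by rewrite -orbA meets_critical_cons h4 -(LcP cS); split=> [[->|->]|/orP];
    rewrite ?orbT.
(* An exchange adds no step: being a lazy trace and meeting a critical configuration depend on the
   start only as a multiset, so the trace from [S'] serves for [S]. *)
case=> [hp|[r rA hf]].
  exists tr; split=> //; rewrite ?ht //.
  - exact: is_trace_perm hp h1.
  - exact: lazy_perm hp h2.
  - rewrite -orbA; split.
      case/meets_criticalE=> [/(LcP cS) -> //|h]; apply/orP; right; apply/h4.
      by apply/meets_criticalE; right.
    case/orP=> [/(LcP cS) h|/h4 /meets_criticalE[h|h]]; apply/meets_criticalE;
      [by left| |by right].
    by left; apply: is_critical_perm h; rewrite perm_sym.
exists ((Inst r, S') :: tr); split=> //=.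
- by split=> //; rewrite inE map_f // orbT.
- by rewrite -orbA meets_critical_cons h4 -(LcP cS); split=> [[->|->]|/orP]; rewrite ?orbT.
Qed.

Definition mkb (k : mark + 'I_(size A)) (ps : seq (seq (letter Sg))) : seq (cert A) :=
  inr k :: flatten [seq rcons (map inl p) (inr (inl Sep)) | p <- ps].
Definition tosym : cert A -> sym := inl.

Lemma pcs_mkb j k ps : k != inl Sep -> pcs j (map tosym (mkb k ps)) = nth [::] ps j.
Proof.
move=> hk; rewrite /= ifF; last by apply/eqP => -[e]; rewrite e eqxx in hk.
have -> : (if (j, dL (tosym (inr k))) is (0, Some l) then
  l :: pcs j (map tosym (flatten [seq rcons (map inl p) (inr (inl Sep)) | p <- ps]))
  else pcs j (map tosym (flatten [seq rcons (map inl p) (inr (inl Sep)) | p <- ps])))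
  = pcs j (map tosym (flatten [seq rcons (map inl p) (inr (inl Sep)) | p <- ps]))
    by case: j.
elim: ps j => [|p ps IH] j /=; first by rewrite nth_nil.
rewrite map_cat map_rcons cat_rcons -map_comp.
elim: p => [|l p IHp] /=; first by rewrite eqxx; case: j.
by case: j IHp => [|j] /= ->.
Qed.

(** A block free of the two delimiters is recovered intact when the certificate is cut up again. *)
Definition cert_ok (Bd : nat) (b : seq (cert A)) :=
  [&& inr (inl Blk) \notin b, inr (inl Fin) \notin b & size b <= Bd].

Lemma mkb_ok k ps P B : k != inl Blk -> k != inl Fin -> size ps <= P ->
  all (fun p => size p <= B) ps -> cert_ok (1 + P * (B + 1)) (mkb k ps).
Proof.
move=> kB kF hs hp; apply/and3P; split.
- rewrite inE negb_or; apply/andP; split; first by apply/eqP => -[e]; rewrite e eqxx in kB.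
  apply/negP => /flattenP[s /mapP[p _ ->]]; rewrite mem_rcons inE => /orP[/eqP //|].
  by case/mapP.
- rewrite inE negb_or; apply/andP; split; first by apply/eqP => -[e]; rewrite e eqxx in kF.
  apply/negP => /flattenP[s /mapP[p _ ->]]; rewrite mem_rcons inE => /orP[/eqP //|].
  by case/mapP.
- rewrite /= ltnS; apply: leq_trans (_ : size ps * (B + 1) <= _);
  last by rewrite leq_mul2r hs orbT.
  elim: ps {hs} hp => //= p ps IH /andP[hp /IH h].
  by rewrite size_cat size_rcons size_map mulSn; apply: leq_add => //; lia.
Qed.

Fixpoint chain X (bl : seq (seq sym)) Y : Prop :=
  if bl is b :: bl' then inn b = X /\ chain (outt b) bl' Y else X = Y.

Lemma chain_cat X bl Y bl' Z : chain X bl Y -> chain Y bl' Z -> chain X (bl ++ bl') Z.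
Proof. by elim: bl X => [|b bl IH] X /= => [-> //|[-> /IH h] /h]. Qed.

Lemma chainE X bl Y : chain X bl Y ->
  X :: map (@outt _ _ _ _) bl = rcons (map (@inn _ _ _ _) bl) Y.
Proof. by elim: bl X => [|b bl IH] X /= => [-> //|[-> /IH ->]]. Qed.

Lemma size_encode_perm S S' : perm_eq S S' -> size (encode S) = size (encode S').
Proof.
move=> h; rewrite /encode !size_flatten /shape -!map_comp; apply: perm_sumn.
exact: perm_map.
Qed.

Lemma size_encode_mem f S : f \in S -> size (encode_tfact f) <= size (encode S).
Proof.
elim: S => //= g S IH; rewrite inE => /orP[/eqP ->|/IH h]; rewrite /encode /= size_cat.
  exact: leq_addr.
exact: leq_trans h (leq_addl _ _).
Qed.

(** An exchange has 6 pieces, a tick 4, and a rule three words plus one for each listed variable.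
    With pieces of length at most [B], the head and the [Sep] marks give block length at most
    [1 + npieces * (B + 1)]. *)
Definition npieces := 6 + \max_(r <- A) (3 + size (rule_tvars r) + size (rule_vars r)).

Definition swap_like Bd S (b : seq (cert A)) :=
  [/\ blk_ok (map tosym b), ~~ is_tick (map tosym b : seq sym), cert_ok Bd b &
      exists2 S1, inn (map tosym b) = encode S1 & perm_eq S S1].

(** Selection sort: [S0] is already in place, and one exchange brings the next fact of [S'] to the
    front of the remaining ones. Hence there is one block for each fact of [S']. *)
Lemma swaps_complete S0 S S' B : perm_eq S S' -> size (encode (S0 ++ S)) <= B ->
  exists bl, [/\ chain (encode (S0 ++ S)) (map (map tosym) bl) (encode (S0 ++ S')),
    size bl = size S' & forall b, b \in bl ->
      swap_like (1 + npieces * (B + 1)) (S0 ++ S) b].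
Proof.
elim: S' S0 S => [|f S' IH] S0 S hp hB.
  by exists [::]; split=> //; rewrite (perm_nilP hp).
have fS : f \in S by rewrite (perm_mem hp) mem_head.
case/splitPr: fS hp hB => S1 S2 hp hB.
have hp' : perm_eq (S1 ++ S2) S'.
  by rewrite -(perm_cons f) -[f :: S1 ++ S2]cat1s perm_catCA.
have hp0 : perm_eq (S0 ++ S1 ++ f :: S2) (rcons S0 f ++ S1 ++ S2).
  by rewrite cat_rcons perm_cat2l -[f :: S2]cat1s perm_catCA.
have hB' : size (encode (rcons S0 f ++ S1 ++ S2)) <= B by rewrite -(size_encode_perm hp0).
have [bl [hc hs hb]] := IH (rcons S0 f) (S1 ++ S2) hp' hB'.
pose b := mkb (inl KSwap) [:: encode (S0 ++ S1 ++ f :: S2); encode (rcons S0 f ++ S1 ++ S2);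
  encode S0; encode S1; encode [:: f]; encode S2].
have pb j : pcs j (map tosym b) = nth [::] [:: encode (S0 ++ S1 ++ f :: S2);
    encode (rcons S0 f ++ S1 ++ S2); encode S0; encode S1; encode [:: f]; encode S2] j.
  by rewrite /b pcs_mkb //; apply/eqP.
exists (b :: bl); split.
- rewrite /= /inn /outt !pb /=; split=> //.
  by move: hc; rewrite (cat_rcons f S0 S').
- by rewrite /= hs.
move=> c; rewrite inE => /orP[/eqP ->|/hb[h1 h2 h3 [S3 e3 p3]]]; last first.
  by split=> //; exists S3 => //; apply: perm_trans hp0 p3.
split.
- apply/or3P; apply: Or32; rewrite /swap_blk /inn /outt !pb eqxx /=.
  by have := swap_complete S0 S1 [:: f] S2; rewrite cat_rcons.
- by rewrite /is_tick /= (inj_eq Some_inj); apply/eqP.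
- apply: mkb_ok => //; try by apply/eqP.
  have hs4 : size (encode S0) + (size (encode S1) + (size (encode [:: f]) + size (encode
    S2))) <= B.
    by move: hB; rewrite -[f :: S2]cat1s !encode_cat !size_cat.
  move: hs4 hB hB'; move: (encode (S0 ++ _)) (encode (rcons _ _ ++ _)) => x y.
  move: (encode S0) (encode S1) (encode [:: f]) (encode S2) => u1 u2 u3 u4 h /= -> ->.
  have [h1 h2] : size u1 <= B /\ size u2 <= B by split; lia.
  have [h3 h4] : size u3 <= B /\ size u4 <= B by split; lia.
  by rewrite h1 h2 h3 h4.
- by exists (S0 ++ S1 ++ f :: S2) => //; rewrite /inn pb.
Qed.

(** The value of a variable is a subword of an encoded fact; thus the pieces that carry
    substitutions are no longer than the configurations. *)
Lemma size_subst_var sg v t : v \in @term_vars Sg t ->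
  size (encode_term (sg v)) <= size (encode_term (subst sg t)).
Proof.
move: t; fix IH 1; case=> [w|f ts] /=; first by rewrite inE => /eqP ->.
elim: ts => //= t ts h; rewrite mem_cat size_cat => /orP[/IH hv|/h hv].
  by apply: leq_trans hv _; rewrite -addnS leq_addr.
by apply: leq_trans hv _; rewrite ltnS leq_addl.
Qed.

Lemma size_subst_atom_var sg v (a : atom Sg) t : v \in atom_vars a ->
  size (encode_term (sg v)) <= size (encode_tfact (Pred (subst_atom sg a), t)).
Proof.
rewrite /encode_tfact /= size_cat => hv.
apply: leq_trans (_ : size (flatten (map (@encode_term Sg) (map (subst sg) a.2))) <= _);
  last by rewrite leqW // leq_addr.
move: hv; rewrite /atom_vars; elim: a.2 => //= u ts h; rewrite mem_cat size_cat.
by case/orP=> [/size_subst_var hv|/h hv];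
  [apply: leq_trans (hv sg) (leq_addr _ _) | apply: leq_trans hv (leq_addl _ _)].
Qed.

Lemma rule_block_complete (i : 'I_(size A)) sg tau R B :
  let r := tnth (in_tuple A) i in
  let S := (Time, tau tT) :: pre_inst sg tau (wpre r) ++ pre_inst sg tau (fpre r) ++ R in
  let S' := (Time, tau tT) :: pre_inst sg tau (wpre r) ++ post_inst sg (tau tT) (post r)
    ++ R in
  sorted_subst sg -> all (holds tau) (guard r) -> is_config S -> is_config S' ->
  size (encode S) <= B -> size (encode S') <= B ->
  exists b, [/\ inn (map tosym b : seq sym) = encode S,
    outt (map tosym b : seq sym) = encode S',
    blk_ok (map tosym b), ~~ is_tick (map tosym b : seq sym) & cert_ok (1 + npieces * (B
      + 1)) b].
Proof.
move=> r S S' sgs hg cS cS' hB hB'.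
have iA : r \in A := mem_tnth i (in_tuple A).
pose ps := [:: encode S; encode S';
  encode R] ++ [seq map (bitl Sg) (bits (tau x)) | x <- rule_tvars r]
  ++ [seq encode_term (sg v) | v <- rule_vars r].
pose b := mkb (inr i) ps.
have pb j : pcs j (map tosym b) = nth [::] ps j by rewrite /b pcs_mkb.
have nth3 j : nth [::] ps (3 + j) = nth [::] ([seq map (bitl Sg) (bits (tau x)) | x <-
  rule_tvars r]
    ++ [seq encode_term (sg v) | v <- rule_vars r]) j by [].
have pt x : x \in rule_tvars r -> tpc r (map tosym b) x = bits (tau x).
  move=> hx; rewrite /tpc /tb pb nth3 nth_cat size_map index_mem hx.
  rewrite (nth_map tT) ?index_mem // nth_index //.
  by elim: (bits _) => //= c u ->.
have pv v : v \in rule_vars r -> vpc r (map tosym b) v = encode_term (sg v).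
  move=> hv; rewrite /vpc pb -addnA nth3 nth_cat size_map ltnNge leq_addr /= addKn.
  by rewrite (nth_map v) ?index_mem // nth_index.
exists b; split; rewrite /inn /outt ?pb //.
- apply/or3P; apply: Or33; apply/hasP; exists i; first by rewrite mem_enum.
  rewrite /rule_blk eqxx -/r /inn /outt !pb /=.
  by apply: (@rule_complete _ r sg tau R) => //; apply: (allP wfA).
apply: mkb_ok => //.
  rewrite /ps !size_cat !size_map /npieces.
  have := leq_bigmax_seq (P := predT) (F :=
    fun r => 3 + size (rule_tvars r) + size (rule_vars r)) r iA isT.
  by move=> h; apply: leq_trans (leq_trans _ h) (leq_addl _ _); rewrite addnA.
have inS f : f \in S -> size (encode_tfact f) <= B.
  by move=> h; apply: leq_trans (size_encode_mem h) hB.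
have inS' f : f \in S' -> size (encode_tfact f) <= B.
  by move=> h; apply: leq_trans (size_encode_mem h) hB'.
have pre_in w : w \in wpre r ++ fpre r -> (Pred (subst_atom sg w.1), tau w.2) \in S.
  move=> hw; rewrite inE catA mem_cat -map_cat; apply/orP; right; apply/orP; left.
  exact: (map_f (fun p : atom Sg * nat => (Pred (subst_atom sg p.1), tau p.2)) hw).
have bits_le f t : size (bits t) <= size (encode_tfact ((f, t) : tfact Sg)).
  by rewrite /encode_tfact /= size_cat size_map leq_addl.
rewrite !all_cat /= hB hB' /=; apply/andP; split; last (apply/andP; split).
- by rewrite andbT; apply: leq_trans hB;
  rewrite /S encode_cons !encode_cat !size_cat !addnA leq_addl.
- apply/andP; split.
    by rewrite size_map; apply: leq_trans (bits_le Time _) _; apply: inS; rewrite inE eqxx.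
  apply/allP => p /mapP[x /mapP[w hw ->] ->]; rewrite size_map.
  by apply: leq_trans (bits_le (Pred (subst_atom sg w.1)) _) _; apply: inS; apply: pre_in.
- apply/allP => p /mapP[v /flattenP[s /mapP[w hw ->] hv] ->].
  move: hw; rewrite catA mem_cat => /orP[hw|hw].
    apply: leq_trans (size_subst_atom_var sg (tau w.2) hv) _.
    by apply: inS; apply: pre_in.
  apply: leq_trans (size_subst_atom_var sg (tau tT + w.2) hv) _.
  apply: inS'; rewrite inE !mem_cat; apply/orP; right; apply/orP; right; apply/orP; left.
  exact: (map_f (fun p : atom Sg * nat => (Pred (subst_atom sg p.1), tau tT + p.2)) hw).
Qed.

Lemma tick_block_complete t R B :
  is_config ((Time, t) :: R) -> must_tick A ((Time, t) :: R) ->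
  size (encode ((Time, t) :: R)) <= B -> size (encode ((Time, t.+1) :: R)) <= B ->
  exists b, [/\ inn (map tosym b : seq sym) = encode ((Time, t) :: R),
    outt (map tosym b : seq sym) = encode ((Time, t.+1) :: R),
    blk_ok (map tosym b), is_tick (map tosym b : seq sym) & cert_ok (1 + npieces * (B +
      1)) b].
Proof.
move=> cS mt hB hB'.
pose ps := [:: encode ((Time, t) :: R); encode ((Time, t.+1) :: R);
  map (bitl Sg) (bits t); encode R].
pose b := mkb (inl KTick) ps.
have pb j : pcs j (map tosym b) = nth [::] ps j by rewrite /b pcs_mkb //; apply/eqP.
have et : is_tick (map tosym b : seq sym) by rewrite /is_tick /= eqxx.
exists b; split; rewrite /inn /outt ?pb //.
- apply/or3P; apply: Or31; rewrite /tick_blk et /inn /outt /tb !pb /=.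
  have -> : pmap (@getbit Sg) (map (bitl Sg) (bits t)) = bits t
    by elim: (bits t) => //= c u ->.
  by rewrite tick_complete /=; apply/LmP.
- apply: mkb_ok; try by apply/eqP.
  rewrite /= hB hB' /= andbT; move: hB;
    rewrite encode_cons size_cat /encode_tfact /= !size_map.
  by move=> h; apply/andP; split; lia.
Qed.

(** Each step costs at most [m] exchanges, which list the facts in the order its rule wants, and one
    block for the step itself. [S1] is the listing left behind by the preceding block. *)
Lemma trace_complete tr S S1 m B : is_config S -> perm_eq S S1 ->
  is_trace A S tr -> lazy_sampling A S tr ->
  (forall S', S' \in trace_configs S tr -> size S' <= m /\ size (encode S') <= B) ->
  exists bl fin, [/\ chain (encode S1) (map (map tosym) bl) fin,
    all (fun b => blk_ok (map tosym b)) bl /\ all (cert_ok (1 + npieces * (B + 1))) bl,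
    count (fun b => is_tick (map tosym b : seq sym)) bl = ticks tr,
    has (fun b => Lc (inn (map tosym b : seq sym))) bl || Lc fin <-> meets_critical CS S tr
    & size bl <= size tr * (m + 1) /\ size fin <= B].
Proof.
elim: tr S S1 => [|[rl S'] tr IH] S S1 cS hp /=.
  move=> _ _ h; exists [::], (encode S1); split=> //.
  - rewrite /= meets_critical_nil LcP; last by rewrite -(perm_config hp).
    by split; apply: is_critical_perm; rewrite // perm_sym.
  - by split=> //; rewrite -(size_encode_perm hp); case: (h S (mem_head _ _)).
move=> [rlA hf htr] [hl hlz] hB.
have cS' : is_config S'.
  by apply: (is_trace_config (A := A) cS (tr := [:: (rl, S')])); rewrite //= !inE eqxx orbT.
have hB' T : T \in trace_configs S' tr -> size T <= m /\ size (encode T) <= B.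
  by move=> hT; apply: hB; rewrite inE hT orbT.
have [szS enS] := hB S (mem_head _ _).
have [szS' enS'] := hB' S' (mem_head _ _).
suff [Sa [Sb [b [hpa hpb [e1 e2] [h1 h2 h3]]]]] : exists Sa Sb b, [/\ perm_eq S Sa,
  perm_eq S' Sb,
    inn (map tosym b : seq sym) = encode Sa /\ outt (map tosym b : seq sym) = encode Sb &
    [/\ blk_ok (map tosym b), is_tick (map tosym b : seq sym) = (rl == Tick)
      & cert_ok (1 + npieces * (B + 1)) b]].
  have [bl [fin [c1 [c2 c3] c4 c5 [c6 c7]]]] := IH S' Sb cS' hpb htr hlz hB'.
  have hp1a : perm_eq S1 Sa by rewrite -(permPl hp).
  have [|bs [s1 s2 s3]] := @swaps_complete [::] S1 Sa B hp1a.
    by rewrite /= -(size_encode_perm hp).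
  (* The configurations between exchanges are listings of [S], so they raise the critical flag only
     if [S] does. *)
  have crit_swap c : c \in bs -> Lc (inn (map tosym c : seq sym)) <-> is_critical CS S.
    case/s3=> _ _ _ [S2 -> p2]; have p2' : perm_eq S S2 by apply: perm_trans hp p2.
    rewrite LcP; last by rewrite -(perm_config p2').
    by split; apply: is_critical_perm; rewrite // perm_sym.
  exists (bs ++ b :: bl), fin; split.
  - rewrite map_cat; apply: chain_cat s1 _.
    by rewrite /= e1 e2.
  - by rewrite !all_cat /= h1 h3 c2 c3 !andbT; split; apply/allP => c /s3[].
  - have e0 : count (fun b => is_tick (map tosym b : seq sym)) bs = 0.
      by apply/eqP; rewrite -leqn0 leqNgt -has_count; apply/hasPn => c /s3[].
    by rewrite count_cat e0 /= h2 c4.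
  - rewrite has_cat /= e1 -!orbA meets_critical_cons -c5.
    have cSa : is_config Sa by rewrite -(perm_config hpa).
    have ca : Lc (encode Sa) <-> is_critical CS S.
      by rewrite LcP //; split; apply: is_critical_perm; rewrite // perm_sym.
    split.
      case/or3P=> [/hasP[c hc /(crit_swap c hc)]|/ca|h]; [by left|by left|by right].
    by case=> [/ca ->|->]; rewrite ?orbT.
  - split=> //; rewrite size_cat /= s2 -(perm_size hpa) mulSn addnS -addSn -addn1.
    by apply: leq_add; rewrite ?leq_add2r.
case: rl rlA hf hl {hB} => [|r] rlA hf hl.
  case: hf => t [R [p1 p2]]; exists ((Time, t) :: R), ((Time, t.+1) :: R).
  have [||||b [b1 b2 b3 b4 b5]] := @tick_block_complete t R B.
  - by rewrite -(perm_config p1).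
  - exact: must_tick_perm p1 (hl erefl).
  - by rewrite -(size_encode_perm p1).
  - by rewrite -(size_encode_perm p2).
  by exists b; rewrite b4 eqxx.
have rA : r \in A by move: rlA; rewrite inE /= => /mapP[r' r'A [->]].
have [i ei] : exists i : 'I_(size A), tnth (in_tuple A) i = r.
  by exists (Ordinal (eq_ind_r is_true rA (index_mem r A)));
    rewrite (tnth_nth r) /= nth_index.
case: hf => sg [tau [R [q1 q2 q3 q4 q5]]].
do 2!eexists; have := @rule_block_complete i sg tau R B; cbv zeta; rewrite ei.
case=> //.
- by rewrite -(perm_config q4).
- by rewrite -(perm_config q5).
- by rewrite -(size_encode_perm q4).
- by rewrite -(size_encode_perm q5).
move=> b [b1 b2 b3 b4 b5]; exists b; split; [exact: q4 | exact: q5 | by split | split=> //].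
by rewrite (negPf b4).
Qed.

End Certificates.

(** * Bounds on traces *)

Section Bounds.
Variables (Sg : alphabet) (A : system Sg).
Implicit Types (S R : config Sg) (tr : seq (rule Sg * config Sg)).

Lemma gtime_perm S t R : perm_eq S ((Time, t) :: R) -> is_config S -> gtime S = t.
Proof.
move=> hp; rewrite is_configE => /andP[_ /eqP hc]; rewrite /gtime.
pose p (f : tfact Sg) := f.1 == Time.
have h := perm_filter p hp.
have hs : size [seq f <- R | p f] = 0.
  by have := perm_size h; rewrite /= ?eqxx /= size_filter hc => -[].
have h1 : perm_eq [seq f <- S | p f] [:: (Time, t)].
  by move: h; rewrite /= ?eqxx (size0nil hs).
by rewrite (perm_small_eq _ h1).
Qed.

Lemma fires_config (rl : rule Sg) S S' : fires rl S S' -> is_config S -> is_config S'.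
Proof.
case: rl => [|r] /=; last by case=> sg [tau [R []]].
case=> t [R [h1 h2]]; rewrite (perm_config h1) (perm_config h2).
by [].
Qed.

Lemma fires_gtime (rl : rule Sg) S S' : fires rl S S' -> is_config S ->
  gtime S' = gtime S + (rl == Tick).
Proof.
move=> f cS; have cS' := fires_config f cS.
case: rl f => [|r] /=.
  by case=> t [R [h1 h2]]; rewrite (gtime_perm h1 cS) (gtime_perm h2 cS') ?eqxx addn1.
by case=> sg [tau [R [_ _ _ h1 h2]]]; rewrite (gtime_perm h1 cS) (gtime_perm h2 cS') addn0.
Qed.

Lemma gtime_trace S tr : is_config S -> is_trace A S tr ->
  gtime (last S (trace_configs S tr)) = gtime S + ticks tr.
Proof.
rewrite /trace_configs /=; elim: tr S => [|[rl S'] tr IH] S cS /=; first by rewrite addn0.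
by move=> [_ f h]; rewrite IH ?(fires_gtime f) ?(fires_config f) // addnA.
Qed.

Hypothesis progA : progressive A.

Lemma fires_size (rl : rule Sg) S S' : rl \in rules A -> fires rl S S' -> size S' = size S.
Proof.
case: rl => [|r] /= hr.
  by case=> t [R [h1 h2]]; rewrite (perm_size h1) (perm_size h2).
case=> sg [tau [R [_ _ _ h1 h2]]]; rewrite (perm_size h1) (perm_size h2).
have rA : r \in A by move: hr; rewrite inE => /orP[//|/mapP[r' r'A [->]]].
have [/eqP hb _ _] := progA rA.
by rewrite /= !size_cat !size_map hb.
Qed.

Lemma trace_size S tr : is_trace A S tr ->
  forall S', S' \in trace_configs S tr -> size S' = size S.
Proof.
elim: tr S => [|[rl S1] tr IH] S /=; first by move=> _ S'; rewrite inE => /eqP ->.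
move=> [hr f h] S'; rewrite inE => /orP[/eqP -> //|hS'].
by rewrite (IH S1 h S' hS') (fires_size hr f).
Qed.

Definition future S := count (fun f : tfact Sg => gtime S < f.2) S.

(* An instantaneous rule consumes no future fact and creates one. *)
Lemma future_inst r S S' : r \in A -> is_config S -> fires (Inst r) S S' ->
  future S < future S'.
Proof.
move=> rA cS f; have cS' := fires_config f cS; have eg := fires_gtime f cS.
case: f => sg [tau [R [_ hg _ h1 h2]]].
have [_ hpost hpre] := progA rA.
rewrite /future eg addn0 (permP h1) (permP h2) (gtime_perm h1 cS) /= ltnn !add0n !count_cat.
have -> : count (fun f : tfact Sg => tau tT < f.2) (pre_inst sg tau (fpre r)) = 0.
  have := hpre _ hg; elim: (fpre r) => //= w p IH /andP[hw /IH ->].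
  by rewrite ltnNge hw.
rewrite ltn_add2l add0n -[X in X < _]add0n ltn_add2r -has_count has_map.
by apply: sub_has hpost => w /=; lia.
Qed.

(** A potential argument: instantaneous steps raise [future], which never exceeds the number of
    facts. A tick may reset it, so each tick grants [(size S).+1] further units, one of them for
    itself. *)
Lemma trace_length S tr : is_config S -> is_trace A S tr ->
  size tr + future S <= (size S).+1 * (ticks tr).+1.
Proof.
elim: tr S => [|[rl S'] tr IH] S cS /=.
  by move=> _; rewrite muln1 add0n; apply: leqW; apply: count_size.
move=> [hr f h]; have := IH S' (fires_config f cS) h; rewrite (fires_size hr f).
have fut : future S <= size S by apply: count_size.
case: rl hr f => [|r] hr f; rewrite /ticks /= -/(ticks tr).
  rewrite ?eqxx /= add1n [X in _ -> _ <= X]mulnS; move: ((size S).+1 * (ticks tr).+1) => x.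
  by clear -fut; lia.
have rA : r \in A by move: hr; rewrite inE => /orP[//|/mapP[r' r'A [->]]].
have := future_inst rA cS f; rewrite add0n; move: ((size S).+1 * (ticks tr).+1) => x.
by clear -x; lia.
Qed.

Definition max_delay := \max_(r <- A) \max_(w <- post r) w.2.

Lemma max_delayP r w : r \in A -> w \in post r -> w.2 <= max_delay.
Proof.
move=> rA hw.
have h1 := leq_bigmax_seq (P := predT) (F := fun w : atom Sg * nat => w.2) w hw isT.
have h2 := leq_bigmax_seq (P := predT) (F :=
  fun r : irule Sg => \max_(w <- post r) w.2) r rA isT.
exact: leq_trans h1 h2.
Qed.

(** The invariant is that [X] bounds the global time and [X + max_delay] all timestamps. Ticks alone
    raise [X]; a rule creates facts at most [max_delay] ahead of the global time. *)
Lemma trace_stamps S tr X : is_trace A S tr ->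
  (forall f, f \in S -> f.2 <= X + max_delay) -> (forall t, (Time, t) \in S -> t <= X) ->
  forall S' f, S' \in trace_configs S tr -> f \in S' -> f.2 <= X + ticks tr + max_delay.
Proof.
elim: tr S X => [|[rl S1] tr IH] S X /=.
  by move=> _ h _ S' f; rewrite inE addn0 => /eqP ->; apply: h.
move=> [hr f h] hS hT S' g; rewrite inE => /orP[/eqP -> /hS hg|hS' hg].
  by apply: leq_trans hg _; rewrite -addnA leq_add2l leq_addl.
pose X1 := X + (rl == Tick).
have -> : X + ticks ((rl, S1) :: tr) = X1 + ticks tr by rewrite /ticks /= addnA.
suff [h1 h2] : (forall f, f \in S1 ->
  f.2 <= X1 + max_delay) /\ (forall t, (Time, t) \in S1 -> t <= X1).
  exact: (IH S1 X1 h h1 h2 S' g hS' hg).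
rewrite /X1; case: rl hr f {X1 h hS' hg IH} => [|r] hr /=.
  case=> t [R [p1 p2]]; rewrite ?eqxx.
  have ht : t <= X by apply: hT; rewrite (perm_mem p1) mem_head.
  split=> [f|t']; rewrite (perm_mem p2) inE => /orP[/eqP e|hf].
  - by rewrite e /=; lia.
  - by have := hS f; rewrite (perm_mem p1) inE hf orbT => /(_ isT); lia.
  - by case: e => ->; lia.
  - by have := hT t'; rewrite (perm_mem p1) inE hf orbT => /(_ isT); lia.
have rA : r \in A by move: hr; rewrite inE => /orP[//|/mapP[r' r'A [->]]].
case=> sg [tau [R [_ _ _ p1 p2]]]; rewrite addn0.
have ht : tau tT <= X by apply: hT; rewrite (perm_mem p1) mem_head.
split=> [f|t']; rewrite (perm_mem p2) inE !mem_cat => /or4P[].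
- by move/eqP=> -> /=; lia.
- by move=> hf; apply: hS; rewrite (perm_mem p1) inE !mem_cat hf orbT.
- by case/mapP=> w hw -> /=; apply: leq_add => //; apply: max_delayP hw.
- by move=> hf; apply: hS; rewrite (perm_mem p1) inE !mem_cat hf !orbT.
- by case/eqP=> ->.
- by case/mapP.
- by case/mapP.
- by move=> hf; apply: hT; rewrite (perm_mem p1) inE !mem_cat hf !orbT.
Qed.

Lemma size_encode_term (t : term Sg) : size (encode_term t) <= term_size t.
Proof.
move: t; fix IH 1; case=> [v|f ts] //=; rewrite ltnS.
by elim: ts => //= t ts h; rewrite size_cat leq_add.
Qed.

Lemma size_encode_le S k e :
  (forall f, f \in S -> fact_size f.1 <= k /\ f.2 < 2 ^ e) ->
  size (encode S) <= size S * (k + e).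
Proof.
elim: S => //= f S IH h; rewrite encode_cons size_cat mulSn; apply: leq_add; last first.
  by apply: IH => g hg; apply: h; rewrite inE hg orbT.
have [hk he] := h f (mem_head _ _).
rewrite /encode_tfact size_cat size_map; apply: leq_add (size_bits he).
apply: leq_trans hk; case: f.1 => //= a; rewrite ltnS.
by elim: a.2 => //= t ts h'; rewrite size_cat leq_add // size_encode_term.
Qed.

Lemma size_le_encode S : size S <= size (encode S).
Proof.
elim: S => //= f S IH; rewrite encode_cons size_cat.
by have [l [u [-> _]]] := encode_tfact_nonstart f; rewrite /= addSn ltnS;
  apply: leq_trans IH (leq_addl _ _).
Qed.

Lemma stamp_lt_encode S f : f \in S -> f.2 < 2 ^ size (encode S).
Proof.
move=> hf; apply: leq_trans (bits_size f.2) _; rewrite leq_exp2l //.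
apply: leq_trans (size_encode_mem hf); case: f {hf} => g t.
by rewrite /encode_tfact size_cat size_map leq_addl.
Qed.

(** At most [N] facts, each with at most [k] symbols and a timestamp of at most
    [N + n + max_delay + 1] bits. *)
Definition config_bound n k N := N * (k + (N + n + max_delay + 1)).

Lemma trace_bounds n k S tr : is_config S -> is_trace A S tr -> ticks tr = n ->
  fact_bound A S k ->
  let N := size (encode S) in
  size tr <= N.+1 * n.+1 /\
  forall S', S' \in trace_configs S tr ->
    size S' <= N /\ size (encode S') <= config_bound n k N.
Proof.
move=> cS ht tn hk N; have sN : size S <= N := size_le_encode S; split.
  have := trace_length cS ht; rewrite tn => h.
  apply: leq_trans (leq_trans (leq_addr _ _) h) _; rewrite leq_mul2r ltnS sN orbT.
  by [].
move=> S' hS'; have sS' := trace_size ht hS'; split; first by rewrite sS'.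
apply: leq_trans (size_encode_le (k := k) (e := N + n + max_delay + 1) _) _; last first.
  by rewrite sS' leq_mul2r sN orbT.
move=> f hf; split.
  by have /allP/(_ _ hS')/allP/(_ _ hf) := hk tr ht.
(* Each initial timestamp has at most [N] bits, so [2 ^ N] can play the part of [X] in
   [trace_stamps]. *)
have h2 : f.2 <= 2 ^ N + ticks tr + max_delay.
  apply: (trace_stamps ht _ _ hS' hf).
    by move=> g /stamp_lt_encode/ltnW hg; apply: leq_trans hg (leq_addr _ _).
  by move=> t /stamp_lt_encode/ltnW.
apply: leq_ltn_trans h2 _; rewrite tn.
have -> : N + n + max_delay + 1 = N + (n + max_delay).+1 by lia.
rewrite -addnA expnD expnS.
have h3 : n + max_delay < 2 ^ (n + max_delay) by apply: ltn_expl.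
have h4 : 0 < 2 ^ N by rewrite expn_gt0.
by move: (2 ^ N) (2 ^ _) h3 h4 => x y; nia.
Qed.
End Bounds.

(** * The oracle machine *)

Section OracleMachine.
Variables (X : finType) (O : language (X + X)%type).
Notation st := (bool * bool + bool)%type.

(** In state [inl (ph, false)] the input is scanned, rightwards for the first query and leftwards
    for the second; in [inl (ph, true)] the query is asked; [inr b] is the verdict. *)
Definition omach : machine X := @Machine X 0 st X id (inl (false, false))
  (fun q => if q is inr b then Some b else None)
  (fun q v => if q is inl (ph, false) then
     if v ord0 is Some a then (q, [ffun => (Some a, if ph then MoveL else MoveR)])
     else (inl (ph, true), [ffun => (None, if ph then Stay else MoveL)])
   else (q, [ffun => (None, Stay)])).

(* The second query is the reversed input, so that the head need not return. *)
Definition two_queries : oracle_machine X (X + X)%type :=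
  @OracleMachine X (X + X)%type omach
    (fun q => match q with
       | inl (false, true) => Some (inl (true, false), inr false)
       | inl (true, true) => Some (inr false, inr true)
       | _ => None end)
    (fun q v => if q is inl (ph, false) then
       omap (fun a => if ph then inr a else inl a) (v ord0) else None).

Let tp (t : tape X) : 'I_1 -> tape X := fun=> t.
Notation step := (@ostep X _ two_queries O).

Let tpE (f : 'I_1 -> tape X) t : f ord0 = t -> f = tp t.
Proof. by move=> e; apply: functional_extensionality => i; rewrite (ord1 i). Qed.

Let step_right a y l w :
  step ((inl (false, false), tp (Tape l (Some a) (map Some y))), w) =
  ((inl (false, false), tp (Tape (Some a :: l) (ohead y) (map Some (behead y)))),
    rcons w (inl a)).
Proof.
rewrite /ostep /= /mstep /= /mread !ffunE /=; congr (_, _, _); apply: tpE.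
by rewrite ffunE /=; case: y.
Qed.

Let step_turn l w : step ((inl (false, false), tp (Tape l None [::])), w) =
  ((inl (false, true), tp (Tape (behead l) (head None l) [:: None])), w).
Proof.
rewrite /ostep /= /mstep /= /mread !ffunE /=; congr (_, _, _); apply: tpE.
by rewrite ffunE.
Qed.

Let step_left a y r w :
  step ((inl (true, false), tp (Tape (map Some y) (Some a) r)), w) =
  ((inl (true, false), tp (Tape (map Some (behead y)) (ohead y) (Some a :: r))),
    rcons w (inr a)).
Proof.
rewrite /ostep /= /mstep /= /mread !ffunE /=; congr (_, _, _); apply: tpE.
by rewrite ffunE /=; case: y.
Qed.

Let step_end r w : step ((inl (true, false), tp (Tape [::] None r)), w) =
  ((inl (true, true), tp (Tape [::] None r)), w).
Proof.
rewrite /ostep /= /mstep /= /mread !ffunE /=; congr (_, _, _); apply: tpE.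
by rewrite ffunE.
Qed.

Let copy_right y l w :
  iter (size y) step ((inl (false, false), tp (Tape l (ohead y) (map Some (behead y)))), w)
  = ((inl (false, false), tp (Tape (rev (map Some y) ++ l) None [::])), w ++ map inl y).
Proof.
elim: y l w => [|a y IH] l w; first by rewrite cats0.
rewrite [size _]/= iterSr [ohead _]/= [behead _]/= step_right IH /=.
by rewrite rev_cons cat_rcons cat_rcons.
Qed.

Let copy_left v r w : exists r',
  iter (size v) step ((inl (true, false), tp (Tape (map Some (behead v)) (ohead v) r)), w)
  = ((inl (true, false), tp (Tape [::] None r')), w ++ map inr v).
Proof.
elim: v r w => [|a v IH] r w; first by exists r; rewrite cats0.
rewrite [size _]/= iterSr [ohead _]/= [behead _]/= step_left.
have [r' ->] := IH (Some a :: r) (rcons w (inr a)).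
by exists r'; rewrite cat_rcons.
Qed.

Let step_halt b t w k : iter k step ((inr b, t), w) = ((inr b, t), w).
Proof. by elim: k => //= k ->. Qed.

Lemma two_queries_P : in_P_oracle O (fun x => O (map inl x) && ~~ O (map inr (rev x))).
Proof.
(* In each phase there are [size x] copying steps, one step at the blank behind the word and one
   call of the oracle. *)
exists two_queries, (2%:P * 'X + 4%:P)%R => x; rewrite hornerD hornerCM hornerX !hornerC.
have -> : (2 * size x + 4)%R = (2 + size x) + (2 + size x)
  by rewrite -[LHS]/(2 * size x + 4)%N; lia.
have it2 c : iter 2 step c = step (step c) by [].
rewrite !iterD !it2.
have -> : minit (base two_queries) x = (inl (false, false),
  tp (Tape [::] (ohead x) (map Some (behead x)))).
  congr pair; apply: tpE; rewrite /= map_id.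
  by case: x.
rewrite copy_right cats0 step_turn cat0s.
have ask1 t w : step ((inl (false, true), t), w) =
    ((if O w then inl (true, false) else inr false, t), [::]) by [].
have ask2 t w : step ((inl (true, true), t), w) =
    ((if O w then inr false else inr true, t), [::]) by [].
rewrite ask1; case: (O (map inl x)); last by rewrite -it2 !step_halt.
have -> : Tape (behead (rev (map Some x))) (head None (rev (map Some x))) [:: None]
    = Tape (map Some (behead (rev x))) (ohead (rev x)) [:: None].
  by rewrite -map_rev; case: (rev x).
rewrite -(size_rev x); have [r' ->] := copy_left (rev x) [:: None] [::].
by rewrite step_end ask2 cat0s; case: (O _).
Qed.

End OracleMachine.

(** * Survivability *)

Section Survivability.
Variables (Sg : alphabet) (A : system Sg) (CS : crit_spec Sg) (n : nat).
Variables (Mc Mm : machine (letter Sg)) (Lc Lm : language (letter Sg)).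
Hypotheses (wfA : all (@wf_irule Sg) A) (progA : progressive A).
Hypothesis LcP : forall S, is_config S -> (Lc (encode S) <-> is_critical CS S).
Hypothesis LmP : forall S, is_config S -> (Lm (encode S) <-> must_tick A S).
Variables (pc pm q : {poly nat}).
Hypothesis McP : forall x, verdict (iter pc.[size x]%R (@mstep _ Mc) (minit Mc x)).1 =
  Some (Lc x).
Hypothesis MmP : forall x, verdict (iter pm.[size x]%R (@mstep _ Mm) (minit Mm x)).1 =
  Some (Lm x).
Notation query := (query Sg).
Notation cert := (cert A).
Notation sym := (sym A Mc Mm).
Implicit Types (S : config Sg) (tr : seq (rule Sg * config Sg)) (u : seq query) (w : seq
  cert).

Definition qsym (a : query) : sym := inr (inl a).
Definition zsym (a : query + cert) : sym :=
  match a with inl a => qsym a | inr c => tosym Mc Mm c end.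

Definition verifier (z : seq (query + cert)) := @check Sg A n Mc Mm Lc Lm (map zsym z).

Lemma verifier_P : in_P verifier.
Proof.
have [c [K [d [us h]]]] := @FPB_check Sg A n Mc Mm Lc Lm pc pm McP MmP.
have [p hp] := pb_polyP (ex_intro _ d (fun n => leqnn _) : pb (fun n => (n + 2) ^ d)).
have [M [p' hM]] := program_in_P zsym us (fun x => exec_le (hp _) (h x)).
exists M, p' => x; rewrite hM /verifier.
by case: (check _ _ _ _).
Qed.

Definition certificate (bl : seq (seq cert)) (fin : seq (letter Sg)) : seq cert :=
  flatten [seq rcons b (inr (inl Blk)) | b <- bl] ++ inr (inl Fin) :: map inl fin.

Lemma zsym_cat u w : map zsym (map inl u ++ map inr w) = map qsym u ++ map (tosym Mc Mm) w.
Proof. by rewrite map_cat -!map_comp. Qed.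

Lemma bpart_query u y : bpart (map qsym u ++ y) = bpart y.
Proof. by elim: u => //= a u <-; case: eqP. Qed.

Lemma fpart_query u y : fpart (map qsym u ++ y) = fpart y.
Proof. by elim: u => //= a u <-; case: eqP. Qed.

Lemma blocks_certificate Bd bl fin : all (cert_ok Bd) bl ->
  zblocks (map (tosym Mc Mm) (certificate bl fin)) = map (map (tosym Mc Mm)) bl.
Proof.
move=> hb; rewrite /zblocks /certificate map_cat /=.
have bp (y v : seq cert) : inr (inl Fin) \notin y ->
    bpart (map (tosym Mc Mm) y ++ Mk A Mc Mm Fin :: map (tosym Mc Mm) v) = map (tosym Mc
      Mm) y.
  elim: y => [|a y IH] /=; first by rewrite eqxx.
  rewrite inE negb_or => /andP[ha /IH ->]; case: eqP => // -[e].
  by rewrite -e eqxx in ha.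
rewrite bp; last first.
  apply/negP => /flattenP[s /mapP[b bb ->]]; rewrite mem_rcons inE => /orP[/eqP //|].
  by have /and3P[_ /negP h _] := allP hb _ bb.
have -> : map (tosym Mc Mm) (flatten [seq rcons b (inr (inl Blk)) | b <- bl]) =
    flatten [seq rcons b (Mk A Mc Mm Blk) | b <- map (map (tosym Mc Mm)) bl].
  by rewrite map_flatten -!map_comp; congr flatten; apply: eq_map => b /=;
    rewrite map_rcons.
apply: blocks_flatten; rewrite all_map; apply: sub_all hb => b /and3P[hb _ _] /=.
by apply/negP => /mapP[a ha [e]]; rewrite e ha in hb.
Qed.

Lemma fpart_certificate Bd bl fin : all (cert_ok Bd) bl ->
  fpart (map (tosym Mc Mm) (certificate bl fin)) = fin.
Proof.
move=> hb; rewrite /certificate map_cat /=.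
have fp (y v : seq cert) : inr (inl Fin) \notin y ->
    fpart (map (tosym Mc Mm) y ++ Mk A Mc Mm Fin :: map (tosym Mc Mm) v) = pmap (@dL _ _
      _ _) (map (tosym Mc Mm) v).
  elim: y => [|a y IH] /=; first by rewrite eqxx.
  rewrite inE negb_or => /andP[ha /IH ->]; case: eqP => // -[e].
  by rewrite -e eqxx in ha.
rewrite fp; first by elim: (fin) => //= l v ->.
apply/negP => /flattenP[s /mapP[b bb ->]]; rewrite mem_rcons inE => /orP[/eqP //|].
by have /and3P[_ /negP h _] := allP hb _ bb.
Qed.

Lemma size_certificate Bd bl fin : all (cert_ok Bd) bl ->
  size (certificate bl fin) <= size bl * (Bd + 1) + (size fin + 1).
Proof.
rewrite /certificate size_cat /= size_map => hb; apply: leq_add; last by rewrite addn1.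
elim: bl hb => //= b bl IH /andP[/and3P[_ _ hb] /IH h].
by rewrite size_cat size_rcons mulSn; apply: leq_add; rewrite // addn1.
Qed.

(** The factors are the length of the trace, the number of blocks per step, and the length of a
    block with its [Blk]; the last summand is the final configuration with [Fin]. The unknown [k] is
    replaced by its bound [q]. *)
Definition cert_bound (N : nat) :=
  let B := config_bound A n q.[N]%R N in
  (N.+1 * n.+1 * (N + 1)) * ((1 + npieces A * (B + 1)) + 1) + (B + 1).

Lemma cert_bound_poly : exists p : {poly nat}, forall N, cert_bound N <= p.[N]%R.
Proof.
apply: pb_polyP; have pq := pb_poly q.
apply: (@pb_le _ (fun N => ((N + 1) * (n + 1) * (N + 1)) * ((1 + npieces A *
  (N * (q.[N]%R + (N + n + max_delay A + 1)) + 1)) + 1) +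
  (N * (q.[N]%R + (N + n + max_delay A + 1)) + 1))) => [N|].
  by rewrite /cert_bound /config_bound !addn1.
by pb_tac.
Qed.

(* [md] tells whether a critical configuration is looked for or excluded. *)
Lemma query_correct u S m k Dmax (md : bool) (pw : {poly nat}) :
  (forall N, cert_bound N <= pw.[N]%R) ->
  admissible A CS S m k Dmax -> k <= q.[size (encode S)]%R ->
  xpart (map qsym u) = encode S -> (pmap (@dqr _ _ _ _) (map qsym u) != [::]) = md ->
  size u = size (encode S) ->
  (exists w, size w <= pw.[size u]%R /\ verifier (map inl u ++ map inr w)) <->
  exists tr, [/\ is_trace A S tr, lazy_sampling A S tr, ticks tr = n
    & meets_critical CS S tr <-> md].
Proof.
move=> hpw [cS _ hk _] kq eS emd su.
have qw (w : seq cert) : pmap (@dqr Sg A Mc Mm) (map (tosym Mc Mm) w) = [::] by elim: w.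
have qw' (w : seq cert) : pmap (@dql Sg A Mc Mm) (map (tosym Mc Mm) w) = [::] by elim: w.
have xz w : xpart (map qsym u ++ map (tosym Mc Mm) w) = encode S.
  by rewrite /xpart !pmap_cat qw qw' !cats0.
have mz w : (pmap (@dqr Sg A Mc Mm) (map qsym u ++ map (tosym Mc Mm) w) != [::]) = md.
  by rewrite pmap_cat qw cats0.
have bz w : zblocks (map qsym u ++ map (tosym Mc Mm) w) = zblocks (map (tosym Mc Mm) w).
  by rewrite /zblocks bpart_query.
split.
  move=> [w [_]]; rewrite /verifier zsym_cat /check /crits xz mz.
  case/and4P=> /eqP/flat_inj hc hb /eqP hn /eqP hcrit.
  have [tr [h1 h2 h3 h4]] := blocks_sound wfA LcP LmP cS hb hc.
  by exists tr; rewrite h3 hn -hcrit.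
move=> [tr [h1 h2 h3 h4]].
have [hs hS] := trace_bounds progA cS h1 h3 hk.
have [bl [fin [c1 [c2 c3] c4 c5 [c6 c7]]]] :=
  trace_complete Mc Mm wfA LcP LmP cS (perm_refl S) h1 h2 hS.
exists (certificate bl fin); split.
  apply: leq_trans (size_certificate fin c3) _; rewrite su; apply: leq_trans (hpw _).
  set N := size (encode S) in hs hS kq c3 c6 c7 *.
  have leB : config_bound A n k N <= config_bound A n q.[N]%R N.
    by rewrite /config_bound leq_mul2l leq_add2r kq orbT.
  rewrite /cert_bound; apply: leq_add; last by rewrite leq_add2r; apply: leq_trans c7 leB.
  apply: leq_mul; first by apply: leq_trans c6 _; rewrite leq_mul2r hs orbT.
  by rewrite leq_add2r leq_add2l leq_mul2l leq_add2r leB orbT.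
rewrite /verifier zsym_cat /check /crits xz mz !bz fpart_query.
rewrite (blocks_certificate _ c3) (fpart_certificate _ c3).
apply/and4P; split.
- by apply/eqP; congr flat; apply: chainE.
- by rewrite all_map.
- by rewrite count_map; apply/eqP; rewrite -h3 -c4.
- rewrite has_map /preim; apply/eqP; apply/idP/idP => h; first by apply/h4/c5.
  by apply/c5/h4.
Qed.

Lemma survivability_Delta2p : exists L : language (letter Sg), in_Delta2p L /\
  forall S m k Dmax, admissible A CS S m k Dmax -> k <= q.[size (encode S)]%R ->
    (L (encode S) <-> survivable A CS n S).
Proof.
have [pw hpw] := cert_bound_poly.
(* A language is a Boolean predicate, so the search for a certificate is a finite quantification
   over the admissible lengths and the words of each length. *)
pose O (u : seq query) : bool := [exists j : 'I_(pw.[size u]%R).+1,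
  [exists w : j.-tuple cert, verifier (map inl u ++ map inr w)]].
have OP u : O u <-> exists w, size w <= pw.[size u]%R /\ verifier (map inl u ++ map inr w).
  split=> [/existsP[j /existsP[w hw]]|[w [hs hw]]].
    by exists w; split=> //; rewrite size_tuple -ltnS.
  by apply/existsP; exists (Ordinal (hs : size w < (pw.[size u]%R).+1)); apply/existsP;
    exists (in_tuple w).
exists (fun x => O (map inl x) && ~~ O (map inr (rev x))); split.
  exists query, O; split; last exact: two_queries_P.
  by exists cert, verifier, pw; split; [apply: verifier_P | apply: OP].
move=> S m k Dmax adm kq; have cS : is_config S by case: adm.
(* The kind of a query is read off from the presence of [dqr] letters, which requires a nonempty
   word; a configuration contains [Time]. *)
have eS0 : encode S != [::].
  case: (S) cS => [|f S'] // _.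
  by rewrite encode_cons; have [l [v [-> _]]] := encode_tfact_nonstart f.
have l1 (x : seq (letter Sg)) : pmap (@dql Sg A Mc Mm) (map qsym (map inl x)) = x.
  by elim: x => //= a x ->.
have l2 (x : seq (letter Sg)) : pmap (@dqr Sg A Mc Mm) (map qsym (map inl x)) = [::].
  by elim: x.
have l3 (x : seq (letter Sg)) : pmap (@dql Sg A Mc Mm) (map qsym (map inr x)) = [::].
  by elim: x.
have l4 (x : seq (letter Sg)) : pmap (@dqr Sg A Mc Mm) (map qsym (map inr x)) = x.
  by elim: x => //= a x ->.
have Q1 : O (map inl (encode S)) <-> exists tr, [/\ is_trace A S tr, lazy_sampling A S tr,
    ticks tr = n & meets_critical CS S tr <-> false].
  apply: iff_trans (OP _) _; apply: (query_correct hpw adm kq).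
  - by rewrite /xpart l1 l2 cats0.
  - by rewrite l2.
  - by rewrite size_map.
have Q2 : O (map inr (rev (encode S))) <-> exists tr, [/\ is_trace A S tr,
  lazy_sampling A S tr,
    ticks tr = n & meets_critical CS S tr <-> true].
  apply: iff_trans (OP _) _; apply: (query_correct hpw adm kq).
  - by rewrite /xpart l3 l4 revK.
  - by rewrite l4 -size_eq0 size_rev size_eq0 eS0.
  - by rewrite size_map size_rev.
(* Realizability speaks of the advance of global time and the queries of the number of ticks;
   [gtime_trace] identifies the two. *)
have real : realizable A CS n S <-> exists tr, [/\ is_trace A S tr, lazy_sampling A S tr,
    ticks tr = n & meets_critical CS S tr <-> false].
  split=> [[tr [h1 h2 h3 h4]]|[tr [h1 h2 h3 h4]]]; exists tr; split=> //.
  - by apply/eqP; rewrite -(eqn_add2l (gtime S)) -(gtime_trace cS h1) h4.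
  - by split=> // -[S' /h3].
  - by move=> S' hS' hc; have /h4 : meets_critical CS S tr by exists S'.
  - by rewrite (gtime_trace cS h1) h3.
rewrite /survivable real -Q1; split.
  case/andP=> -> /negP hQ2; split=> // tr h1 h2 h3 S' hS' hc; apply: hQ2; apply/Q2.
  by exists tr; split=> //; split=> // _; exists S'.
case=> -> hall /=; apply/negP => /Q2[tr [h1 h2 h3 h4]].
by have [S' hS' hc] := (proj2 h4 isT); apply: (hall tr h1 h2 h3 S').
Qed.

End Survivability.

Theorem theorem4 (Sg : alphabet) (A : system Sg) (CS : crit_spec Sg) (n : nat)
    (wfA : all (@wf_irule Sg) A) (progA : progressive A)
    (wfCS : wf_crit_spec CS)
    (next : rule Sg -> config Sg -> bool)
    (critical mustTick : config Sg -> bool)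
    (nextP : forall (r : rule Sg) (S : config Sg), r \in rules A -> is_config S ->
       (next r S <-> applicable r S))
    (criticalP : forall S, is_config S -> (critical S <-> is_critical CS S))
    (mustTickP : forall S, is_config S -> (mustTick S <-> must_tick A S))
    (next_ptime : forall r : rule Sg, r \in rules A -> ptime_config (next r))
    (critical_ptime : ptime_config critical)
    (mustTick_ptime : ptime_config mustTick)
    (q : {poly nat}) :
  exists L : language (letter Sg), in_Delta2p L /\
    forall (S0 : config Sg) (m k Dmax : nat),
      admissible A CS S0 m k Dmax ->
      (k <= q.[size (encode S0)]%R)%N ->
      (L (encode S0) <-> survivable A CS n S0).
Proof.
have [Lc [[Mc [pc McP]] LcE]] := critical_ptime.
have [Lm [[Mm [pm MmP]] LmE]] := mustTick_ptime.
apply: (survivability_Delta2p n wfA progA _ _ q McP MmP) => S cS.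
- by rewrite LcE //; apply: criticalP.
- by rewrite LmE //; apply: mustTickP.
Qed.
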